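(* Let $(S,P)$ be a commuting pair of bounded operators on a Hilbert space $\mathcal H$ with $\|P\|\le 1$. Then $(S,P)$ is a $\Gamma$-contraction if and only if the spectral radius of $S$ is not greater than $2$ and there exists $A\in\mathcal B(\mathcal D_P)$ with numerical radius $\omega(A)\le1$ such that $$S-S^*P=\mathbf D_PA\mathbf D_P.$$
   Context: All Hilbert spaces are complex and separable. Let $\Gamma=\{(z_1+z_2,z_1z_2):|z_1|\le 1,|z_2|\le 1\}\subset\mathbb C^2$. A $\Gamma$-contraction on $\mathcal H$ is a pair $(S,P)$ of commuting bounded operators on $\mathcal H$ such that $\|f(S,P)\|\le\sup_{\Gamma}|f|$ for every polynomial $f$ in two variables. For a contraction $P$, $\mathbf D_P=(I-P^*P)^{1/2}$ and $\mathcal D_P=\overline{\mathrm{Ran}}\,\mathbf D_P$. The numerical radius of an operator $T$ is $\omega(T)=\sup\{|\langle Tx,x\rangle|:\|x\|\le1\}$. *)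

(* Defs.v *)
From HB Require Import structures.
From mathcomp Require Import all_boot all_order all_algebra.
From mathcomp Require Import all_classical all_reals all_analysis.
From mathcomp Require Import complex.

Set Implicit Arguments.
Unset Strict Implicit.
Unset Printing Implicit Defensive.

Import Order.TTheory GRing.Theory Num.Theory.
Import numFieldNormedType.Exports.

Local Open Scope classical_set_scope.
Local Open Scope ring_scope.

(* The inner product is linear in its first argument and conjugate-linear in
   its second one. *)
HB.mixin Record CompleteNormedModule_isHilbert (R : realType) H
    of CompleteNormedModule R[i] H := {
  inner : {dot H for (@Num.conj R[i])} ;
  inner_normE : forall x : H, inner x x = `|x| ^+ 2
}.

#[short(type="hilbertType")]
HB.structure Definition Hilbert (R : realType) :=
  {H of CompleteNormedModule_isHilbert R H & CompleteNormedModule R[i] H}.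

Definition separable (T : topologicalType) : Prop :=
  exists2 A : set T, countable A & dense A.

(* Norms over R[i] take their values in R[i] (with zero imaginary part);
   rnorm is the same norm with values in R. *)
Definition rnorm (R : realType) (V : normedZmodType R[i]) (x : V) : R :=
  complex.Re `|x|.

Section operators.
Variables (R : realType) (H : hilbertType R).
Implicit Types (T A : H -> H) (D : set H).

(* For a closed subspace D of H, an element of B(D) is represented by a
   function on H of which only the values on D matter. *)
Definition bounded_operator_on D A : Prop :=
  [/\ forall x, D x -> D (A x),
      forall (a : R[i]) x y, D x -> D y -> A (a *: x + y) = a *: A x + A y
    & exists M : R, forall x, D x -> rnorm (A x) <= M * rnorm x].

Definition bounded_operator T : Prop := bounded_operator_on setT T.

Definition op_norm T : \bar R :=
  ereal_sup [set (rnorm (T x))%:E | x in [set x : H | rnorm x <= 1]].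

Definition numerical_radius_on D A : \bar R :=
  ereal_sup [set (rnorm (inner (A x) x))%:E
            | x in [set x : H | D x /\ rnorm x <= 1]].

Definition spectrum T : set R[i] :=
  [set l | ~ exists2 U : H -> H, bounded_operator U &
             (forall x, U (T x - l *: x) = x) /\
             (forall x, T (U x) - l *: U x = x)].

(* The spectrum is empty exactly when H is the zero space; the supremum is
   then -oo, which is below every real bound, like the conventional value 0
   is below every nonnegative one. *)
Definition spectral_radius T : \bar R :=
  ereal_sup [set (rnorm l)%:E | l in spectrum T].

(* The unique such operator when T is bounded (Riesz). *)
Definition adjoint T : H -> H :=
  xget (fun=> 0) [set U : H -> H | bounded_operator U /\
                    forall x y, inner (T x) y = inner x (U y)].

(* 0 <= z in R[i] means that z is real and nonnegative. *)
Definition positive_operator T : Prop :=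
  bounded_operator T /\ forall x, 0 <= inner (T x) x.

(* The unique such operator when T is positive. *)
Definition sqrt_op T : H -> H :=
  xget (fun=> 0) [set B : H -> H | positive_operator B /\
                    forall x, B (B x) = T x].

Definition defect_op T : H -> H := sqrt_op (fun x => x - adjoint T (T x)).

Definition defect_space T : set H := closure (range (defect_op T)).

(* With f = \sum_(i, j) f_ij s^i p^j, so that f.[s, p] (from polyXY) is the
   value of f at a pair of scalars. *)
Definition poly_op (f : {poly {poly R[i]}}) S P : H -> H :=
  fun x => \sum_(i < size f) \sum_(j < size f`_i)
             f`_i`_j *: iter i S (iter j P x).

End operators.

Definition Gamma (R : realType) : set (R[i] * R[i]) :=
  [set sp | exists z1 z2 : R[i],
     [/\ rnorm z1 <= 1, rnorm z2 <= 1 & sp = (z1 + z2, z1 * z2)]].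

Definition Gamma_contraction (R : realType) (H : hilbertType R)
    (S P : H -> H) : Prop :=
  [/\ bounded_operator S, bounded_operator P,
      forall x, S (P x) = P (S x)
    & forall f : {poly {poly R[i]}},
        (op_norm (poly_op f S P) <=
           ereal_sup [set (rnorm f.[sp.1, sp.2])%:E | sp in @Gamma R])%E].

(* Main.v *)
From HB Require Import structures.
Require Import Defs.
From mathcomp Require Import all_boot all_order all_algebra.
From mathcomp Require Import all_classical all_reals all_analysis.
From mathcomp Require Import complex ring lra.
From mathcomp Require cyclic separable cyclotomic.

(** Write [F = S - S^* P] and [D = D_P]. Both sides of the equivalence are compared
    with the form inequality
      [|<F x, x>| <= |D x|^2 = |x|^2 - |P x|^2] for all [x],
    written as [Re <u F x, x> <= |D x|^2] for all unimodular [u].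

    The fundamental equation [F = D A D] with numerical radius of [A] at most [1]
    gives [|<F x, x>| = |<A (D x), D x>| <= |D x|^2] ([form_of_factorization]).
    Conversely, the
    inequality polarises to [|<F x, y>| <= 2 |D x| |D y|], and the Riesz
    representation theorem on the closed range of [D] provides [A]
    ([operator_of_form]).

    Necessity. For [|u| = 1] the function [(2 u p - s) / (2 - u s)] is bounded by [1] on
    [Gamma]. Inserting [(r S, r^2 P)] in the truncations of its power series and
    letting [r] tend to [1] gives [|(2 u P - S) x| <= |(2 - u S) x|], whose square is
    the form inequality ([mobius_contractive], [gamma_form_le]). The polynomial [s]
    gives [|S| <= 2], hence the bound on the spectral radius.

    Sufficiency. [(S, P)] dilates to a pair [(T, V)] in which [V] is Schaffer's
    isometric dilation of [P], and [T] is built from [S] and the Toeplitz operator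
    with symbol [A + w A^*]; they satisfy [T V = V T] and [T = T^* V]. The last relation
    implies [|T x|^2 <= |x| |T^2 x|], so the norm of [T] is the growth rate of its
    powers ([norm_le_growth]). That rate is at most [2], because [|A + w A^*| <= 2]
    ([pencil_norm_le]) and because of the spectral radius formula for [S]
    ([growth_of_spectrum]). Now that [|T| <= 2], the two roots of [z^2 - T z + V], as
    companion matrices, are commuting isometries for a semidefinite inner product,
    with sum [T] and product [V]. So [f(T, V)] is a symmetric polynomial in two
    commuting isometries, and its norm is at most the supremum of [|f|] over
    [(a + b, a b)] with [|a| = |b| = 1] ([gamma_isometry_bound]); [f(S, P)] is a
    compression of [f(T, V)].

    Where one would integrate against a spectral measure, an isometry is replaced by
    unimodular scalars through discrete Fourier transforms of its orbits
    ([symbol_bound]). This makes sense in any semi-inner product space, in particular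
    on finitely supported sequences. *)

Set Implicit Arguments.
Unset Strict Implicit.
Unset Printing Implicit Defensive.

Import Order.TTheory GRing.Theory Num.Theory.
Import numFieldNormedType.Exports.

Local Open Scope classical_set_scope.
Local Open Scope ring_scope.

(** * Moduli of complex numbers and of vectors *)

Section complex_modulus.
Variable R : realType.
Local Notation C := R[i].

Lemma rnormE (V : normedZmodType C) (x : V) : `|x| = (rnorm x)%:C%C.
Proof. by rewrite /rnorm RRe_real // normr_real. Qed.

Lemma rnorm_ge0 (V : normedZmodType C) (x : V) : 0 <= rnorm x.
Proof. by rewrite -ler0c -rnormE normr_ge0. Qed.

Lemma rnorm0 (V : normedZmodType C) : rnorm (0 : V) = 0.
Proof. by rewrite /rnorm normr0. Qed.

Lemma rnorm_eq0 (V : normedZmodType C) (x : V) : rnorm x = 0 -> x = 0.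
Proof. by move=> x0; apply/normr0_eq0; rewrite rnormE x0. Qed.

Lemma rnormM (a b : C) : rnorm (a * b) = rnorm a * rnorm b.
Proof. by apply: complexI; rewrite rmorphM /= -!rnormE normrM. Qed.

Lemma rnorm1 : rnorm (1 : C) = 1.
Proof. by rewrite /rnorm normr1. Qed.

Lemma rnormX (a : C) n : rnorm (a ^+ n) = rnorm a ^+ n.
Proof.
by elim: n => [|n IH]; rewrite ?expr0 ?rnorm1 // !exprS rnormM IH.
Qed.

Lemma rnormN (V : normedZmodType C) (x : V) : rnorm (- x) = rnorm x.
Proof. by rewrite /rnorm normrN. Qed.

Lemma rnormV (a : C) : rnorm a^-1 = (rnorm a)^-1.
Proof. by apply: complexI; rewrite fmorphV /= -!rnormE normfV. Qed.

Lemma rnorm_realE (r : R) : rnorm (r%:C%C : C) = `|r|.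
Proof. by rewrite /rnorm normc_def /= expr0n addr0 sqrtr_sqr. Qed.

Lemma sqr_rnorm (a : C) : rnorm a ^+ 2 = complex.Re a ^+ 2 + complex.Im a ^+ 2.
Proof.
by apply: complexI; rewrite rmorphXn /= -rnormE add_Re2_Im2.
Qed.

Lemma rnorm_conj (a : C) : rnorm (a^*)%C = rnorm a.
Proof. by rewrite /rnorm normcJ. Qed.

Lemma mul_conjc (a : C) : a * (a^*)%C = (rnorm a ^+ 2)%:C%C.
Proof. by rewrite -sqr_normc rnormE rmorphXn. Qed.

Lemma unimodular_conj (a : C) : rnorm a = 1 -> a * (a^*)%C = 1.
Proof. by move=> a1; rewrite mul_conjc a1 expr1n. Qed.

Lemma unimodular_neq0 (a : C) : rnorm a = 1 -> a != 0.
Proof.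
move=> a1; apply/eqP => a0; move: a1.
by rewrite a0 rnorm0 => /eqP; rewrite eq_sym oner_eq0.
Qed.

Lemma Re_le_rnorm (a : C) : complex.Re a <= rnorm a.
Proof.
rewrite -lecR -rnormE; apply: le_trans (normc_ge_Re a).
by rewrite lecR ler_norm.
Qed.

Lemma rnormD (V : normedZmodType C) (x y : V) :
  rnorm (x + y) <= rnorm x + rnorm y.
Proof. by rewrite -lecR rmorphD /= -!rnormE ler_normD. Qed.

Lemma rnormB (V : normedZmodType C) (x y : V) :
  rnorm (x - y) <= rnorm x + rnorm y.
Proof. by rewrite -(rnormN y) rnormD. Qed.

Lemma rotate_to_modulus (z : C) :
  exists2 u : C, rnorm u = 1 & u * z = (rnorm z)%:C%C.
Proof.
have [->|z0] := eqVneq z 0.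
  by exists 1; rewrite ?rnorm1 // mulr0 rnorm0.
have nz0 : rnorm z != 0 by apply/eqP => /rnorm_eq0 /eqP; apply/negP.
exists ((rnorm z)%:C%C / z); last by rewrite divfK.
by rewrite rnormM rnormV rnorm_realE ger0_norm ?rnorm_ge0 // divff.
Qed.

End complex_modulus.

(** * Semidefinite inner products *)

(** Only real parts of inner products are kept, so that unimodular factors carry
    the complex information: [ipJ] says that a scalar moves to the other side as
    its conjugate. Definiteness is not asked for because the form
    [companion_ip] below degenerates where [T] attains the norm [2]. *)

Section semi_inner_products.
Variable R : realType.
Local Notation C := R[i].

Record semi_inner (X : lmodType C) (ip : X -> X -> R) : Prop := SemiInner {
  ipDl : forall x y z, ip (x + y) z = ip x z + ip y z;
  ipZl : forall (r : R) x y, ip (r%:C%C *: x) y = r * ip x y;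
  ipC : forall x y, ip x y = ip y x;
  ipJ : forall (a : C) x y, ip (a *: x) y = ip x ((a^*)%C *: y);
  ip_ge0 : forall x, 0 <= ip x x }.

Definition inorm (X : lmodType C) (ip : X -> X -> R) (x : X) : R :=
  Num.sqrt (ip x x).

Variables (X : lmodType C) (ip : X -> X -> R).
Hypothesis ip_semi : semi_inner ip.
Local Notation nrm := (inorm ip).
Implicit Types x y z : X.

Lemma ipDr x y z : ip x (y + z) = ip x y + ip x z.
Proof. by rewrite ipC // ipDl // -!(ipC ip_semi x). Qed.

Lemma ipZr (r : R) x y : ip x (r%:C%C *: y) = r * ip x y.
Proof. by rewrite ipC // ipZl // (ipC ip_semi x). Qed.

Lemma ip0l x : ip 0 x = 0.
Proof. by rewrite -(scale0r (0 : X)) (ipZl ip_semi 0) mul0r. Qed.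

Lemma ip0r x : ip x 0 = 0.
Proof. by rewrite ipC // ip0l. Qed.

Lemma ipNl x y : ip (- x) y = - ip x y.
Proof. by apply/eqP; rewrite -addr_eq0 -ipDl // addNr ip0l. Qed.

Lemma ipNr x y : ip x (- y) = - ip x y.
Proof. by rewrite ipC // ipNl (ipC ip_semi x). Qed.

Lemma ipBl x y z : ip (x - y) z = ip x z - ip y z.
Proof. by rewrite ipDl // ipNl. Qed.

Lemma ipBr x y z : ip x (y - z) = ip x y - ip x z.
Proof. by rewrite ipDr ipNr. Qed.

Lemma ip_suml (I : Type) (s : seq I) (Q : pred I) (F : I -> X) y :
  ip (\sum_(i <- s | Q i) F i) y = \sum_(i <- s | Q i) ip (F i) y.
Proof. by apply: (big_morph (ip^~ y)) => [a b|]; rewrite ?ipDl ?ip0l. Qed.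

Lemma ip_sumr (I : Type) (s : seq I) (Q : pred I) (F : I -> X) y :
  ip y (\sum_(i <- s | Q i) F i) = \sum_(i <- s | Q i) ip y (F i).
Proof. by apply: (big_morph (ip y)) => [a b|]; rewrite ?ipDr ?ip0r. Qed.

Lemma nrm_ge0 x : 0 <= nrm x. Proof. exact: sqrtr_ge0. Qed.

Lemma nrmK x : nrm x ^+ 2 = ip x x.
Proof. by rewrite sqr_sqrtr // ip_ge0. Qed.

Lemma nrm0 : nrm 0 = 0.
Proof. by rewrite /inorm ip0l sqrtr0. Qed.

Lemma ipZZ (a : C) x y : ip (a *: x) (a *: y) = rnorm a ^+ 2 * ip x y.
Proof.
by rewrite ipJ // scalerA mulrC mul_conjc ipZr.
Qed.

Lemma nrmZ (a : C) x : nrm (a *: x) = rnorm a * nrm x.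
Proof.
by rewrite /inorm ipZZ sqrtrM ?sqr_ge0 // sqrtr_sqr ger0_norm ?rnorm_ge0.
Qed.

Lemma nrmN x : nrm (- x) = nrm x.
Proof. by rewrite /inorm ipNl ipNr opprK. Qed.

Lemma nrmBC x y : nrm (x - y) = nrm (y - x).
Proof. by rewrite -nrmN opprB. Qed.

Lemma nrm_le x y : ip x x <= ip y y -> nrm x <= nrm y.
Proof. by move=> h; rewrite ler_sqrt // ip_ge0. Qed.

Lemma nrm_le_sqr x (c : R) : 0 <= c -> ip x x <= c ^+ 2 -> nrm x <= c.
Proof.
by move=> c0 h; rewrite -(ler_pXn2r (n := 2)) ?nnegrE ?nrm_ge0 // nrmK.
Qed.

Lemma ip_cauchy_schwarz x y : ip x y <= nrm x * nrm y.
Proof.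
have quad (t : R) : 0 <= ip x x - 2 * t * ip x y + t ^+ 2 * ip y y.
  have := ip_ge0 ip_semi (x - t%:C%C *: y).
  rewrite ipBl !ipBr ipZl // !ipZr ipZl // (ipC ip_semi y x).
  by move=> h; apply: le_trans h _; rewrite le_eqVlt; apply/orP; left; apply/eqP; ring.
(* A null vector y is orthogonal to everything: the quadratic polynomial quad
   degenerates to an affine one, which is tested at a value that would make it
   equal to -1. *)
have [y0|y0] := eqVneq (ip y y) 0.
  have [h|xy0] := lerP (ip x y) 0.
    by apply: le_trans h _; rewrite mulr_ge0 ?nrm_ge0.
  have := quad ((ip x x + 1) / (2 * ip x y)).
  rewrite y0 mulr0 addr0.
  have -> : 2 * ((ip x x + 1) / (2 * ip x y)) * ip x y = ip x x + 1.
    by field; rewrite gt_eqF.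
  by lra.
have yp : 0 < ip y y by rewrite lt_neqAle eq_sym y0 ip_ge0.
have h := quad (ip x y / ip y y).
have le2 : ip x y ^+ 2 <= (nrm x * nrm y) ^+ 2.
  rewrite exprMn !nrmK -ler_pdivrMr //.
  suff -> : ip x y ^+ 2 / ip y y =
     ip x x - (ip x x - 2 * (ip x y / ip y y) * ip x y +
       (ip x y / ip y y) ^+ 2 * ip y y) by lra.
  by field.
apply: le_trans (ler_norm _) _.
by rewrite -(ler_pXn2r (n := 2)) ?nnegrE ?mulr_ge0 ?nrm_ge0 // real_normK ?num_real.
Qed.

Lemma ip_abs_le x y : `|ip x y| <= nrm x * nrm y.
Proof.
rewrite ler_norml ip_cauchy_schwarz andbT lerNl -ipNl -(nrmN x).
exact: ip_cauchy_schwarz.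
Qed.

Lemma nrmD x y : nrm (x + y) <= nrm x + nrm y.
Proof.
apply: nrm_le_sqr; first by rewrite addr_ge0 ?nrm_ge0.
rewrite ipDl // !ipDr sqrrD !nrmK (ipC ip_semi y x).
by have := ip_cauchy_schwarz x y; lra.
Qed.

Lemma nrmB x y : nrm (x - y) <= nrm x + nrm y.
Proof. by rewrite -(nrmN y) nrmD. Qed.

Lemma nrm_sum (I : Type) (s : seq I) (Q : pred I) (F : I -> X) :
  nrm (\sum_(i <- s | Q i) F i) <= \sum_(i <- s | Q i) nrm (F i).
Proof.
elim/big_rec2: _ => [|i y z _ h]; first by rewrite nrm0.
by apply: le_trans (nrmD _ _) _; rewrite lerD2l.
Qed.

Lemma parallelogram x y :
  ip (x - y) (x - y) + ip (x + y) (x + y) = 2 * ip x x + 2 * ip y y.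
Proof.
rewrite !(ipDl ip_semi, ipDr, ipNl, ipNr); ring.
Qed.

End semi_inner_products.

Section linear_operators.
Variable R : realType.
Local Notation C := R[i].

Definition linop (X Y : lmodType C) (T : X -> Y) : Prop :=
  forall (a : C) x y, T (a *: x + y) = a *: T x + T y.

Section linop_theory.
Variables (X Y : lmodType C) (T : X -> Y).
Hypothesis T_lin : linop T.

Lemma linopD x y : T (x + y) = T x + T y.
Proof. by have := T_lin 1 x y; rewrite !scale1r. Qed.

Lemma linop0 : T 0 = 0.
Proof. by apply/(addrI (T 0)); rewrite -linopD !addr0. Qed.

Lemma linopZ a x : T (a *: x) = a *: T x.
Proof. by have := T_lin a x 0; rewrite linop0 !addr0. Qed.

Lemma linopN x : T (- x) = - T x.
Proof. by rewrite -scaleN1r linopZ scaleN1r. Qed.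

Lemma linopB x y : T (x - y) = T x - T y.
Proof. by rewrite linopD linopN. Qed.

Lemma linop_sum (I : Type) (s : seq I) (Q : pred I) (F : I -> X) :
  T (\sum_(i <- s | Q i) F i) = \sum_(i <- s | Q i) T (F i).
Proof. by apply: (big_morph T) => [a b|]; rewrite ?linopD ?linop0. Qed.

End linop_theory.

Lemma linop_comp (X Y Z : lmodType C) (f : Y -> Z) (g : X -> Y) :
  linop f -> linop g -> linop (f \o g).
Proof. by move=> fl gl a x y /=; rewrite gl fl. Qed.

Lemma linop_iter (X : lmodType C) (T : X -> X) n : linop T -> linop (iter n T).
Proof. by move=> Tl; elim: n => [|n IH] a x y //=; rewrite IH Tl. Qed.

Lemma linop_add (X Y : lmodType C) (f g : X -> Y) :
  linop f -> linop g -> linop (fun x => f x + g x).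
Proof. by move=> fl gl a x y; rewrite fl gl scalerDr addrACA. Qed.

Lemma linop_scale (X Y : lmodType C) (b : C) (f : X -> Y) :
  linop f -> linop (fun x => b *: f x).
Proof. by move=> fl a x y; rewrite fl scalerDr !scalerA mulrC. Qed.

Lemma linop_bigsum (X Y : lmodType C) (I : Type) (s : seq I) (F : I -> X -> Y) :
  (forall i, linop (F i)) -> linop (fun x => \sum_(i <- s) F i x).
Proof.
move=> Fl a x y; rewrite scaler_sumr -big_split /=.
by apply: eq_bigr => i _; rewrite Fl.
Qed.

Lemma commute_iter (X : Type) (f g : X -> X) n :
  (forall x, f (g x) = g (f x)) -> forall x, f (iter n g x) = iter n g (f x).
Proof. by move=> fg x; elim: n => //= n IH; rewrite fg IH. Qed.

Lemma ex_primitive_root n : (0 < n)%N -> exists z : C, n.-primitive_root z.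
Proof.
move=> n0; pose p : {poly C} := 'X^n - 1.
have [r Dp] := closed_field_poly_normal p.
rewrite (monicP _) ?monicXnsubC // scale1r in Dp.
have rn1 : all n.-unity_root r.
  by apply/allP=> z; rewrite -root_prod_XsubC -Dp.
have sz_r : (n < (size r).+1)%N.
  by rewrite -(size_prod_XsubC r id) -Dp size_XnsubC.
have [|z] := hasP (cyclic.has_prim_root n0 rn1 _ sz_r); last by exists z.
rewrite -separable.separable_prod_XsubC -Dp cyclotomic.separable_Xn_sub_1 //.
by rewrite pnatr_eq0 -lt0n.
Qed.

Lemma sum_root_of_unity n (z : C) : z ^+ n = 1 -> z != 1 ->
  \sum_(k < n) z ^+ k = 0.
Proof.
move=> zn z1; have := subrX1 z n; rewrite zn subrr => /esym/eqP.
by rewrite mulf_eq0 subr_eq0 (negbTE z1) => /eqP.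
Qed.

Lemma root_of_unity_unimodular n (z : C) : (0 < n)%N -> z ^+ n = 1 -> rnorm z = 1.
Proof.
move=> n0 zn; have : rnorm z ^+ n = 1 by rewrite -rnormX zn rnorm1.
by move/eqP; rewrite pexpr_eq1 ?rnorm_ge0 // => /eqP.
Qed.

End linear_operators.

(** * Replacing an isometry by unimodular scalars *)

Section symbols.
Variable R : realType.
Local Notation C := R[i].
Variables (X : lmodType C) (ip : X -> X -> R).
Hypothesis ip_semi : semi_inner ip.
Local Notation nrm := (inorm ip).
Local Notation q x := (ip x x).

(** The vectors [\sum_l w^(-k l) y_l] are the discrete Fourier transform of the
    sequence [y], computed in an arbitrary semi-inner product space. *)
Lemma parseval n (w : C) (y : nat -> X) : n.-primitive_root w ->
  \sum_(k < n) q (\sum_(l < n) ((w ^+ k)^-1) ^+ l *: y l)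
    = n%:R * \sum_(l < n) q (y l).
Proof.
move=> pw; have n0 := prim_order_gt0 pw; have wn := prim_expr_order pw.
have w1 := root_of_unity_unimodular n0 wn.
have w0 := unimodular_neq0 w1.
have u1 k l : rnorm (((w ^+ k)^-1) ^+ l) = 1.
  by rewrite rnormX rnormV rnormX w1 !expr1n invr1 expr1n.
rewrite mulr_sumr.
under eq_bigr => k _.
  rewrite ip_suml //.
  under eq_bigr => l _ do rewrite ip_sumr //.
  over.
rewrite exchange_big /=; apply: eq_bigr => l _.
rewrite exchange_big /= (bigD1 l) //= [X in _ + X]big1 ?addr0 => [|m ml].
  under eq_bigr => k _ do rewrite ipZZ // u1 expr1n mul1r.
  by rewrite sumr_const card_ord mulr_natl.
under eq_bigr => k _ do rewrite ipJ // scalerA.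
rewrite -ip_sumr // -scaler_suml.
set s := \sum_(k < n) _; suff -> : s = 0 by rewrite scale0r ip0r.
pose z : C := w ^+ l / w ^+ m.
have -> : s = \sum_(k < n) z ^+ k.
  apply: eq_bigr => k _.
  rewrite /z.
  (* Conjugation inverts a unimodular number. *)
  have -> : ((((w ^+ k)^-1) ^+ l)^*)%C = (w ^+ k) ^+ l.
    have ne0 : ((w ^+ k)^-1) ^+ l != 0 by apply: unimodular_neq0; exact: u1.
    apply: (mulfI ne0); rewrite unimodular_conj ?u1 // -exprMn mulVf ?expf_neq0 //.
    by rewrite expr1n.
  by rewrite -exprVn -!exprM expr_div_n -!exprM mulnC exprVn (mulnC k m).
apply: sum_root_of_unity.
  by rewrite expr_div_n -!exprM !(mulnC _ n) !exprM wn !expr1n divr1.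
apply: contra ml => /eqP z1.
have : w ^+ l == w ^+ m.
  by rewrite -(mulr1 (w ^+ m)) -z1 /z mulrC divfK ?expf_neq0.
by rewrite (eq_prim_root_expr pw) !modn_small // => /eqP lm; apply/eqP/val_inj.
Qed.

Definition bounded_by (M : R) (T : X -> X) : Prop :=
  forall x, nrm (T x) <= M * nrm x.

(** [G] is an expression in the isometry [V], and [g w] the same expression with
    [V] replaced by the scalar [w]. The last field is what survives of the
    factor [V - w] of [G - g w]: it makes [G] close to [g w] on approximate
    eigenvectors of [V], and it is stable under sums and compositions. *)
Record has_symbol (V G : X -> X) (g : C -> X -> X) (M : R) : Prop := HasSymbol {
  symbol_ge0 : 0 <= M;
  symbol_op_lin : linop G;
  symbol_comm : forall x, G (V x) = V (G x);
  symbol_op_bounded : bounded_by M G;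
  symbol_lin : forall w, rnorm w = 1 -> linop (g w);
  symbol_bounded : forall w, rnorm w = 1 -> bounded_by M (g w);
  symbol_diff : forall w x, rnorm w = 1 ->
    nrm (G x - g w x) <= M * nrm (V x - w *: x) }.

Lemma isometry_iter (V : X -> X) n x : (forall y, q (V y) = q y) ->
  q (iter n V x) = q x.
Proof. by move=> Vi; elim: n => //= n IH; rewrite Vi. Qed.

(** Von Neumann's inequality for one isometry, with operator coefficients. For an
    [n]-th root of unity [z], the vector [v = \sum_(l < n) z^(-l) V^l x] satisfies
    [V v - z v = z (V^n x - x)], whose norm stays at most [2 |x|] while the sum
    over [z] of [|v|^2] is [n^2 |x|^2]. So [G v] and [g z v] agree up to a bounded
    error, and [parseval] averages the bounds on [g z] into one on [G], up to
    [O(1/n)]. *)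
Lemma symbol_bound (V G : X -> X) g M B :
  linop V -> (forall x, q (V x) = q x) -> has_symbol V G g M ->
  0 <= B -> (forall w, rnorm w = 1 -> bounded_by B (g w)) -> bounded_by B G.
Proof.
move=> Vl Vi [M0 Gl GV GM gl gM Ggd] B0 gB x.
apply: nrm_le_sqr => //; first by rewrite mulr_ge0 ?nrm_ge0.
rewrite exprMn nrmK //.
pose K := (2 * M) ^+ 2 * q x.
have K0 : 0 <= K by rewrite mulr_ge0 ?sqr_ge0 ?ip_ge0.
have main n d : (0 < n)%N -> 0 < d ->
    q (G x) <= (1 + d) * (B ^+ 2 * q x) + (1 + d^-1) * K / n%:R.
  move=> n0 d0; have [w pw] := ex_primitive_root R n0.
  have wn := prim_expr_order pw.
  have w1 := root_of_unity_unimodular n0 wn.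
  pose v k y := \sum_(l < n) ((w ^+ k)^-1) ^+ l *: iter l V y.
  have pars y : \sum_(k < n) q (v k y) = n%:R ^+ 2 * q y.
    rewrite (parseval _ pw) expr2 -mulrA; congr (_ * _).
    under eq_bigr => l _ do rewrite isometry_iter //.
    by rewrite sumr_const card_ord mulr_natl.
  have Gv k : G (v k x) = v k (G x).
    rewrite linop_sum //; apply: eq_bigr => l _; rewrite linopZ //.
    by congr (_ *: _); apply: commute_iter.
  have Vv k : V (v k x) - w ^+ k *: v k x = w ^+ k *: (iter n V x - x).
    have z0 : w ^+ k != 0 by apply: unimodular_neq0; rewrite rnormX w1 expr1n.
    rewrite linop_sum // scaler_sumr -sumrB.
    under eq_bigr => l _ do rewrite linopZ // -iterS.
    pose h l := (w ^+ k * ((w ^+ k)^-1) ^+ l) *: iter l V x.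
    transitivity (\sum_(0 <= l < n) (h l.+1 - h l)).
      rewrite big_mkord; apply: eq_bigr => l _.
      by rewrite /h exprS mulrA divff // mul1r scalerA.
    rewrite telescope_sumr // /h expr0 mulr1 scalerBr.
    by rewrite exprVn -exprM mulnC exprM wn expr1n invr1 mulr1.
  (* (a + b)^2 <= (1 + d) a^2 + (1 + 1/d) b^2 separates the main term a from
     the bounded error b. *)
  have bnd k : q (v k (G x)) <= (1 + d) * (B ^+ 2 * q (v k x)) + (1 + d^-1) * K.
    have zk : rnorm (w ^+ k) = 1 by rewrite rnormX w1 expr1n.
    have h1 : nrm (v k (G x)) <= B * nrm (v k x) + 2 * M * nrm x.
      rewrite -Gv -[G _](subrK (g (w ^+ k) (v k x))) addrC.
      apply: le_trans (nrmD ip_semi _ _) _.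
      apply: lerD; first exact: gB.
      apply: le_trans (Ggd _ _ zk) _.
      rewrite Vv nrmZ // zk mul1r.
      have hV : nrm (iter n V x - x) <= 2 * nrm x.
        apply: le_trans (nrmB ip_semi _ _) _.
        by rewrite {1}/inorm isometry_iter // -/(inorm ip x); lra.
      by have := ler_wpM2l M0 hV; rewrite mulrA (mulrC M 2).
    set a := B * nrm (v k x) in h1; set b := 2 * M * nrm x in h1.
    have -> : B ^+ 2 * q (v k x) = a ^+ 2 by rewrite exprMn nrmK.
    have -> : K = b ^+ 2 by rewrite exprMn nrmK.
    have b0 : 0 <= b by rewrite !mulr_ge0 ?nrm_ge0.
    have a0 : 0 <= a by rewrite !mulr_ge0 ?nrm_ge0.
    rewrite -nrmK //; apply: (@le_trans _ _ ((a + b) ^+ 2)).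
      by rewrite ler_pXn2r ?nnegrE ?nrm_ge0 ?addr_ge0.
    rewrite -subr_ge0.
    have -> : (1 + d) * a ^+ 2 + (1 + d^-1) * b ^+ 2 - (a + b) ^+ 2
      = (d * a - b) ^+ 2 / d by field; rewrite gt_eqF.
    by rewrite divr_ge0 ?sqr_ge0 // ltW.
  have nR : 0 < n%:R :> R by rewrite ltr0n.
  have : \sum_(k < n) q (v k (G x)) <=
      \sum_(k < n) ((1 + d) * (B ^+ 2 * q (v k x)) + (1 + d^-1) * K).
    by apply: ler_sum => k _; exact: bnd.
  rewrite pars big_split /= [X in _ + X]sumr_const card_ord -2!mulr_sumr pars => h.
  rewrite -[X in _ + X]mulr_natl in h.
  rewrite -(ler_pM2l (exprn_gt0 2 nR)) (le_trans h) // le_eqVlt.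
  by apply/orP; left; apply/eqP; field; rewrite !gt_eqF.
apply/ler_addgt0Pr => e e0.
(* d is chosen first, to absorb half of e, and then n. *)
pose b := B ^+ 2 * q x; have b0 : 0 <= b by rewrite mulr_ge0 ?sqr_ge0 ?ip_ge0.
pose d := e / (2 * (b + 1)).
have d0 : 0 < d by rewrite divr_gt0 ?mulr_gt0 //; lra.
pose c := (1 + d^-1) * K.
have c0 : 0 <= c by rewrite mulr_ge0 // addr_ge0 // invr_ge0 ltW.
pose n := (Num.truncn (2 * c / e)).+1.
have nlt : 2 * c / e < n%:R by rewrite truncnS_gt.
have nR : 0 < n%:R :> R by rewrite ltr0n.
apply: le_trans (main n d isT d0) _.
rewrite -/b -/c.
have h1 : c / n%:R <= e / 2.
  by rewrite ler_pdivrMr //; move: nlt; rewrite ltr_pdivrMr //; lra.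
have h2 : d * b <= e / 2.
  rewrite /d -mulrA -subr_ge0.
  have -> : e / 2 - e * ((2 * (b + 1))^-1 * b) = e / (2 * (b + 1)).
    by field; rewrite gt_eqF //; lra.
  exact: ltW.
lra.
Qed.

End symbols.

(** * Polynomials in a pair of operators and their symbols *)

Section polynomials_in_operators.
Variable R : realType.
Local Notation C := R[i].

(** The formula of [poly_op] on a bare module: it is also evaluated on sequences and
    on pairs of vectors. *)
Definition poly_at (X : lmodType C) (f : {poly {poly C}}) (S P : X -> X) : X -> X :=
  fun x => \sum_(i < size f) \sum_(j < size f`_i)
             f`_i`_j *: iter i S (iter j P x).

Lemma poly_at_intertwine (X Y : lmodType C) (J : X -> Y) S P S' P' f x :
  linop J -> (forall x, J (S x) = S' (J x)) -> (forall x, J (P x) = P' (J x)) ->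
  J (poly_at f S P x) = poly_at f S' P' (J x).
Proof.
move=> Jl JS JP.
have JI A A' (JA : forall x, J (A x) = A' (J x)) n y :
    J (iter n A y) = iter n A' (J y).
  by elim: n => //= n <-.
rewrite linop_sum //; apply: eq_bigr => i _.
rewrite linop_sum //; apply: eq_bigr => j _.
by rewrite linopZ // (JI _ _ JS) (JI _ _ JP).
Qed.

Lemma poly_at_scalar (X : lmodType C) f (a b : C) (x : X) :
  poly_at f (fun x => a *: x) (fun x => b *: x) x = f.[a, b] *: x.
Proof.
have itZ c n y : iter n (fun x : X => c *: x) y = c ^+ n *: y.
  by elim: n => [|n IH] /=; rewrite ?scale1r // IH scalerA exprS.
rewrite (horner_coef f) horner_sum scaler_suml; apply: eq_bigr => i _.
rewrite hornerM -rmorphXn hornerC horner_coef mulr_suml scaler_suml.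
apply: eq_bigr => j _.
by rewrite !itZ !scalerA mulrAC mulrA.
Qed.

Lemma eq_poly_at (X : lmodType C) f (S P S' P' : X -> X) :
  S =1 S' -> P =1 P' -> poly_at f S P =1 poly_at f S' P'.
Proof.
move=> SS PP x; apply: eq_bigr => i _; apply: eq_bigr => j _.
by rewrite (eq_iter SS) (eq_iter PP).
Qed.

End polynomials_in_operators.

Section symbol_calculus.
Variable R : realType.
Local Notation C := R[i].
Variables (X : lmodType C) (ip : X -> X -> R).
Hypothesis ip_semi : semi_inner ip.
Local Notation nrm := (inorm ip).
Variable V : X -> X.
Hypothesis V_lin : linop V.

Definition ex_symbol (G : X -> X) (g : C -> X -> X) : Prop :=
  exists M, has_symbol ip V G g M.

Lemma symbol_const G M : 0 <= M -> linop G -> (forall x, G (V x) = V (G x)) ->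
  bounded_by ip M G -> ex_symbol G (fun _ => G).
Proof.
move=> M0 Gl GV GM; exists M; split => // w x _.
by rewrite subrr nrm0 // mulr_ge0 ?nrm_ge0.
Qed.

Lemma symbol_id : (forall x, nrm (V x) = nrm x) -> ex_symbol V (fun w x => w *: x).
Proof.
move=> Vi; exists 1; split => //.
- by move=> x; rewrite Vi mul1r.
- by move=> w _ a x y; rewrite scalerDr !scalerA mulrC.
- by move=> w w1 x; rewrite nrmZ // w1.
- by move=> w x _; rewrite mul1r.
Qed.

Lemma symbol_comp G1 g1 G2 g2 : ex_symbol G1 g1 -> ex_symbol G2 g2 ->
  ex_symbol (fun x => G1 (G2 x)) (fun w x => g1 w (g2 w x)).
Proof.
move=> [M1 [M10 Gl1 GV1 GM1 gl1 gM1 d1]] [M2 [M20 Gl2 GV2 GM2 gl2 gM2 d2]].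
have le2 a : 0 <= a -> M1 * (M2 * a) <= 2 * (M1 * M2) * a.
  by move=> a0; have := mulr_ge0 (mulr_ge0 M10 M20) a0; lra.
exists (2 * (M1 * M2)); split.
- by rewrite !mulr_ge0.
- exact: linop_comp.
- by move=> x; rewrite GV2 GV1.
- move=> x; apply: le_trans (le2 _ (nrm_ge0 _ _)).
  by apply: le_trans (GM1 _) _; rewrite ler_wpM2l.
- by move=> w w1; apply: linop_comp; [exact: gl1|exact: gl2].
- move=> w w1 x; apply: le_trans (le2 _ (nrm_ge0 _ _)).
  by apply: le_trans (gM1 _ w1 _) _; rewrite ler_wpM2l // gM2.
- move=> w x w1.
  have -> : G1 (G2 x) - g1 w (g2 w x)
      = (G1 (G2 x) - g1 w (G2 x)) + g1 w (G2 x - g2 w x).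
    by rewrite (linopB (gl1 _ w1)) addrA subrK.
  apply: le_trans (nrmD ip_semi _ _) _.
  have h1 : nrm (G1 (G2 x) - g1 w (G2 x)) <= M1 * (M2 * nrm (V x - w *: x)).
    apply: le_trans (d1 _ _ w1) _; rewrite ler_wpM2l //.
    by rewrite -GV2 -linopZ // -linopB // GM2.
  have h2 : nrm (g1 w (G2 x - g2 w x)) <= M1 * (M2 * nrm (V x - w *: x)).
    by apply: le_trans (gM1 _ w1 _) _; rewrite ler_wpM2l // d2.
  by lra.
Qed.

Lemma symbol_add G1 g1 G2 g2 : ex_symbol G1 g1 -> ex_symbol G2 g2 ->
  ex_symbol (fun x => G1 x + G2 x) (fun w x => g1 w x + g2 w x).
Proof.
move=> [M1 [M10 Gl1 GV1 GM1 gl1 gM1 d1]] [M2 [M20 Gl2 GV2 GM2 gl2 gM2 d2]].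
exists (M1 + M2); split.
- by rewrite addr_ge0.
- exact: linop_add.
- by move=> x; rewrite GV1 GV2 linopD.
- by move=> x; rewrite mulrDl (le_trans (nrmD ip_semi _ _)) // lerD.
- by move=> w w1; apply: linop_add; [exact: gl1|exact: gl2].
- by move=> w w1 x; rewrite mulrDl (le_trans (nrmD ip_semi _ _)) // lerD ?gM1 ?gM2.
- move=> w x w1; rewrite opprD addrACA mulrDl.
  by rewrite (le_trans (nrmD ip_semi _ _)) // lerD ?d1 ?d2.
Qed.

Lemma symbol_scale c G g : ex_symbol G g ->
  ex_symbol (fun x => c *: G x) (fun w x => c *: g w x).
Proof.
move=> [M [M0 Gl GV GM gl gM d]]; have c0 := rnorm_ge0 c.
exists (rnorm c * M); split.
- by rewrite mulr_ge0.
- exact: linop_scale.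
- by move=> x; rewrite GV linopZ.
- by move=> x; rewrite nrmZ // -mulrA ler_wpM2l.
- by move=> w w1; apply: linop_scale; exact: gl.
- by move=> w w1 x; rewrite nrmZ // -mulrA ler_wpM2l // gM.
- by move=> w x w1; rewrite -scalerBr nrmZ // -mulrA ler_wpM2l // d.
Qed.

Lemma symbol_zero : ex_symbol (fun=> 0) (fun _ _ => 0).
Proof.
exists 0; split => //.
- by move=> a x y; rewrite scaler0 addr0.
- by move=> x; rewrite linop0.
- by move=> x; rewrite mul0r nrm0.
- by move=> w _ a x y; rewrite scaler0 addr0.
- by move=> w w1 x; rewrite mul0r nrm0.
- by move=> w x _; rewrite subrr mul0r nrm0.
Qed.

Lemma eq_symbol G g G' g' : G =1 G' -> (forall w, g w =1 g' w) ->
  ex_symbol G g -> ex_symbol G' g'.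
Proof.
move=> /funext -> gg'; suff -> : g = g' by [].
by apply/funext => w; apply/funext => x; exact: gg'.
Qed.

Lemma symbol_sum n (G : 'I_n -> X -> X) g : (forall i, ex_symbol (G i) (g i)) ->
  ex_symbol (fun x => \sum_(i < n) G i x) (fun w x => \sum_(i < n) g i w x).
Proof.
move=> Gg; elim: (index_enum _) => [|i s IH].
  by apply: eq_symbol symbol_zero => [x|w x]; rewrite big_nil.
apply: eq_symbol (symbol_add (Gg i) IH) => [x|w x]; by rewrite big_cons.
Qed.

Lemma symbol_iter n G g : ex_symbol G g ->
  ex_symbol (iter n G) (fun w => iter n (g w)).
Proof.
move=> Gg; elim: n => [|n IH]; last exact: symbol_comp Gg IH.
have h : bounded_by ip 1 (fun x => x) by move=> x; rewrite mul1r.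
exact: (@symbol_const (fun x => x) 1 ler01).
Qed.

Lemma symbol_poly_at f Z1 z1 Z2 z2 : ex_symbol Z1 z1 -> ex_symbol Z2 z2 ->
  ex_symbol (poly_at f Z1 Z2) (fun w => poly_at f (z1 w) (z2 w)).
Proof.
move=> s1 s2; apply: symbol_sum => i; apply: symbol_sum => j.
exact: symbol_scale (symbol_comp (symbol_iter i s1) (symbol_iter j s2)).
Qed.

End symbol_calculus.

(** * Pairs of commuting isometries *)

Section commuting_isometries.
Variable R : realType.
Local Notation C := R[i].

(** Ando's inequality for the symmetric polynomials [f(z1 + z2, z1 z2)]:
    [symbol_bound] turns first [U1], and then [U2], into a unimodular scalar. *)
Lemma isometry_pair_bound (X : lmodType C) (ip : X -> X -> R) (U1 U2 : X -> X)
    (f : {poly {poly C}}) (B : R) :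
  semi_inner ip -> linop U1 -> linop U2 ->
  (forall x, ip (U1 x) (U1 x) = ip x x) ->
  (forall x, ip (U2 x) (U2 x) = ip x x) ->
  (forall x, U1 (U2 x) = U2 (U1 x)) ->
  0 <= B ->
  (forall a b : C, rnorm a = 1 -> rnorm b = 1 -> rnorm f.[a + b, a * b] <= B) ->
  bounded_by ip B (poly_at f (fun x => U1 x + U2 x) (fun x => U1 (U2 x))).
Proof.
move=> ips l1 l2 i1 i2 cm B0 fB.
have n1 x : inorm ip (U1 x) = inorm ip x by rewrite /inorm i1.
have n2 x : inorm ip (U2 x) = inorm ip x by rewrite /inorm i2.
have b2 : bounded_by ip 1 U2 by move=> x; rewrite n2 mul1r.
have s1 : ex_symbol ip U1 U1 (fun w x => w *: x) by exact: symbol_id.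
have s12 : ex_symbol ip U1 U2 (fun _ => U2).
  by apply: (@symbol_const _ _ _ ips _ _ 1).
have [M sG] := symbol_poly_at ips l1 f (symbol_add ips l1 s1 s12)
  (symbol_comp ips s1 s12).
apply: (symbol_bound ips l1 i1 sG B0) => w w1.
have s2 : ex_symbol ip U2 U2 (fun w x => w *: x) by exact: symbol_id.
have sw : ex_symbol ip U2 (fun x => w *: x) (fun _ x => w *: x).
  apply: (@symbol_const _ _ _ ips _ _ 1) => //.
  - by apply: linop_scale.
  - by move=> x; rewrite linopZ.
  - by move=> x; rewrite nrmZ // w1.
have [M' sG'] := symbol_poly_at ips l2 f (symbol_add ips l2 sw s2)
  (symbol_comp ips sw s2).
apply: (symbol_bound ips l2 i2 sG' B0) => v v1 x.
rewrite (@eq_poly_at _ _ _ _ _ (fun x => (w + v) *: x) (fun x => (w * v) *: x)).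
- by rewrite poly_at_scalar nrmZ // ler_wpM2r ?nrm_ge0 // fB.
- by move=> y; rewrite scalerDl.
- by move=> y; rewrite scalerA.
Qed.

End commuting_isometries.

(** * Gamma-isometries *)

(** These are the pairs [(T, V)] with [V] isometric, [T = T^* V] and [|T| <= 2]. If
    [T = z1 + z2] and [V = z1 z2] for commuting isometries [z1] and [z2], then
    [T^* V = T]. Conversely [z1] is produced as multiplication by [z] on pairs
    [(x, y)] standing for [x z + y], where [z^2 = T z - V]; it is [companion1], and
    [companion2 = T - companion1] is the other root. The square norm of [x z + y] is
    [|x z1 + y|^2 + |x z2 + y|^2 = 2 |x|^2 + 2 |y|^2 + 2 Re <T x, y>], which is
    nonnegative exactly when [|T| <= 2]. *)

Section gamma_isometries.
Variable R : realType.
Local Notation C := R[i].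
Variables (X : lmodType C) (ip : X -> X -> R) (T V : X -> X).
Hypothesis ip_semi : semi_inner ip.
Hypotheses (T_lin : linop T) (V_lin : linop V).
Hypothesis TV : forall x, T (V x) = V (T x).
Hypothesis V_iso : forall x y, ip (V x) (V y) = ip x y.
Hypothesis T_adj : forall x y, ip (T x) y = ip (V x) (T y).
Hypothesis T_le2 : bounded_by ip 2 T.
Local Notation nrm := (inorm ip).

Definition companion_ip (u v : X * X) : R :=
  2 * ip u.1 v.1 + 2 * ip u.2 v.2 + ip (T u.1) v.2 + ip (T v.1) u.2.

Definition companion1 (u : X * X) : X * X := (T u.1 + u.2, - V u.1).
Definition companion2 (u : X * X) : X * X := (- u.2, T u.2 + V u.1).

Lemma companion_ip_semi : semi_inner companion_ip.
Proof.
have ipe := (ipDl ip_semi, ipDr ip_semi, linopD T_lin).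
split; rewrite /companion_ip.
- by move=> x y z /=; rewrite !ipe; ring.
- move=> r x y /=; rewrite !(linopZ T_lin) !(ipZl ip_semi) !(ipZr ip_semi); ring.
- by move=> x y; rewrite (ipC ip_semi x.1) (ipC ip_semi x.2); ring.
- move=> a x y /=; rewrite !(linopZ T_lin) !(ipJ ip_semi) conjcK; ring.
- move=> [x y] /=; have := ip_abs_le ip_semi (T x) y.
  have h : nrm (T x) * nrm y <= 2 * nrm x * nrm y.
    by rewrite ler_wpM2r ?nrm_ge0.
  rewrite ler_norml -!(nrmK ip_semi) => /andP[h1 _].
  by have := sqr_ge0 (nrm x - nrm y); rewrite sqrrB; lra.
Qed.

Let ipe := (ipDl ip_semi, ipDr ip_semi, ipNl ip_semi, ipNr ip_semi,
            linopD T_lin, linopN T_lin, V_iso).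

Lemma companion1_isometry u :
  companion_ip (companion1 u) (companion1 u) = companion_ip u u.
Proof.
case: u => x y; rewrite /companion_ip /companion1 /=.
rewrite !(ipNl ip_semi, ipNr ip_semi) V_iso (ipC ip_semi _ (V x)) -T_adj !ipe.
rewrite (ipC ip_semi y (T x)); ring.
Qed.

Lemma companion2_isometry u :
  companion_ip (companion2 u) (companion2 u) = companion_ip u u.
Proof.
case: u => x y; rewrite /companion_ip /companion2 /=.
rewrite (linopN T_lin) !(ipNl ip_semi, ipNr ip_semi) !ipe.
rewrite (ipC ip_semi (T y) (V x)) -T_adj; ring.
Qed.

Lemma companion12 u : companion1 (companion2 u) = (V u.1, V u.2).
Proof.
case: u => x y; rewrite /companion1 /companion2 /=; congr pair.
  by rewrite (linopN T_lin) addrA addNr add0r.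
by rewrite (linopN V_lin) opprK.
Qed.

Lemma companion_comm u : companion1 (companion2 u) = companion2 (companion1 u).
Proof.
rewrite companion12; case: u => x y; rewrite /companion1 /companion2 /= opprK.
by rewrite (linopN T_lin) TV (linopD V_lin) addrA addNr add0r.
Qed.

Lemma companionD u : companion1 u + companion2 u = (T u.1, T u.2).
Proof.
case: u => x y; rewrite /companion1 /companion2 /=.
by congr pair; rewrite ?addrK // addrC addrK.
Qed.

(** The vectors [(0, y)] span an isometric copy, up to the factor [sqrt 2], of the
    original space, on which [companion1 + companion2] and their product act as
    [T] and [V]. *)
Lemma gamma_isometry_bound (f : {poly {poly C}}) (B : R) : 0 <= B ->
  (forall a b : C, rnorm a = 1 -> rnorm b = 1 -> rnorm f.[a + b, a * b] <= B) ->
  bounded_by ip B (poly_at f T V).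
Proof.
move=> B0 fB y.
have l1 : linop companion1.
  move=> a [x1 x2] [y1 y2]; rewrite /companion1 /=; congr pair.
    by rewrite T_lin /= scalerDr addrACA.
  by rewrite V_lin /= opprD scalerN.
have l2 : linop companion2.
  move=> a [x1 x2] [y1 y2]; rewrite /companion2 /=; congr pair.
    by rewrite opprD /= scalerN.
  by rewrite T_lin V_lin /= scalerDr addrACA.
have := isometry_pair_bound companion_ip_semi l1 l2 companion1_isometry
  companion2_isometry companion_comm B0 fB (0, y).
pose J (x : X) : X * X := (0, x).
have Jl : linop J by move=> a u v; rewrite /J; congr pair; rewrite /= scaler0 addr0.
rewrite -/(J y) -(poly_at_intertwine (J := J) (S := T) (P := V)) //; first last.
- by move=> x; rewrite companion12 /= linop0.
- by move=> x; rewrite companionD /= linop0.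
have nJ x : inorm companion_ip (J x) = Num.sqrt 2 * nrm x.
  rewrite /inorm /companion_ip /J /= linop0 // !ip0l //.
  by rewrite mulr0 add0r !addr0 sqrtrM.
by rewrite !nJ mulrCA ler_pM2l // sqrtr_gt0.
Qed.

End gamma_isometries.

(** * Finitely supported sequences and their shift *)

Section finitely_supported_sequences.
Variable R : realType.
Local Notation C := R[i].
Variable X : lmodType C.

Definition eventually0 : {pred nat -> X} :=
  [pred x | `[< exists N, forall n, (N <= n)%N -> x n = 0 >]].

Lemma eventually0_submod : submod_closed eventually0.
Proof.
split; first by apply/asboolP; exists 0%N.
move=> a x y /asboolP[N xN] /asboolP[M yM]; apply/asboolP.
exists (maxn N M) => n; rewrite geq_max => /andP[Nn Mn].
transitivity (a *: x n + y n) => //.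
by rewrite xN // yM // scaler0 addr0.
Qed.

HB.instance Definition _ :=
  GRing.isSubmodClosed.Build C (nat -> X) eventually0 eventually0_submod.

Record finseq := FinSeq { finseq_val :> nat -> X; _ : finseq_val \in eventually0 }.

HB.instance Definition _ := [isSub for finseq_val].
HB.instance Definition _ := [Choice of finseq by <:].
HB.instance Definition _ := [SubChoice_isSubLmodule of finseq by <:].

Lemma finseqP (x y : finseq) : (forall n, x n = y n) -> x = y.
Proof. by move=> xy; apply/val_inj/funext. Qed.

Lemma finseq_bound (x : finseq) : exists N, forall n, (N <= n)%N -> x n = 0.
Proof. by case: x => x /= /asboolP. Qed.

Lemma mem_eventually0 (x : nat -> X) N : (forall n, (N <= n)%N -> x n = 0) ->
  x \in eventually0.
Proof. by move=> xN; apply/asboolP; exists N. Qed.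

Lemma finseqDE (x y : finseq) n : (x + y) n = x n + y n.
Proof. by []. Qed.

Lemma finseqZE a (x : finseq) n : (a *: x) n = a *: x n.
Proof. by []. Qed.

Lemma shiftseq_subproof (x : finseq) :
  (fun n => if n is m.+1 then x m else 0) \in eventually0.
Proof.
have [N xN] := finseq_bound x.
by apply: (@mem_eventually0 _ N.+1) => -[|n] //; exact: xN.
Qed.
Definition shiftseq (x : finseq) : finseq := FinSeq (shiftseq_subproof x).

Lemma headseq_subproof (a : X) : (fun n => if n is 0 then a else 0) \in eventually0.
Proof. by apply: (@mem_eventually0 _ 1) => -[]. Qed.
Definition headseq (a : X) : finseq := FinSeq (headseq_subproof a).

(** The test on [x n] keeps the support finite even when [A 0] is not [0]. *)
Lemma mapseq_subproof (A : X -> X) (x : finseq) :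
  (fun n => if x n == 0 then 0 else A (x n)) \in eventually0.
Proof.
have [N xN] := finseq_bound x.
by apply: (@mem_eventually0 _ N) => n /xN ->; rewrite eqxx.
Qed.
Definition mapseq A x : finseq := FinSeq (mapseq_subproof A x).

Lemma mapseqE A x n : linop A -> mapseq A x n = A (x n).
Proof. by move=> Al /=; case: eqP => // ->; rewrite linop0. Qed.

Lemma shiftseq_lin : linop shiftseq.
Proof.
move=> a x y; apply: finseqP => -[|n] //.
by rewrite finseqDE finseqZE /= scaler0 addr0.
Qed.

Lemma headseq_lin : linop headseq.
Proof.
move=> a x y; apply: finseqP => -[|n] //.
by rewrite finseqDE finseqZE /= scaler0 addr0.
Qed.

Lemma mapseq_lin A : linop A -> linop (mapseq A).
Proof.
by move=> Al a x y; apply: finseqP => n;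
  rewrite mapseqE // !finseqDE !finseqZE !mapseqE // Al.
Qed.

Lemma mapseq_shift A x : mapseq A (shiftseq x) = shiftseq (mapseq A x).
Proof. by apply: finseqP => -[|n] //=; rewrite eqxx. Qed.

Lemma mapseq_head A a : linop A -> mapseq A (headseq a) = headseq (A a).
Proof. by move=> Al; apply: finseqP => -[|n]; rewrite mapseqE //= linop0. Qed.

Variable ip : X -> X -> R.
Hypothesis ip_semi : semi_inner ip.

(** The number of terms is a chosen bound of the support of [x]; by [seq_ipE] any
    other bound gives the same value. *)
Definition seq_ip (x y : finseq) : R :=
  \sum_(n < projT1 (cid (finseq_bound x))) ip (x n) (y n).

Lemma seq_ipE N (x y : finseq) : (forall n, (N <= n)%N -> x n = 0) ->
  seq_ip x y = \sum_(n < N) ip (x n) (y n).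
Proof.
rewrite /seq_ip; case: cid => M /= xM xN.
wlog MN : N M xM xN / (M <= N)%N.
  by move=> h; have [|/ltnW] := leqP M N; [exact: h|move=> /h ->].
rewrite -!(big_mkord xpredT (fun n => ip (x n) (y n))).
rewrite [RHS](big_cat_nat (n := M)) //= [X in _ + X]big1_seq ?addr0 // => n.
by rewrite mem_index_iota => /andP[_ /andP[/xM -> _]]; rewrite ip0l.
Qed.

Lemma finseq_bound2 (x y : finseq) :
  exists N, forall n, (N <= n)%N -> x n = 0 /\ y n = 0.
Proof.
have [N xN] := finseq_bound x; have [M yM] := finseq_bound y.
by exists (maxn N M) => n; rewrite geq_max => /andP[/xN -> /yM ->].
Qed.

Lemma seq_ip_semi : semi_inner seq_ip.
Proof.
split.
- move=> x y z; have [N xyN] := finseq_bound2 x y.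
  rewrite !(@seq_ipE N) => [|n /xyN[]|n /xyN[]|n /xyN[xn yn]] //; last first.
    by rewrite finseqDE xn yn addr0.
  by rewrite -big_split; apply: eq_bigr => n _; rewrite finseqDE ipDl.
- move=> r x y; have [N xN] := finseq_bound x.
  rewrite !(@seq_ipE N) => [||n /xN xn] //; last by rewrite finseqZE xn scaler0.
  by rewrite mulr_sumr; apply: eq_bigr => n _; rewrite finseqZE ipZl.
- move=> x y; have [N xyN] := finseq_bound2 x y.
  rewrite !(@seq_ipE N) => [|n /xyN[]|n /xyN[]] //.
  by apply: eq_bigr => n _; rewrite ipC.
- move=> a x y; have [N xN] := finseq_bound x.
  rewrite !(@seq_ipE N) => [||n /xN xn] //; last by rewrite finseqZE xn scaler0.
  by apply: eq_bigr => n _; rewrite finseqZE ipJ.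
- by move=> x; apply: sumr_ge0 => n _; exact: ip_ge0.
Qed.

Lemma seq_ip_shift x y : seq_ip (shiftseq x) (shiftseq y) = seq_ip x y.
Proof.
have [N xN] := finseq_bound x; rewrite (@seq_ipE N.+1) => [|[|n] //]; last exact: xN.
by rewrite big_ord_recl /= ip0l // add0r (seq_ipE _ xN).
Qed.

Lemma seq_ip_head a y : seq_ip (headseq a) y = ip a (y 0%N).
Proof. by rewrite (@seq_ipE 1) => [|[|n] //]; rewrite big_ord1. Qed.

Lemma seq_ip_map A B x y : linop A -> linop B ->
  (forall a b, ip (A a) b = ip a (B b)) ->
  seq_ip (mapseq A x) y = seq_ip x (mapseq B y).
Proof.
move=> Al Bl AB; have [N xN] := finseq_bound x.
rewrite !(@seq_ipE N) => [||n /xN xn] //; last by rewrite mapseqE // xn linop0.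
by apply: eq_bigr => n _; rewrite !mapseqE.
Qed.

Lemma mapseq_bounded A c : linop A -> 0 <= c -> bounded_by ip c A ->
  bounded_by seq_ip c (mapseq A).
Proof.
move=> Al c0 Ac x; have [N xN] := finseq_bound x.
apply: (nrm_le_sqr seq_ip_semi); first by rewrite mulr_ge0 ?nrm_ge0.
rewrite exprMn (nrmK seq_ip_semi).
rewrite !(@seq_ipE N) => [||n /xN xn] //; last by rewrite mapseqE // xn linop0.
rewrite mulr_sumr; apply: ler_sum => n _; rewrite mapseqE //.
rewrite -!(nrmK ip_semi) -exprMn ler_pXn2r ?nnegrE ?nrm_ge0 //.
by rewrite mulr_ge0 ?nrm_ge0.
Qed.

End finitely_supported_sequences.

(** * The norm of [T] from the growth of its powers *)

Section growth_and_norm.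
Variable R : realType.
Local Notation C := R[i].

Lemma bernoulli_ineq (h : R) n : -1 <= h -> 1 + n%:R * h <= (1 + h) ^+ n.
Proof.
move=> h0; elim: n => [|n IH]; first by rewrite mul0r addr0 expr0.
rewrite exprS; apply: (@le_trans _ _ ((1 + h) * (1 + n%:R * h))).
  rewrite -natr1 -subr_ge0.
  have -> : (1 + h) * (1 + n%:R * h) - (1 + (n%:R + 1) * h) = n%:R * h ^+ 2 by ring.
  by rewrite mulr_ge0 ?sqr_ge0.
by rewrite ler_wpM2l //; lra.
Qed.

Lemma geometric_unbounded (x K : R) : 1 < x -> exists n, K < x ^+ n.
Proof.
move=> x1; exists (Num.truncn (K / (x - 1))).+1.
set n := _.+1; have : K / (x - 1) < n%:R by exact: truncnS_gt.
rewrite ltr_pdivrMr ?subr_gt0 // => h; apply: lt_le_trans h _.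
have h0 : -1 <= x - 1 by lra.
have := bernoulli_ineq n h0; rewrite [1 + (x - 1)]addrC subrK; lra.
Qed.

Lemma geometric_small (r e : R) : 0 <= r -> r < 1 -> 0 < e -> exists N, r ^+ N <= e.
Proof.
move=> r0 r1 e0; have [->|r00] := eqVneq r 0; first by exists 1%N; rewrite expr1 ltW.
have rp : 0 < r by rewrite lt_neqAle eq_sym r00.
have [N hN] := @geometric_unbounded r^-1 e^-1 ltac:(by rewrite invf_gt1).
exists N; apply: ltW; rewrite exprVn in hN.
by rewrite ltf_pV2 ?posrE ?exprn_gt0 in hN.
Qed.

Variables (X : lmodType C) (ip : X -> X -> R) (T V : X -> X).
Hypothesis ip_semi : semi_inner ip.
Hypothesis V_iso : forall x, ip (V x) (V x) = ip x x.
Hypothesis T_adj : forall x y, ip (T x) y = ip (V x) (T y).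
Local Notation nrm := (inorm ip).

(** [T = T^* V] with [V] isometric gives [|T x|^2 = <V x, T^2 x> <= |x| |T^2 x|], so
    that [n |-> |T^n x|] is logarithmically convex: its first ratio
    [|T x| / |x|] is at most its exponential growth rate. *)
Lemma norm_le_growth : 
  (forall x r, 2 < r -> exists K, forall n, nrm (iter n T x) <= K * r ^+ n) ->
  bounded_by ip 2 T.
Proof.
move=> growth x; pose b n := nrm (iter n T x).
have b0 n : 0 <= b n by exact: nrm_ge0.
have logcvx n : b n.+1 ^+ 2 <= b n * b n.+2.
  rewrite /b /= nrmK // T_adj; apply: le_trans (ip_cauchy_schwarz ip_semi _ _) _.
  by rewrite {1}/inorm V_iso.
have step n : b 1%N * b n <= b n.+1 * b 0%N.
  elim: n => [|n IH]; first by rewrite mulrC.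
  have [bn|bn] := eqVneq (b n) 0.
    have : b n.+1 ^+ 2 <= 0 by rewrite (le_trans (logcvx n)) // bn mul0r.
    move=> h; have -> : b n.+1 = 0.
      by apply/eqP; rewrite -sqrf_eq0 eq_le h sqr_ge0.
    by rewrite mulr0 mulr_ge0.
  have bp : 0 < b n by rewrite lt_neqAle eq_sym bn b0.
  rewrite -(ler_pM2l bp); apply: (@le_trans _ _ (b n.+1 ^+ 2 * b 0%N)).
    by have := ler_wpM2l (b0 n.+1) IH; rewrite expr2; lra.
  by rewrite mulrA ler_wpM2r.
have [x0|x0] := eqVneq (b 0%N) 0.
  have : b 1%N ^+ 2 <= 0 by rewrite (le_trans (logcvx 0)) // x0 mul0r.
  move=> h; have h1 : b 1%N = 0 by apply/eqP; rewrite -sqrf_eq0 eq_le h sqr_ge0.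
  by rewrite -[nrm (T x)]/(b 1%N) h1 mulr_ge0 ?nrm_ge0.
have bp : 0 < b 0%N by rewrite lt_neqAle eq_sym x0 b0.
have geo n : (b 1%N / b 0%N) ^+ n * b 0%N <= b n.
  elim: n => [|n IH]; first by rewrite mul1r.
  have q0 : 0 <= b 1%N / b 0%N by rewrite divr_ge0.
  rewrite exprS -mulrA (le_trans (ler_wpM2l q0 IH)) //.
  by rewrite mulrAC ler_pdivrMr.
rewrite leNgt; apply/negP => lt2.
have q2 : 2 < b 1%N / b 0%N by rewrite ltr_pdivlMr.
set q := b 1%N / b 0%N in geo q2; pose r := (2 + q) / 2.
have [K hK] := growth x r ltac:(rewrite /r; lra).
have [n hn] : exists n, K / b 0%N < (q / r) ^+ n.
  by apply: geometric_unbounded; rewrite ltr_pdivlMr /r; lra.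
have rp : 0 < r by rewrite /r; lra.
have := le_trans (geo n) (hK n).
rewrite leNgt; move/negP; apply.
by rewrite ltr_pdivrMr // expr_div_n mulrAC ltr_pdivlMr ?exprn_gt0 in hn.
Qed.

End growth_and_norm.

(** * Numerical radius and the pencil [A + w A^*] *)

Section numerical_radius.
Variable R : realType.
Local Notation C := R[i].
Variables (X : lmodType C) (ip : X -> X -> R).
Hypothesis ip_semi : semi_inner ip.

(** Polarisation of the form [<Z x, x>] gives [<Z x, y> <= |x|^2 + |y|^2], which is
    used at [y = Z x / 2]. *)
Lemma selfadjoint_norm_le (Z : X -> X) : linop Z ->
  (forall x y, ip (Z x) y = ip x (Z y)) -> (forall x, `|ip (Z x) x| <= 2 * ip x x) ->
  bounded_by ip 2 Z.
Proof.
move=> Zl Zs Zn x; apply: nrm_le_sqr => //; first by rewrite mulr_ge0 ?nrm_ge0.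
rewrite exprMn nrmK //.
have polar a b : ip (Z a) b <= ip a a + ip b b.
  have := Zn (a + b); have := Zn (a - b); have := parallelogram ip_semi a b.
  rewrite !ler_norml !(linopD Zl) (linopN Zl).
  rewrite !(ipDl ip_semi, ipDr ip_semi, ipNl ip_semi, ipNr ip_semi).
  rewrite (ipC ip_semi (Z b) a) -Zs => _ /andP[h1 _] /andP[_ h2].
  by rewrite (ipC ip_semi b a) in h1 h2; lra.
have := polar x ((2^-1)%:C%C *: Z x).
by rewrite !ipZr // ipZl //; lra.
Qed.

Variables (A Ad : X -> X).
Hypotheses (A_lin : linop A) (Ad_lin : linop Ad).
Hypothesis A_adj : forall x y, ip (A x) y = ip x (Ad y).
Hypothesis A_num : forall (u : C) x, rnorm u = 1 -> ip (u *: A x) x <= ip x x.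

(** Let [w = v ^+ 2]. Then [A + w A^* = v (v^* A + v A^* )], and the operator in
    brackets is selfadjoint, with values [2 Re (v^* <A x, x>)] at most [2 |x|^2]. *)
Lemma pencil_norm_le (w : C) : rnorm w = 1 ->
  bounded_by ip 2 (fun x => A x + Ad (w *: x)).
Proof.
move=> w1; pose v := sqrtC w.
have vw : v * v = w by rewrite -expr2 sqrtCK.
have v1 : rnorm v = 1.
  have : rnorm v ^+ 2 = 1 by rewrite -rnormX expr2 vw.
  by move/eqP; rewrite sqrf_eq1 => /orP[] /eqP // h; have := rnorm_ge0 v; rewrite h; lra.
have vJ := unimodular_conj v1.
pose Z x := (v^*)%C *: A x + v *: Ad x.
have Zl : linop Z by apply: linop_add; apply: linop_scale.
have AZ x : A x + Ad (w *: x) = v *: Z x.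
  by rewrite scalerDr !scalerA vJ vw scale1r linopZ.
have Zh x y : ip ((v^*)%C *: A x) y = ip x (v *: Ad y).
  by rewrite ipJ // conjcK A_adj linopZ.
have Zs x y : ip (Z x) y = ip x (Z y).
  rewrite ipDl // ipDr // Zh (ipC ip_semi (v *: Ad x)) -(Zh y x).
  by rewrite (ipC ip_semi _ x) addrC.
have Zx x : ip (Z x) x = 2 * ip ((v^*)%C *: A x) x.
  by rewrite ipDl // (ipC ip_semi (v *: Ad x)) -(Zh x x); ring.
have Zn x : `|ip (Z x) x| <= 2 * ip x x.
  rewrite Zx ler_norml.
  have := @A_num (v^*)%C x; rewrite rnorm_conj => /(_ v1) h1.
  have := @A_num (- v^*)%C x; rewrite rnormN rnorm_conj scaleNr ipNl // => /(_ v1) h2.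
  by lra.
move=> x; rewrite AZ nrmZ // v1 mul1r.
exact: selfadjoint_norm_le.
Qed.

End numerical_radius.

(** * The dilation *)

(** On [H + H + H + ...] the isometry is Schaffer's dilation
    [V (x, y) = (P x, D x, y_0, y_1, ...)] of [P], and [T] acts on the sequences [y]
    as the Toeplitz operator of symbol [A + w A^*], with the corner [A^* D] that
    makes [T] commute with [V]. The relation [T V = V T] amounts to
    [D S = A D + A^* D P], and [T = T^* V] to [S = S^* P + D A D]. *)

Section dilation.
Variable R : realType.
Local Notation C := R[i].
Variables (X : lmodType C) (ip : X -> X -> R).
Hypothesis ip_semi : semi_inner ip.
Variables (S P D A Ad : X -> X) (c : R).
Hypotheses (S_lin : linop S) (P_lin : linop P) (D_lin : linop D).
Hypotheses (A_lin : linop A) (Ad_lin : linop Ad).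
Hypothesis SP : forall x, S (P x) = P (S x).
Hypothesis PD : forall x y, ip (P x) (P y) + ip (D x) (D y) = ip x y.
Hypothesis A_adj : forall x y, ip (A x) y = ip x (Ad y).
Hypothesis c_ge0 : 0 <= c.
Hypotheses (A_bound : bounded_by ip c A) (Ad_bound : bounded_by ip c Ad).
Hypothesis A_num : forall (u : C) x, rnorm u = 1 -> ip (u *: A x) x <= ip x x.
Hypothesis S_adj : forall x y, ip (S x) y = ip (P x) (S y) + ip (A (D x)) (D y).
Hypothesis DS : forall x, D (S x) = A (D x) + Ad (D (P x)).
Hypothesis S_growth : forall x r, 2 < r ->
  exists K, forall n, inorm ip (iter n S x) <= K * r ^+ n.

Local Notation K := (finseq X).
Local Notation ipK := (seq_ip ip).
Let ipK_semi : semi_inner ipK := seq_ip_semi ip_semi.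

Definition toeplitz (x : K) : K := mapseq A x + mapseq Ad (shiftseq x).

Lemma toeplitz_lin : linop toeplitz.
Proof.
apply: linop_add; first exact: mapseq_lin.
by apply: linop_comp (@shiftseq_lin _ X); exact: mapseq_lin.
Qed.

(** [toeplitz] is [A + A^* W] for the shift [W], which is an isometry. *)
Lemma toeplitz_bound : bounded_by ipK 2 toeplitz.
Proof.
have shn x : inorm ipK (shiftseq x) = inorm ipK x by rewrite /inorm seq_ip_shift.
have sW := symbol_id ipK_semi (@shiftseq_lin _ X) shn.
have sC B : linop B -> bounded_by ip c B ->
    ex_symbol ipK (@shiftseq _ X) (mapseq B) (fun _ => mapseq B).
  move=> Bl Bc; apply: (@symbol_const _ _ _ ipK_semi _ _ c) => //.
  - exact: mapseq_lin.
  - by move=> x; rewrite mapseq_shift.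
  - exact: mapseq_bounded.
have [M sM] := symbol_add ipK_semi (@shiftseq_lin _ X) (sC _ A_lin A_bound)
  (symbol_comp ipK_semi (sC _ Ad_lin Ad_bound) sW).
apply: (symbol_bound ipK_semi (@shiftseq_lin _ X) _ sM) => // [x|w w1].
  by rewrite seq_ip_shift.
have pl : linop (fun x : X => A x + Ad (w *: x)).
  apply: linop_add => //; apply: (@linop_comp _ _ _ _ Ad) => //.
  by move=> a x y; rewrite scalerDr !scalerA mulrC.
move=> x.
have -> : mapseq A x + mapseq Ad (w *: x) = mapseq (fun x : X => A x + Ad (w *: x)) x.
  by apply: finseqP => n; rewrite finseqDE !mapseqE.
by apply: mapseq_bounded => //; exact: pencil_norm_le.
Qed.

Definition dil_ip (u v : X * K) : R := ip u.1 v.1 + ipK u.2 v.2.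
Definition dilS (u : X * K) : X * K := (S u.1, headseq (Ad (D u.1)) + toeplitz u.2).
Definition dilP (u : X * K) : X * K := (P u.1, headseq (D u.1) + shiftseq u.2).

Lemma dil_ip_semi : semi_inner dil_ip.
Proof.
split; rewrite /dil_ip.
- by move=> x y z /=; rewrite (ipDl ip_semi) (ipDl ipK_semi); ring.
- by move=> r x y /=; rewrite (ipZl ip_semi) (ipZl ipK_semi); ring.
- by move=> x y; rewrite (ipC ip_semi) (ipC ipK_semi).
- by move=> a x y /=; rewrite (ipJ ip_semi) (ipJ ipK_semi).
- by move=> x; rewrite addr_ge0 ?(ip_ge0 ip_semi) ?(ip_ge0 ipK_semi).
Qed.

Lemma dilS_lin : linop dilS.
Proof.
move=> a x y; rewrite /dilS /=; congr pair => /=; first exact: S_lin.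
rewrite D_lin Ad_lin (@headseq_lin _ X) toeplitz_lin.
by rewrite addrACA -scalerDr.
Qed.

Lemma dilP_lin : linop dilP.
Proof.
move=> a x y; rewrite /dilP /=; congr pair => /=; first exact: P_lin.
by rewrite D_lin (@headseq_lin _ X) (@shiftseq_lin _ X) scalerDr addrACA.
Qed.

Lemma toeplitz_head a :
  toeplitz (headseq a) = headseq (A a) + shiftseq (headseq (Ad a)).
Proof. by rewrite /toeplitz mapseq_head // mapseq_shift mapseq_head. Qed.

Lemma toeplitz_shift x : toeplitz (shiftseq x) = shiftseq (toeplitz x).
Proof.
by rewrite /toeplitz (linopD (@shiftseq_lin _ X)) !mapseq_shift.
Qed.

Lemma dil_comm u : dilS (dilP u) = dilP (dilS u).
Proof.
case: u => x y; rewrite /dilS /dilP /=; congr pair; first exact: SP.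
rewrite (linopD toeplitz_lin) toeplitz_head toeplitz_shift.
move: (toeplitz y) => t.
rewrite (linopD (@shiftseq_lin _ X)) DS (linopD (@headseq_lin _ X)) !addrA.
by rewrite [headseq (Ad _) + headseq _]addrC.
Qed.

Lemma seq_ip_head_shift a y : ipK (headseq a) (shiftseq y) = 0.
Proof. by rewrite seq_ip_head // ip0r. Qed.

Lemma dilP_iso u v : dil_ip (dilP u) (dilP v) = dil_ip u v.
Proof.
case: u v => x y [x' y']; rewrite /dil_ip /=.
rewrite (ipDl ipK_semi) !(ipDr ipK_semi) seq_ip_shift // seq_ip_head_shift.
rewrite (ipC ipK_semi (shiftseq y)) seq_ip_head_shift seq_ip_head //=.
by rewrite -(PD x x'); ring.
Qed.

Lemma toeplitz_adj x y : ipK (toeplitz x) y = ipK (shiftseq x) (toeplitz y).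
Proof.
have A_adj' a b : ip (Ad a) b = ip a (A b).
  by rewrite (ipC ip_semi) -A_adj (ipC ip_semi).
rewrite (ipDl ipK_semi) (ipDr ipK_semi) (seq_ip_map ip_semi _ _ Ad_lin A_lin A_adj').
rewrite (seq_ip_map ip_semi _ _ A_lin Ad_lin A_adj) addrC mapseq_shift seq_ip_shift //.
Qed.

Lemma dilS_adj u v : dil_ip (dilS u) v = dil_ip (dilP u) (dilS v).
Proof.
case: u v => x y [x' y']; rewrite /dil_ip /=.
rewrite (ipDl ipK_semi (headseq (Ad (D x)))) toeplitz_adj S_adj.
rewrite (ipDl ipK_semi (headseq (D x))) !(ipDr ipK_semi _ (headseq (Ad (D x')))).
rewrite (ipC ipK_semi (shiftseq y) (headseq _)) seq_ip_head_shift !seq_ip_head //.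
have -> : toeplitz y' 0%N = A (y' 0%N).
  by rewrite /toeplitz finseqDE !mapseqE //= linop0 // addr0.
have A_adj' a b : ip (Ad a) b = ip a (A b).
  by rewrite (ipC ip_semi) -A_adj (ipC ip_semi).
by rewrite A_adj' A_adj /=; ring.
Qed.

(** [dilS] is triangular: its diagonal entries [S] and [toeplitz] have growth rate at
    most [2], and the off-diagonal entry contributes a geometric sum. The constant
    [M'] is a supersolution of the recursion [a_(n+1) <= c M r^n + 2 a_n]. *)
Lemma dilS_growth u r : 2 < r ->
  exists M, forall n, inorm dil_ip (iter n dilS u) <= M * r ^+ n.
Proof.
move=> r2; case: u => x y; have [M hM] := S_growth x r2.
have r0 n : 0 <= r ^+ n by rewrite exprn_ge0 //; lra.
have M0 : 0 <= M by have := hM 0%N; rewrite expr0 mulr1; apply: le_trans; exact: nrm_ge0.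
have e1 n : (iter n dilS (x, y)).1 = iter n S x by elim: n => //= n ->.
have Dle z : inorm ip (D z) <= inorm ip z.
  by apply: nrm_le => //; rewrite -[leRHS]PD lerDr ip_ge0.
pose M' := inorm ipK y + c * M / (r - 2).
have M'0 : 0 <= M'.
  by rewrite addr_ge0 ?nrm_ge0 // divr_ge0 ?mulr_ge0 //; lra.
have e2 n : inorm ipK (iter n dilS (x, y)).2 <= M' * r ^+ n.
  elim: n => [|n IH].
    by rewrite expr0 mulr1 lerDl divr_ge0 ?mulr_ge0 //; lra.
  rewrite iterS /= e1; apply: le_trans (nrmD ipK_semi _ _) _.
  have h1 : inorm ipK (headseq (Ad (D (iter n S x)))) <= c * M * r ^+ n.
    have -> z : inorm ipK (headseq z) = inorm ip z.
      by rewrite /inorm seq_ip_head.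
    apply: le_trans (Ad_bound _) _; rewrite -mulrA ler_wpM2l //.
    exact: le_trans (Dle _) (hM n).
  have h2 := toeplitz_bound (iter n dilS (x, y)).2.
  have h3 : c * M * r ^+ n + 2 * (M' * r ^+ n) <= M' * r ^+ n.+1.
    rewrite exprS -subr_ge0.
    have -> : M' * (r * r ^+ n) - (c * M * r ^+ n + 2 * (M' * r ^+ n))
       = ((r - 2) * M' - c * M) * r ^+ n by ring.
    rewrite mulr_ge0 // /M'.
    have -> : (r - 2) * (inorm ipK y + c * M / (r - 2)) - c * M
       = (r - 2) * inorm ipK y by field; lra.
    by rewrite mulr_ge0 ?nrm_ge0 //; lra.
  by lra.
exists (M + M') => n; apply: (nrm_le_sqr dil_ip_semi).
  by rewrite mulr_ge0 // addr_ge0.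
rewrite /dil_ip -(nrmK ip_semi) -(nrmK ipK_semi) e1 mulrDl.
set a := inorm ip _; set b := inorm ipK _.
have h1 : a ^+ 2 <= (M * r ^+ n) ^+ 2.
  by rewrite ler_pXn2r ?nnegrE ?nrm_ge0 ?mulr_ge0 // hM.
have h2 : b ^+ 2 <= (M' * r ^+ n) ^+ 2.
  by rewrite ler_pXn2r ?nnegrE ?nrm_ge0 ?mulr_ge0 // e2.
have h3 : 0 <= (M * r ^+ n) * (M' * r ^+ n) by rewrite !mulr_ge0.
by rewrite sqrrD; lra.
Qed.

(** [H] is co-invariant: the first component of [f(T, V)] is [f(S, P)]. *)
Lemma dilation_bound (f : {poly {poly C}}) (B : R) : 0 <= B ->
  (forall a b : C, rnorm a = 1 -> rnorm b = 1 -> rnorm f.[a + b, a * b] <= B) ->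
  bounded_by ip B (poly_at f S P).
Proof.
move=> B0 fB x.
have dilS2 : bounded_by dil_ip 2 dilS.
  apply: (norm_le_growth dil_ip_semi (V := dilP)) => //.
  - by move=> u; exact: dilP_iso.
  - exact: dilS_adj.
  - exact: dilS_growth.
have := gamma_isometry_bound dil_ip_semi dilS_lin dilP_lin dil_comm dilP_iso
  dilS_adj dilS2 B0 fB (x, 0).
have -> : inorm dil_ip (x, 0) = inorm ip x.
  by rewrite /inorm /dil_ip /= (ip0l ipK_semi) addr0.
apply: le_trans.
have -> : poly_at f S P x = (poly_at f dilS dilP (x, 0)).1.
  by rewrite (@poly_at_intertwine _ _ _ (@fst X K) dilS dilP S P).
rewrite /inorm ler_sqrt /dil_ip; last first.
  by rewrite addr_ge0 ?(ip_ge0 ip_semi) ?(ip_ge0 ipK_semi).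
by rewrite lerDl (ip_ge0 ipK_semi).
Qed.

End dilation.

(** * The spectral radius bounds the growth of powers *)

Section uniform_lower_bound.
Variable R : realType.
Local Notation C := R[i].

Lemma complex_of_pairB (a b a' b' : R) :
  rnorm (Complex a b - Complex a' b') <= `|a - a'| + `|b - b'|.
Proof.
have -> : Complex a b - Complex a' b' = Complex (a - a') (b - b') by [].
move: (a - a') (b - b') => u v.
rewrite /rnorm normc_def /= -[X in _ <= X]ger0_norm ?addr_ge0 // -sqrtr_sqr.
rewrite ler_sqrt ?sqr_ge0 // sqrrD !real_normK ?num_real //.
by have := mulr_ge0 (normr_ge0 u) (normr_ge0 v); lra.
Qed.

(** Compactness of the disc, transported from a square in [R * R] and used for a
    family [Q m] of properties that weaken as [m] decreases to [0]. *)
Lemma uniform_on_disc (Q : R -> C -> Prop) (M : R) :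
  (forall m m' z, m' <= m -> Q m z -> Q m' z) ->
  (forall z, rnorm z <= M -> exists m e, [/\ 0 < m, 0 < e &
     forall z', rnorm (z - z') < e -> Q m z']) ->
  exists2 m, 0 < m & forall z, rnorm z <= M -> Q m z.
Proof.
move=> Qmono Qloc.
pose disc := [set p : R * R | rnorm (Complex p.1 p.2) <= M].
pose sq : set (R * R) := `[- M, M]%classic `*` `[- M, M]%classic.
have sq_compact : near_covering sq.
  by apply/compact_near_coveringP; apply: compact_setX; exact: segment_compact.
pose P (m : R) (p : R * R) := rnorm (Complex p.1 p.2) <= M -> Q m (Complex p.1 p.2).
have : \forall m \near 0^'+, sq `<=` P m.
  apply: sq_compact => -[a b] _.
  have [zM|zM] := lerP (rnorm (Complex a b)) M; last first.
    pose e := (rnorm (Complex a b) - M) / 2.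
    have e0 : 0 < e by rewrite /e; lra.
    exists (ball ((a, b) : R * R) e, setT).
      by split; [exact: nbhsx_ballx|exact: filterT].
    move=> [[a' b'] m] [[/= ha hb] _] /=; rewrite /P /= => zM'; exfalso.
    have h := rnormD (Complex a b - Complex a' b') (Complex a' b').
    rewrite subrK in h; have := complex_of_pairB a b a' b'.
    rewrite /ball /= in ha hb; rewrite /e in ha hb; lra.
  have [m0 [e [m00 e0 Hm]]] := Qloc _ zM.
  have e20 : 0 < e / 2 by lra.
  exists (ball ((a, b) : R * R) (e / 2), [set m | m < m0]).
    split; [exact: nbhsx_ballx|exact: nbhs_right_lt].
  move=> [[a' b'] m] [[/= ha hb] mm0] /=; rewrite /P /= => zM'.
  apply: (Qmono m0); first exact: ltW.
  apply: Hm; apply: le_lt_trans (complex_of_pairB a b a' b') _.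
  by rewrite /ball /= in ha hb; lra.
move=> h; have [m [m0 hm]] : exists m : R, 0 < m /\ sq `<=` P m.
  apply: (filter_ex (F := 0^'+)); apply: filterI h; exact: nbhs_right_gt.
exists m => // -[a b] zM; apply: (hm (a, b)) => //.
have sM (x : R) : x ^+ 2 <= rnorm (Complex a b) ^+ 2 -> x \in `[- M, M].
  have M0 := le_trans (rnorm_ge0 _) zM.
  move=> h1; rewrite in_itv /= -ler_norml; apply: le_trans zM.
  by rewrite -(ler_pXn2r (n := 2)) ?nnegrE ?rnorm_ge0 // real_normK ?num_real.
by split; apply: sM; rewrite sqr_rnorm /= ?lerDl ?lerDr sqr_ge0.
Qed.

End uniform_lower_bound.

Section spectral_growth.
Variable R : realType.
Local Notation C := R[i].
Variables (X : lmodType C) (ip : X -> X -> R).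
Hypothesis ip_semi : semi_inner ip.
Local Notation nrm := (inorm ip).
Variables (S : X -> X) (c : R).
Hypotheses (S_lin : linop S) (c_gt0 : 0 < c) (S_bound : bounded_by ip c S).

Definition growth (r : R) : Prop :=
  exists2 K, 0 <= K & forall n, bounded_by ip (K * r ^+ n) (iter n S).

Definition lower_bound (k : R) (z : C) : Prop :=
  forall x, k * nrm x <= nrm (S x - z *: x).

Definition has_resolvent (z : C) : Prop :=
  exists U : X -> X, (exists K, bounded_by ip K U) /\
    (forall x, U (S x - z *: x) = x) /\ (forall x, S (U x) - z *: U x = x).

Lemma growth_le r r' : 0 <= r -> r <= r' -> growth r -> growth r'.
Proof.
move=> r0 rr' [K K0 hK]; exists K => // n x; apply: le_trans (hK n x) _.
by rewrite ler_wpM2r ?nrm_ge0 // ler_wpM2l // lerXn2r ?nnegrE // (le_trans r0).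
Qed.

Lemma iter_bound n : bounded_by ip (c ^+ n) (iter n S).
Proof.
elim: n => [|n IH] x; first by rewrite expr0 mul1r.
apply: le_trans (S_bound _) _; rewrite exprS -mulrA.
by apply: ler_wpM2l (IH x); exact: ltW.
Qed.

Lemma resolvent_lower_bound z : has_resolvent z -> exists2 k, 0 < k & lower_bound k z.
Proof.
move=> [U [[K hK] [US _]]]; exists ((`|K| + 1)^-1).
  by rewrite invr_gt0 ltr_wpDl.
move=> x; rewrite mulrC ler_pdivrMr ?ltr_wpDl //.
rewrite -{1}(US x); apply: le_trans (hK _) _.
rewrite mulrC ler_wpM2l ?nrm_ge0 //; have := ler_norm K; lra.
Qed.

Lemma lower_bound_near k z z' : 0 < k -> lower_bound k z ->
  rnorm (z - z') <= k / 2 -> lower_bound (k / 2) z'.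
Proof.
move=> k0 hk zz x; have := hk x.
have -> : S x - z *: x = (S x - z' *: x) - (z - z') *: x.
  by rewrite scalerBl opprB addrA subrK.
move=> h; have := le_trans h (nrmB ip_semi _ _); rewrite nrmZ //.
have := ler_wpM2r (nrm_ge0 ip x) zz; lra.
Qed.

Lemma uniform_resolvent_bound rho M : 2 < rho ->
  (forall z, 2 < rnorm z -> has_resolvent z) ->
  exists2 k, 0 < k & forall z, rho <= rnorm z -> rnorm z <= M -> lower_bound k z.
Proof.
move=> rho2 res.
have [||k k0 hk] := @uniform_on_disc R
    (fun k z => rho <= rnorm z -> lower_bound k z) M.
- move=> m m' z mm' h zr x; apply: le_trans (h zr x).
  by rewrite ler_wpM2r ?nrm_ge0.
- move=> z _; have [z2|z2] := lerP (rnorm z) 2.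
    exists 1, (rho - 2); split => //; first by lra.
    move=> z' zz' rz'; exfalso.
    have := rnormD (z' - z) z; rewrite subrK.
    rewrite -[z' - z]opprB rnormN; lra.
  have [k k0 hk] := resolvent_lower_bound (res _ z2).
  exists (k / 2), (k / 2); split; [lra|lra|] => z' zz' _.
  by apply: (lower_bound_near k0 hk); exact: ltW.
by exists k => // z zr zM; exact: hk.
Qed.

Lemma geometric_telescope n (m : C) x :
  \sum_(l < n) (m^-1) ^+ l *: iter l S (x - m^-1 *: S x)
    = x - (m^-1) ^+ n *: iter n S x.
Proof.
pose h l := (m^-1) ^+ l *: iter l S x.
transitivity (\sum_(0 <= l < n) (h l - h l.+1)).
  rewrite big_mkord; apply: eq_bigr => l _; rewrite /h.
  rewrite (linopB (linop_iter l S_lin)) (linopZ (linop_iter l S_lin)).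
  by rewrite scalerBr scalerA -exprSr -iterSr.
have -> : \sum_(0 <= l < n) (h l - h l.+1) = - \sum_(0 <= l < n) (h l.+1 - h l).
  by rewrite -sumrN; apply: eq_bigr => l _; rewrite opprB.
by rewrite telescope_sumr // opprB /h expr0 scale1r.
Qed.

(** Averaging the truncated Neumann series of [S / a] over all rotations of [a]
    leaves only the constant term. *)
Lemma roots_of_unity_average n (w a : C) x : n.-primitive_root w -> a != 0 ->
  \sum_(j < n) \sum_(l < n) ((a * w ^+ j)^-1) ^+ l *: iter l S x = n%:R *: x.
Proof.
move=> pw a0; have n0 := prim_order_gt0 pw; have wn := prim_expr_order pw.
have w0 := unimodular_neq0 (root_of_unity_unimodular n0 wn).
rewrite exchange_big /= (bigD1 (Ordinal n0)) //= [X in _ + X]big1 ?addr0.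
  under eq_bigr => j _ do rewrite expr0 scale1r.
  by rewrite sumr_const card_ord scaler_nat.
move=> l l0; rewrite -scaler_suml.
under eq_bigr => j _ do rewrite invfM exprMn -exprVn -exprM mulnC exprM.
rewrite -mulr_sumr sum_root_of_unity ?mulr0 ?scale0r //.
  by rewrite -exprM mulnC exprM exprVn wn invr1 expr1n.
apply: contra l0; rewrite exprVn invr_eq1 => /eqP wl.
have : w ^+ l == w ^+ 0 by rewrite wl expr0.
by rewrite (eq_prim_root_expr pw) !modn_small // => /eqP l0; apply/eqP/val_inj.
Qed.

(** The exponents [n = q N + s] are controlled by the [N]-th power and by at most
    [N] factors of norm [c]. *)
Lemma growth_of_power N r : (0 < N)%N -> 0 < r ->
  bounded_by ip (r ^+ N) (iter N S) -> growth r.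
Proof.
move=> N0 r0 hN; have cr : 0 <= c / r by rewrite divr_ge0 // ltW.
exists ((1 + c / r) ^+ N); first by rewrite exprn_ge0 // addr_ge0.
move=> n x; rewrite (divn_eq n N) addnC iterD.
set q := (n %/ N)%N; set s := (n %% N)%N.
have hq : nrm (iter (q * N) S x) <= r ^+ (q * N) * nrm x.
  elim: q => [|q IH]; first by rewrite mul0n expr0 mul1r.
  rewrite mulSn iterD exprD -mulrA; apply: le_trans (hN _) _.
  by rewrite ler_wpM2l // exprn_ge0 // ltW.
apply: le_trans (iter_bound s _) _.
have rs y : 0 <= r ^+ y by rewrite exprn_ge0 // ltW.
rewrite exprD mulrA -[leRHS]mulrA; apply: ler_pM => //.
- by rewrite exprn_ge0 // ltW.
- exact: nrm_ge0.
rewrite -[leLHS](@divfK _ (r ^+ s)) ?expf_neq0 ?gt_eqF // -expr_div_n.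
rewrite ler_wpM2r //.
apply: (@le_trans _ _ ((1 + c / r) ^+ s)).
  by rewrite lerXn2r ?nnegrE ?addr_ge0 // lerDr.
have sN : (s <= N)%N by rewrite ltnW // ltn_mod.
by rewrite ler_weXn2l // lerDl.
Qed.

(** The elementary proof of the spectral radius formula. Put
    [y = x - (S / rho)^N x]. The average of the resolvents [(1 - S / mu)^-1 y] over
    the points [mu = rho w^j], where [w] is a primitive [N]-th root of unity, is
    [x], and over the points [nu = r w^j] it is a
    vector [z] with [z - (S / r)^N z = y], hence close to [y] for large [N] as soon
    as [r > rho]. Since resolvents are uniformly Lipschitz on the closed annulus
    between both circles, [x] is close to [z] for [r] near [rho], whatever [N] is.
    So [x] is close to [y], which means that [(S / rho)^N] is small. *)
Lemma growth_improve rho : 2 < rho ->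
  (forall z, 2 < rnorm z -> has_resolvent z) ->
  (forall r, rho < r -> growth r) -> exists2 r, 0 < r < rho & growth r.
Proof.
move=> rho2 res gr.
have rho0 : 0 < rho by lra.
have [k k0 hk] := @uniform_resolvent_bound rho (rho + 1) rho2 res.
(* E is the Lipschitz constant of the resolvents between the two circles; d, the
   distance of the circles, is chosen before N. *)
pose E := (1 + (rho + 1) / k) / k.
have E0 : 0 < E by rewrite divr_gt0 // addr_gt0 // divr_gt0 //; lra.
pose d := Num.min 1 ((6 * E)^-1).
have d0 : 0 < d by rewrite lt_min ltr01 invr_gt0 mulr_gt0.
have d1 : d <= 1 by rewrite ge_min lexx.
have dE : d * E <= 6^-1.
  apply: (@le_trans _ _ ((6 * E)^-1 * E)).
    by rewrite ler_wpM2r ?(ltW E0) // ge_min lexx orbT.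
  by rewrite invfM mulfVK ?gt_eqF.
pose r := rho + d; pose r1 := rho + d / 2.
have r0 : 0 < r by rewrite /r; lra.
have r10 : 0 < r1 by rewrite /r1; lra.
have [K K0 hK] := gr r1 ltac:(rewrite /r1; lra).
have [N0 hN0] : exists n, 8 * (K + 1) < (r / r1) ^+ n.
  by apply: geometric_unbounded; rewrite ltr_pdivlMr // /r /r1; lra.
pose N := N0.+1.
have hN x : nrm ((r%:C%C^-1) ^+ N *: iter N S x) <= 8^-1 * nrm x.
  rewrite nrmZ // rnormX rnormV rnorm_realE gtr0_norm //.
  have hN : 8 * K <= (r / r1) ^+ N.
    apply: le_trans (_ : (r / r1) ^+ N0 <= _); first by move: hN0; lra.
    rewrite exprS ler_peMl ?exprn_ge0 ?divr_ge0 ?(ltW r0) ?(ltW r10) //.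
    by rewrite ler_pdivlMr // /r /r1; lra.
  rewrite exprVn mulrC ler_pdivrMr ?exprn_gt0 //.
  apply: le_trans (hK N x) _.
  have rN : 0 < r1 ^+ N by rewrite exprn_gt0.
  rewrite expr_div_n ler_pdivlMr // in hN.
  have := ler_wpM2r (nrm_ge0 ip x) hN; lra.
have [w pw] := ex_primitive_root R (ltn0Sn N0 : (0 < N)%N).
have wN := prim_expr_order pw.
have w1 := root_of_unity_unimodular (ltn0Sn N0) wN.
have NR : (N%:R : C) != 0 by rewrite pnatr_eq0.
have rC0 : r%:C%C != 0 :> C.
  by apply/eqP => /complexI h; move: r0; rewrite h ltxx.
have rhoC0 : rho%:C%C != 0 :> C.
  by apply/eqP => /complexI h; move: rho0; rewrite h ltxx.
(* The Nth powers of the points of both circles do not depend on j. *)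
have powN (a : C) j : ((a * w ^+ j)^-1) ^+ N = (a^-1) ^+ N.
  rewrite invfM exprMn -[RHS]mulr1; congr (_ * _).
  by rewrite exprVn -exprM mulnC exprM wN expr1n invr1.
have half x : nrm ((rho%:C%C^-1) ^+ N *: iter N S x) <= 2^-1 * nrm x.
  have [y yE] : exists y, y = x - (rho%:C%C^-1) ^+ N *: iter N S x by eexists.
  have ratio : nrm (x - y) <= 3^-1 * nrm y.
    pose mu j : C := rho%:C%C * w ^+ j; pose nu j : C := r%:C%C * w ^+ j.
    have wj j : rnorm (w ^+ j) = 1 by rewrite rnormX w1 expr1n.
    have nmu j : rnorm (mu j) = rho.
      by rewrite rnormM wj mulr1 rnorm_realE gtr0_norm.
    have nnu j : rnorm (nu j) = r.
      by rewrite rnormM wj mulr1 rnorm_realE gtr0_norm.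
    have mu0 j : mu j != 0 by rewrite mulf_neq0 // expf_neq0 // unimodular_neq0.
    have nu0 j : nu j != 0 by rewrite mulf_neq0 // expf_neq0 // unimodular_neq0.
    (* g j and h j are the values at y of the resolvents at mu j and nu j; the
       former is known explicitly as a finite geometric series applied to x. *)
    have res_nu j : exists h, S h - nu j *: h = - (nu j *: y).
      have [|U [_ [_ SU]]] := res (nu j); first by rewrite nnu /r; lra.
      by exists (U (- (nu j *: y))).
    pose h j := projT1 (cid (res_nu j)).
    have hE j : S (h j) - nu j *: h j = - (nu j *: y) by rewrite /h; case: cid.
    have hE' j : h j - (nu j)^-1 *: S (h j) = y.
      have := congr1 (fun v => - ((nu j)^-1 *: v)) (hE j).
      rewrite scalerBr opprB !scalerA mulVf // scale1r.
      by rewrite scalerN opprK scalerA mulVf // scale1r.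
    pose g j := \sum_(l < N) ((mu j)^-1) ^+ l *: iter l S x.
    have gE' j : g j - (mu j)^-1 *: S (g j) = y.
      rewrite yE -(powN rho%:C%C j) -geometric_telescope /g (linop_sum S_lin) scaler_sumr -sumrB.
      apply: eq_bigr => l _; rewrite (linopB (linop_iter l S_lin)).
      rewrite (linopZ (linop_iter l S_lin)) (linopZ S_lin) scalerBr -iterSr iterS.
      by move: (mu j)^-1 => m; rewrite !scalerA [in RHS]mulrC.
    have gE j : S (g j) - mu j *: g j = - (mu j *: y).
      by rewrite -(gE' j) scalerBr scalerA divff // scale1r opprB.
    have hbound j : nrm (h j) <= (rho + 1) / k * nrm y.
      rewrite mulrAC ler_pdivlMr // mulrC.
      apply: le_trans (hk (nu j) _ _ (h j)) _; rewrite ?nnu /r; [lra|lra|].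
      rewrite hE nrmN // nrmZ // nnu ler_wpM2r ?nrm_ge0 // /r; lra.
    have ghbound j : nrm (g j - h j) <= 6^-1 * nrm y.
      have ghE : S (g j - h j) - mu j *: (g j - h j) = (nu j - mu j) *: (y - h j).
        rewrite linopB // !scalerBr !scalerBl.
        have -> : S (g j) = mu j *: g j - mu j *: y.
          by rewrite -[LHS](subrK (mu j *: g j)) gE addrC.
        have -> : S (h j) = nu j *: h j - nu j *: y.
          by rewrite -[LHS](subrK (nu j *: h j)) hE addrC.
        move: (mu j *: g j) (mu j *: y) (nu j *: h j) (nu j *: y) (mu j *: h j).
        move=> a1 a2 a3 a4 a5.
        rewrite !opprB [a1 - a2]addrC addrAC [a5 - a1]addrC.
        rewrite [- a2 + a1 + (- a1 + a5)]addrA addrK.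
        by rewrite [LHS]addrC addrACA [- a3 + a5]addrC.
      have dmu : rnorm (nu j - mu j) = d.
        by rewrite -mulrBl rnormM wj mulr1 -rmorphB rnorm_realE /r addrC addKr gtr0_norm.
      have := hk (mu j) _ _ (g j - h j); rewrite nmu ghE nrmZ // dmu.
      move=> /(_ (lexx _) ltac:(lra)) h1.
      have h2 : nrm (y - h j) <= (1 + (rho + 1) / k) * nrm y.
        by apply: le_trans (nrmB ip_semi _ _) _; rewrite mulrDl mul1r lerD2l.
      have h3 : k * nrm (g j - h j) <= k * (d * E * nrm y).
        apply: le_trans h1 _; apply: le_trans (ler_wpM2l (ltW d0) h2) _.
        rewrite le_eqVlt; apply/orP; left; apply/eqP; rewrite /E; field.
        by rewrite gt_eqF.
      rewrite ler_pM2l // in h3; apply: le_trans h3 _.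
      by rewrite ler_wpM2r ?nrm_ge0.
    pose z := (N%:R : C)^-1 *: \sum_(j < N) h j.
    have gx : x = (N%:R : C)^-1 *: \sum_(j < N) g j.
      by rewrite roots_of_unity_average // scalerA mulVf // scale1r.
    have hz : z - (r%:C%C^-1) ^+ N *: iter N S z = y.
      have -> : y = (N%:R : C)^-1 *: (N%:R *: y) by rewrite scalerA mulVf // scale1r.
      rewrite -(roots_of_unity_average _ pw rC0) /z.
      rewrite (linopZ (linop_iter N S_lin)) scalerA mulrC -scalerA -scalerBr.
      congr (_ *: _); rewrite (linop_sum (linop_iter N S_lin)) scaler_sumr -sumrB.
      apply: eq_bigr => j _; rewrite -(powN _ j) -geometric_telescope.
      by apply: eq_bigr => l _; rewrite hE'.
    have xz : nrm (x - z) <= 6^-1 * nrm y.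
      rewrite {1}gx /z -scalerBr -sumrB nrmZ // rnormV.
      have -> : rnorm (N%:R : C) = N%:R.
        by rewrite -(rmorph_nat (real_complex R)) rnorm_realE ger0_norm.
      rewrite mulrC ler_pdivrMr ?ltr0n //; apply: le_trans (nrm_sum ip_semi _ _ _) _.
      apply: (@le_trans _ _ (\sum_(j < N) 6^-1 * nrm y)).
        by apply: ler_sum => j _; exact: ghbound.
      by rewrite sumr_const card_ord mulr_natr.
    have zy : nrm (z - y) <= 8^-1 * nrm z.
      by rewrite -hz opprB addrCA subrr addr0; exact: hN.
    have h1 : nrm z <= nrm y + nrm (z - y).
      by rewrite -{1}[z](subrK y) addrC nrmD.
    have h2 : nrm (x - y) <= nrm (x - z) + nrm (z - y).
      have -> : x - y = (x - z) + (z - y) by rewrite addrA subrK.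
      exact: nrmD.
    have y0 := nrm_ge0 ip y; lra.
  have h1 : nrm y <= nrm x + nrm (x - y).
    by rewrite (nrmBC ip_semi) -{1}[y](subrK x) addrC nrmD.
  have -> : (rho%:C%C^-1) ^+ N *: iter N S x = x - y by rewrite yE opprB addrCA subrr addr0.
  lra.
(* Bernoulli: (1 - 1/(2N))^N >= 1/2, so the gain of a factor 2 at the power N
   allows the radius rho (1 - 1/(2N)). *)
pose t := (2 * N%:R)^-1 : R.
have N1 : 1 <= N%:R :> R by rewrite ler1n.
have tN : t * N%:R = 2^-1 by rewrite /t; field; rewrite gt_eqF //; lra.
have t0 : 0 < t by rewrite invr_gt0; lra.
have t1 : t < 1 by rewrite invf_lt1; lra.
exists (rho * (1 - t)).
  by rewrite mulr_gt0 ?subr_gt0 //= gtr_pMr // gtrBl.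
apply: (@growth_of_power N) => //; first by rewrite mulr_gt0 ?subr_gt0.
move=> x; have := half x; rewrite nrmZ // rnormX rnormV rnorm_realE gtr0_norm //.
rewrite exprVn mulrC ler_pdivrMr ?exprn_gt0 // => hx.
have := @bernoulli_ineq R (- t) N ltac:(lra).
rewrite mulrN mulrC tN => hb; apply: le_trans hx _.
rewrite mulrAC ler_wpM2r ?nrm_ge0 // mulrC exprMn ler_wpM2l //.
  by rewrite exprn_ge0 // ltW.
by lra.
Qed.

(** The infimum of the admissible growth rates cannot exceed [2], by
    [growth_improve]. *)
Lemma growth_of_spectrum r : (forall z, 2 < rnorm z -> has_resolvent z) ->
  2 < r -> growth r.
Proof.
move=> res r2; apply: contrapT => nr.
pose G := [set s : R | 2 < s /\ growth s].
have Gmono s : 0 < s -> growth s -> r < s.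
  move=> s0 gs; rewrite ltNge; apply/negP => sr; apply: nr.
  exact: growth_le (ltW s0) sr gs.
have Gc : G (Num.max c 3).
  split; first by rewrite lt_max; apply/orP; right; lra.
  have gc : growth c by exists 1 => // n x; rewrite mul1r; exact: iter_bound.
  by apply: growth_le gc; [exact: ltW|rewrite le_max lexx].
have Glb : lbound G r by move=> s [s2 gs]; apply/ltW/Gmono => //; lra.
have Ginf : has_inf G by split; [exists (Num.max c 3)|exists r].
have rinf : r <= inf G by apply: lb_le_inf => //; exists (Num.max c 3).
have [|||s /andP[s0 sG] gs] := @growth_improve (inf G).
- by lra.
- exact: res.
- move=> s sG; have e0 : 0 < s - inf G by lra.
  have [s' [s'2 gs'] s's] := inf_adherent e0 Ginf.
  apply: growth_le gs'; [lra|by apply: ltW; lra].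
have sr := Gmono s s0 gs.
have : inf G <= s by apply: ge_inf; [exists r|split => //; lra].
lra.
Qed.

End spectral_growth.

(** * Hilbert spaces: limits and Riesz representation *)

Section hilbert_spaces.
Variable R : realType.
Local Notation C := R[i].
Variable H : hilbertType R.
Implicit Types x y z : H.

Definition hip x y : R := complex.Re (inner x y).

Lemma innerDl x y z : inner (x + y) z = inner x z + inner y z.
Proof. exact: linearDl. Qed.

Lemma innerZl (a : C) x y : inner (a *: x) y = a * inner x y.
Proof. exact: linearZl_LR. Qed.

Lemma innerC x y : inner x y = ((inner y x)^*)%C.
Proof. by rewrite hermC expr0 mul1r. Qed.

Lemma innerZr (a : C) x y : inner x (a *: y) = (a^*)%C * inner x y.
Proof. by rewrite innerC innerZl rmorphM /= -innerC. Qed.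

Lemma Re_real_mul (r : R) (z : C) : complex.Re (r%:C%C * z) = r * complex.Re z.
Proof. by case: z => a b /=; rewrite mul0r subr0. Qed.

Lemma hip_semi : semi_inner hip.
Proof.
split; rewrite /hip.
- by move=> x y z; rewrite innerDl raddfD.
- by move=> r x y; rewrite innerZl Re_real_mul.
- by move=> x y; rewrite innerC; case: (inner y x).
- by move=> a x y; rewrite innerZl innerZr conjcK.
- by move=> x; rewrite inner_normE rnormE -rmorphXn /= sqr_ge0.
Qed.

Lemma hip_norm x : inorm hip x = rnorm x.
Proof.
by rewrite /inorm /hip inner_normE rnormE -rmorphXn /= sqrtr_sqr ger0_norm ?rnorm_ge0.
Qed.

Lemma rnormZ (a : C) x : rnorm (a *: x) = rnorm a * rnorm x.
Proof. by rewrite -!hip_norm (nrmZ hip_semi). Qed.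

Lemma hip_sqr x : hip x x = rnorm x ^+ 2.
Proof. by rewrite -hip_norm nrmK //; exact: hip_semi. Qed.

Lemma hip_eq0 x : hip x x = 0 -> x = 0.
Proof. by rewrite hip_sqr => /eqP; rewrite sqrf_eq0 => /eqP /rnorm_eq0. Qed.

Lemma Im_inner x y : complex.Im (inner x y) = hip ((- 'i%C) *: x) y.
Proof. by rewrite /hip innerZl; case: (inner x y) => a b /=; rewrite !oppr0; ring. Qed.

Lemma inner_hip_eq x y x' y' :
  (forall a : C, hip (a *: x) y = hip (a *: x') y') -> inner x y = inner x' y'.
Proof.
move=> h; have := h 1; have := h (- 'i%C); rewrite -!Im_inner !scale1r /hip.
by case: (inner x y) (inner x' y') => a b [a' b'] /= -> ->.
Qed.

Lemma hip_inner (u : C) x y : hip (u *: x) y = complex.Re (u * inner x y).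
Proof. by rewrite /hip innerZl. Qed.

Lemma rnorm_inner_le x y (c : R) :
  (forall u : C, rnorm u = 1 -> hip (u *: x) y <= c) -> rnorm (inner x y) <= c.
Proof.
move=> h; have [u u1 uz] := rotate_to_modulus (inner x y).
by have := h u u1; rewrite hip_inner uz.
Qed.

Lemma hip_le_rnorm_inner (u : C) x y : rnorm u = 1 ->
  hip (u *: x) y <= rnorm (inner x y).
Proof.
by move=> u1; rewrite hip_inner (le_trans (Re_le_rnorm _)) // rnormM u1 mul1r.
Qed.

Lemma rnorm_ballE (x y : H) (e : R) : ball x e%:C%C y <-> rnorm (x - y) < e.
Proof. by rewrite -ball_normE /ball_ /= rnormE ltcR. Qed.

Lemma closure_rnormP (A : set H) x :
  closure A x <-> forall e : R, 0 < e -> exists2 a, A a & rnorm (x - a) <= e.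
Proof.
split=> [clA e e0|h B /nbhs_ballP[e /= e0 eB]].
  have [|a [Aa xa]] := clA (ball x e%:C%C).
    by apply: nbhsx_ballx; rewrite ltcR.
  by exists a => //; apply: ltW; apply/rnorm_ballE.
have [/eqP ime ree] : complex.Im e == 0 /\ 0 < complex.Re e.
  by move: e0; rewrite ltcE => /andP[].
have eE : e = (complex.Re e)%:C%C by case: e ime {e0 eB ree} => a b /= ->.
have [a Aa xa] := h (complex.Re e / 2) ltac:(lra).
exists a; split=> //; apply: eB; rewrite eE; apply/rnorm_ballE.
by apply: le_lt_trans xa _; lra.
Qed.

Lemma hilbert_complete (u : nat -> H) :
  (forall e : R, 0 < e -> exists N, forall m n, (N <= m)%N -> (N <= n)%N ->
     rnorm (u m - u n) <= e) ->
  exists l, forall e : R, 0 < e -> exists N, forall n, (N <= n)%N ->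
     rnorm (u n - l) <= e.
Proof.
move=> cu.
have : cauchy (u @ \oo).
  apply/cauchy_ballP => e e0.
  have [/eqP ime ree] : complex.Im e == 0 /\ 0 < complex.Re e.
    by move: e0; rewrite ltcE => /andP[].
  have eE : e = (complex.Re e)%:C%C by case: e ime {e0 ree} => a b /= ->.
  have [N hN] := cu (complex.Re e / 2) ltac:(lra).
  exists (u @` [set n | (N <= n)%N], u @` [set n | (N <= n)%N]).
    by split; exists N => //= n Nn; exists n.
  move=> [_ _] [[m /= Nm <-] [n /= Nn <-]] /=; rewrite eE; apply/rnorm_ballE.
  by apply: le_lt_trans (hN m n Nm Nn) _; lra.
move=> /cauchy_cvg/cvg_ex[l ul]; exists l => e e0.
have e0' : 0 < e%:C%C :> C by rewrite ltcR.
have [N _ hN] := cvg_ball ul e0'.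
exists N => n Nn; have := hN n Nn; rewrite /= => /rnorm_ballE.
by rewrite -[l - _]opprB /rnorm normrN => /ltW.
Qed.

(** The form in which iterations are shown to converge: the estimate of the error
    is kept as a multiple of the gap of the scalar sequence [y] to its limit, which
    [gap_vanish] exploits to identify limits. *)
Lemma dominated_limit (u : nat -> H) (y : nat -> R) (b K : R) :
  0 <= K -> (forall n, y n <= y n.+1) -> (forall n, y n <= b) ->
  (forall n, rnorm (u n.+1 - u n) <= (y n.+1 - y n) * K) ->
  exists l, forall n, rnorm (l - u n) <= (sup (range y) - y n) * K.
Proof.
move=> K0 ymono yb hu.
have yM m n : (n <= m)%N -> y n <= y m.
  elim: m => [|m IH]; first by rewrite leqn0 => /eqP ->.
  by rewrite leq_eqVlt => /orP[/eqP ->//|/IH]; move/le_trans; apply.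
have uM m n : (n <= m)%N -> rnorm (u m - u n) <= (y m - y n) * K.
  elim: m => [|m IH]; first by rewrite leqn0 => /eqP ->; rewrite !subrr mul0r rnorm0.
  rewrite leq_eqVlt => /orP[/eqP ->|/IH h]; first by rewrite !subrr mul0r rnorm0.
  have -> : u m.+1 - u n = (u m.+1 - u m) + (u m - u n) by rewrite addrA subrK.
  have := nrmD hip_semi (u m.+1 - u m) (u m - u n); rewrite !hip_norm.
  by have := hu m; lra.
have hs : has_sup (range y) by split; [exists (y 0%N), 0%N|exists b => _ [n _ <-]].
have ys n : y n <= sup (range y) by apply: sup_upper_bound => //; exists n.
have [|l hl] := @hilbert_complete u.
  move=> e e0; have e1 : 0 < e / (K + 1) by rewrite divr_gt0 //; lra.
  have [_ [N _ <-] hN] := sup_adherent e1 hs.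
  have bnd m n : (N <= n)%N -> (n <= m)%N -> rnorm (u m - u n) <= e.
    move=> Nn nm; apply: le_trans (uM _ _ nm) _.
    apply: (@le_trans _ _ (e / (K + 1) * (K + 1))); last by rewrite divfK ?gt_eqF //; lra.
    have h := ys m; have h' := yM _ _ Nn.
    by apply: ler_pM; rewrite ?subr_ge0 ?yM //; lra.
  exists N => m n Nm Nn; have [mn|nm] := leqP m n.
    by rewrite -opprB /rnorm normrN; apply: bnd.
  by apply: bnd => //; exact: ltnW.
exists l => n; apply/ler_addgt0Pr => e e0.
have [N hN] := hl e e0.
pose m := maxn N n.
have h1 := hN m (leq_maxl _ _); have h2 := uM m n (leq_maxr _ _).
have -> : l - u n = (l - u m) + (u m - u n) by rewrite addrA subrK.
have := nrmD hip_semi (l - u m) (u m - u n); rewrite !hip_norm.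
rewrite -[l - u m]opprB /rnorm normrN -!/(rnorm _) => h3.
have h4 : (y m - y n) * K <= (sup (range y) - y n) * K.
  by rewrite ler_wpM2r // lerD2r ys.
by move: h1 h2 h3 h4; rewrite /rnorm => h1 h2 h3 h4; lra.
Qed.

Lemma sup_range_small (y : nat -> R) b (e : R) : (forall n, y n <= b) -> 0 < e ->
  exists n, sup (range y) - y n <= e.
Proof.
move=> yb e0.
have hs : has_sup (range y) by split; [exists (y 0%N), 0%N|exists b => _ [n _ <-]].
have [_ [n _ <-] hn] := sup_adherent e0 hs.
by exists n; lra.
Qed.

Lemma gap_vanish (y : nat -> R) b K (v : H) : (forall n, y n <= b) ->
  (forall n, rnorm v <= (sup (range y) - y n) * K) -> v = 0.
Proof.
move=> yb hv; apply: rnorm_eq0; apply/eqP; rewrite eq_le rnorm_ge0 andbT.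
apply/ler_addgt0Pr => e e0; rewrite add0r.
have [n hn] := sup_range_small (e := e / (`|K| + 1)) yb ltac:(by rewrite divr_gt0 // ltr_wpDl).
have y0 : 0 <= sup (range y) - y n.
  rewrite subr_ge0; apply: sup_upper_bound; last by exists n.
  by split; [exists (y 0%N), 0%N|exists b => _ [k _ <-]].
apply: le_trans (hv n) _.
apply: (@le_trans _ _ ((sup (range y) - y n) * `|K|)); first by rewrite ler_wpM2l // ler_norm.
apply: le_trans (ler_wpM2r (normr_ge0 K) hn) _.
rewrite mulrAC ler_pdivrMr ?ltr_wpDl //.
by have := mulr_ge0 (normr_ge0 K) (ltW e0); lra.
Qed.

Lemma hip_uniq x y : (forall z, hip z x = hip z y) -> x = y.
Proof.
move=> h; apply/eqP; rewrite -subr_eq0; apply/eqP/hip_eq0.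
by rewrite (ipBr hip_semi) h subrr.
Qed.

Section factorization.
Variable D : H -> H.
Hypothesis D_lin : linop D.

(** Membership in the closure of the range of [D], that is, in the defect space when
    [D] is a defect operator. *)
Definition near_range v := forall e : R, 0 < e -> exists h, rnorm (v - D h) <= e.

Lemma near_range_lin (a : C) v w : near_range v -> near_range w -> near_range (a *: v + w).
Proof.
move=> hv hw e e0.
have a0 := rnorm_ge0 a.
have [h hh] := hv (e / (2 * (rnorm a + 1))) ltac:(by rewrite divr_gt0 //; lra).
have [k hk] := hw (e / 2) ltac:(lra).
exists (a *: h + k); rewrite D_lin opprD addrACA -scalerBr.
have := nrmD hip_semi (a *: (v - D h)) (w - D k); rewrite (nrmZ hip_semi) !hip_norm.
have h1 : rnorm a * rnorm (v - D h) <= e / 2.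
  apply: le_trans (ler_wpM2l a0 hh) _.
  rewrite mulrA ler_pdivrMr; last by lra.
  by have := mulr_ge0 a0 (ltW e0); lra.
lra.
Qed.

Lemma near_range_orth v w : near_range v -> (forall x, hip (D x) w = 0) -> hip v w = 0.
Proof.
move=> hv Dw; apply/eqP; rewrite -normr_le0; apply/ler_addgt0Pr => e e0; rewrite add0r.
have w0 := rnorm_ge0 w.
have [h hh] := hv (e / (rnorm w + 1)) ltac:(by rewrite divr_gt0 //; lra).
have -> : hip v w = hip (v - D h) w by rewrite (ipBl hip_semi) Dw subr0.
apply: le_trans (ip_abs_le hip_semi _ _) _; rewrite !hip_norm.
apply: le_trans (ler_wpM2r w0 hh) _.
by rewrite mulrAC ler_pdivrMr; [have := mulr_ge0 w0 (ltW e0); lra|lra].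
Qed.

Lemma near_range_uniq v : near_range v -> (forall x, hip (D x) v = 0) -> v = 0.
Proof. by move=> hv Dv; apply: hip_eq0; exact: near_range_orth. Qed.

(** Riesz representation on the closed range of [D]: the representing vector is the
    limit of [D h_n] for a sequence [h_n] that minimises [|D h|^2 / 2 - phi h], a
    Cauchy sequence by the parallelogram identity. The functional is given on the
    domain of [D], so nothing has to be extended to the closure first. *)
Lemma riesz_on_range (phi : H -> R) (M : R) :
  (forall x y, phi (x + y) = phi x + phi y) ->
  (forall (r : R) x, phi (r%:C%C *: x) = r * phi x) ->
  (forall x, phi x <= M * rnorm (D x)) ->
  exists2 v, near_range v & forall x, hip (D x) v = phi x.
Proof.
move=> phiD phiZ phiM.
pose J x := hip (D x) (D x) / 2 - phi x.
have Jlb x : - (M ^+ 2 / 2) <= J x.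
  rewrite /J hip_sqr; have := phiM x; have := sqr_ge0 (rnorm (D x) - M).
  rewrite sqrrB; lra.
pose m := inf (range J).
have Jinf : has_inf (range J) by split; [exists (J 0), 0|exists (- (M ^+ 2 / 2)) => _ [x _ <-]].
have mJ x : m <= J x by apply: ge_inf; [case: Jinf|exists x].
have paral x y : hip (D x - D y) (D x - D y) / 4 <= J x + J y - 2 * m.
  have := mJ ((2^-1)%:C%C *: (x + y)).
  rewrite {1}/J (linopZ D_lin) (ipZl hip_semi) (ipZr hip_semi) phiZ phiD (linopD D_lin).
  have := parallelogram hip_semi (D x) (D y).
  rewrite /J; lra.
have min n : exists x, J x <= m + (n.+1%:R)^-1.
  have n0 : 0 < (n.+1%:R)^-1 :> R by rewrite invr_gt0 ltr0n.
  have [_ [x _ <-] hx] := inf_adherent n0 Jinf.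
  by exists x; exact: ltW.
have [h hh] := choice min.
have small (e : R) : 0 < e -> exists N, forall n, (N <= n)%N -> (n.+1%:R)^-1 <= e.
  move=> e0; exists (Num.truncn e^-1) => n Nn.
  rewrite -[leRHS]invrK lef_pV2 ?posrE ?invr_gt0 ?ltr0n //.
  apply: ltW; apply: lt_le_trans (truncnS_gt _) _; by rewrite ler_nat.
have [|v hv] := @hilbert_complete (fun n => D (h n)).
  move=> e e0 /=; have [N hN] := small (e ^+ 2 / 8) ltac:(by rewrite divr_gt0 ?exprn_gt0).
  exists N => a b Na Nb.
  rewrite -(ler_pXn2r (n := 2)) ?nnegrE ?rnorm_ge0 ?(ltW e0) // -hip_sqr.
  have := paral (h a) (h b); have := hh a; have := hh b.
  have := hN _ Na; have := hN _ Nb.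
  move: (b.+1%:R^-1) (a.+1%:R^-1) => p q; lra.
exists v => [e e0|x].
  have [N hN] := hv e e0; exists (h N).
  by have := hN N (leqnn _); rewrite -opprB /rnorm normrN.
(* The first variation at the minimum, passed to the limit. *)
have main t : 0 <= t * (hip (D x) v - phi x) + t ^+ 2 / 2 * hip (D x) (D x).
  apply/ler_addgt0Pr => e e0.
  pose k := `|t| * rnorm (D x) + 1.
  have k0 : 0 < k by rewrite ltr_wpDl // mulr_ge0 ?rnorm_ge0.
  have [N1 hN1] := hv (e / (2 * k)) ltac:(by rewrite divr_gt0 // mulr_gt0).
  have [N2 hN2] := small (e / 2) ltac:(lra).
  pose n := maxn N1 N2.
  have h1 := hN1 n (leq_maxl _ _); have h2 := hN2 n (leq_maxr _ _).
  have : J (h n) <= m + e / 2 by apply: le_trans (hh n) _; rewrite lerD2l.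
  have := mJ (h n + t%:C%C *: x).
  rewrite /J (linopD D_lin) (linopZ D_lin) phiD phiZ.
  rewrite !(ipDl hip_semi, ipDr hip_semi) !(ipZl hip_semi) !(ipZr hip_semi).
  rewrite (ipC hip_semi (D (h n)) (D x)).
  have h3 : t * hip (D x) (D (h n) - v) <= e / 2.
    apply: le_trans (ler_norm _) _; rewrite normrM.
    have := ip_abs_le hip_semi (D x) (D (h n) - v); rewrite !hip_norm => h3.
    apply: le_trans (ler_wpM2l (normr_ge0 t) h3) _.
    apply: (@le_trans _ _ (k * (e / (2 * k)))); last first.
      by rewrite le_eqVlt; apply/orP; left; apply/eqP; field; rewrite gt_eqF.
    by rewrite mulrA ler_pM ?mulr_ge0 ?rnorm_ge0 // /k lerDl.
  by rewrite (ipBr hip_semi) in h3; lra.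
set q := hip (D x) (D x) in main; set d := hip (D x) v - phi x in main.
have q0 : 0 <= q by exact: (ip_ge0 hip_semi).
have := main (- d / (q + 1)).
have -> : - d / (q + 1) * d + (- d / (q + 1)) ^+ 2 / 2 * q
    = - (d ^+ 2 * ((q + 2) / (2 * (q + 1) ^+ 2))).
  by field; rewrite gt_eqF //; lra.
rewrite oppr_ge0 pmulr_lle0; last by rewrite divr_gt0 ?mulr_gt0 ?exprn_gt0 //; lra.
move=> d0; have : d == 0 by rewrite -sqrf_eq0 eq_le d0 sqr_ge0.
by rewrite subr_eq0 => /eqP.
Qed.

Lemma near_range_bound v (M : R) : near_range v -> 0 <= M ->
  (forall x, hip (D x) v <= M * rnorm (D x)) -> rnorm v <= M.
Proof.
move=> hv M0 hM.
have v0 := rnorm_ge0 v.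
have key : rnorm v ^+ 2 <= M * rnorm v.
  apply/ler_addgt0Pr => e e0.
  pose k := rnorm v + `|M|; have k0 : 0 <= k by rewrite addr_ge0.
  have [h hh] := hv (e / (k + 1)) ltac:(by rewrite divr_gt0 //; lra).
  have h1 : rnorm v ^+ 2 = hip (v - D h) v + hip (D h) v.
    by rewrite (ipBl hip_semi) subrK hip_sqr.
  have h2 := ip_cauchy_schwarz hip_semi (v - D h) v.
  have h3 : `|rnorm (D h) - rnorm v| <= rnorm (v - D h).
    have := nrmD hip_semi (v - D h) (D h); have := nrmB hip_semi v (v - D h).
    rewrite opprB addrCA subrr addr0 subrK !hip_norm ler_norml; lra.
  have h4 : M * rnorm (D h) <= M * rnorm v + `|M| * rnorm (v - D h).
    rewrite -lerBlDl -mulrBr (le_trans (ler_norm _)) // normrM ler_wpM2l //.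
  have h5 : k * rnorm (v - D h) <= e.
    apply: le_trans (ler_wpM2l k0 hh) _.
    by rewrite mulrA ler_pdivrMr; [lra|lra].
  rewrite !hip_norm in h2; have := hM h; rewrite /k in h5; lra.
have [v00|v1] := eqVneq (rnorm v) 0; first by rewrite v00.
by rewrite -(ler_pM2r (x := rnorm v)) -?expr2 // lt_neqAle eq_sym v1.
Qed.

End factorization.
End hilbert_spaces.

(** * Adjoints and square roots *)

Section hilbert_operators.
Variable R : realType.
Local Notation C := R[i].
Variable H : hilbertType R.
Implicit Types x y z : H.
Local Notation hip := (@hip R H).
Let hs : semi_inner hip := @hip_semi R H.

(** Douglas' factorisation [G = W^* D], valid when [<G x, y>] is bounded by a multiple
    of [|D x|] for each [y]. Adjoints are the case [D = 1], the orthogonal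
    projection onto the closed range of [D] is the case [G = D]. *)
Lemma factor_through (D G : H -> H) : linop D -> linop G ->
  (forall y, exists M, forall x, hip (G x) y <= M * rnorm (D x)) ->
  exists W : H -> H, [/\ linop W, forall y, near_range D (W y)
    & forall x y, hip (D x) (W y) = hip (G x) y].
Proof.
move=> Dl Gl GM.
have rep y : exists v, near_range D v /\ forall x, hip (D x) v = hip (G x) y.
  have [M hM] := GM y.
  have [|||v nv hv] := @riesz_on_range R H D Dl (fun x => hip (G x) y) M.
  - by move=> x x' /=; rewrite (linopD Gl) (ipDl hs).
  - by move=> r x /=; rewrite (linopZ Gl) (ipZl hs).
  - exact: hM.
  - by exists v.
have [W hW] := choice rep.
exists W; split => [a y y'|y|x y]; [|by case: (hW y)|by case: (hW y)].
apply/eqP; rewrite -subr_eq0; apply/eqP.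
have nW y1 : near_range D (W y1) by case: (hW y1).
have eW y1 x : hip (D x) (W y1) = hip (G x) y1 by case: (hW y1).
apply: (@near_range_uniq R H D) => [|x].
  rewrite -scaleN1r addrC; apply: near_range_lin => //.
  exact: near_range_lin.
have aJ (v w : H) : hip v (a *: w) = hip ((a^*)%C *: v) w by rewrite (ipJ hs) conjcK.
rewrite (ipBr hs) (ipDr hs) !eW aJ -(linopZ Dl) eW (linopZ Gl).
by rewrite (ipDr hs) aJ subrr.
Qed.

Lemma hip_bound_le (T : H -> H) M x y : (forall x, rnorm (T x) <= M * rnorm x) ->
  hip (T x) y <= M * rnorm x * rnorm y.
Proof.
move=> TM; have := ip_cauchy_schwarz hs (T x) y; rewrite !hip_norm => h.
by apply: le_trans h _; rewrite ler_wpM2r ?rnorm_ge0.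
Qed.

Lemma adjoint_exists (T : H -> H) M : linop T -> 0 <= M ->
  (forall x, rnorm (T x) <= M * rnorm x) ->
  exists U : H -> H, [/\ linop U, forall x, rnorm (U x) <= M * rnorm x
    & forall x y, hip (T x) y = hip x (U y)].
Proof.
move=> Tl M0 TM.
have [||y|U [Ul _ hU]] := @factor_through id T => //.
  by exists (M * rnorm y) => x; rewrite mulrAC hip_bound_le.
exists U; split => // x.
have h : rnorm (U x) ^+ 2 <= M * rnorm (U x) * rnorm x.
  by rewrite -hip_sqr hU hip_bound_le.
have [->|u0] := eqVneq (rnorm (U x)) 0; first by rewrite mulr_ge0 ?rnorm_ge0.
have up : 0 < rnorm (U x) by rewrite lt_neqAle eq_sym u0 rnorm_ge0.
by rewrite -(ler_pM2l up) -expr2 mulrCA mulrA.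
Qed.

Lemma bounded_operatorP (T : H -> H) : bounded_operator T <->
  linop T /\ exists M, [/\ 0 <= M & forall x, rnorm (T x) <= M * rnorm x].
Proof.
split=> [[_ Tl [M hM]]|[Tl [M [M0 hM]]]]; last first.
  by split=> [x _ //|a x y _ _|]; [exact: Tl|exists M => x _].
split; first by move=> a x y; exact: Tl.
exists `|M|; split=> // x; apply: le_trans (hM x I) _.
by rewrite ler_wpM2r ?rnorm_ge0 // ler_norm.
Qed.

Lemma adjointP (T : H -> H) : bounded_operator T ->
  bounded_operator (adjoint T) /\ forall x y, hip (T x) y = hip x (adjoint T y).
Proof.
move=> Tb; have [Tl [M [M0 hM]]] := (bounded_operatorP T).1 Tb.
have [U [Ul UM hU]] := adjoint_exists Tl M0 hM.
have ex : exists U : H -> H, bounded_operator U /\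
    forall x y, inner (T x) y = inner x (U y).
  exists U; split; first by apply/bounded_operatorP; split => //; exists M.
  by move=> x y; apply: inner_hip_eq => a; rewrite -(linopZ Tl) hU.
have [ab ae] := @xgetPex _ (fun=> 0) [set U : H -> H | bounded_operator U /\
  forall x y, inner (T x) y = inner x (U y)] ex.
by split=> // x y; rewrite /hip ae.
Qed.

(** The square root of [1 - Z] is [1 - Y], where [Y = (Z + Y ^+ 2) / 2] is the limit
    of [root_iter]. The iterates are polynomials in [Z] with nonnegative
    coefficients, and so are their increments; hence the norms are dominated by the
    scalar iteration at [Z = 1], which increases to [1]. *)
Section square_root.
Variable Z : H -> H.
Hypotheses (Z_lin : linop Z) (Z_le1 : forall x, rnorm (Z x) <= rnorm x).
Hypothesis Z_sym : forall x y, hip (Z x) y = hip x (Z y).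

Local Notation half := ((2^-1 : R)%:C%C).

Fixpoint root_iter n : H -> H :=
  if n is m.+1 then fun x => half *: (Z x + root_iter m (root_iter m x)) else fun=> 0.

Fixpoint scalar_iter n : R :=
  if n is m.+1 then (1 + scalar_iter m ^+ 2) / 2 else 0.

Let rn_half x : rnorm (half *: x) = rnorm x / 2.
Proof.
rewrite rnormZ rnorm_realE ger0_norm ?invr_ge0 // mulrC //.
Qed.

Lemma scalar_iter_bounds n : 0 <= scalar_iter n <= 1.
Proof.
elim: n => [|n /andP[h0 h1]] /=; first by lra.
have := sqr_ge0 (scalar_iter n); have : scalar_iter n ^+ 2 <= 1 by rewrite exprn_ile1.
lra.
Qed.

Lemma scalar_iter_mono n : scalar_iter n <= scalar_iter n.+1.
Proof. by have := sqr_ge0 (1 - scalar_iter n); rewrite sqrrB /=; lra. Qed.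

Lemma root_iter_lin n : linop (root_iter n).
Proof.
elim: n => [|n IH] a x y /=; first by rewrite scaler0 addr0.
rewrite Z_lin !IH addrACA -[a *: Z x + _]scalerDr [LHS]scalerDr.
by congr (_ + _); rewrite !scalerA [_ * a]mulrC.
Qed.

Lemma root_iter_le n x : rnorm (root_iter n x) <= scalar_iter n * rnorm x.
Proof.
elim: n x => [|n IH] x /=; first by rewrite rnorm0 mul0r.
have /andP[s0 _] := scalar_iter_bounds n.
rewrite rn_half.
have h1 := rnormD (Z x) (root_iter n (root_iter n x)).
have h2 := le_trans (IH (root_iter n x)) (ler_wpM2l s0 (IH x)).
have h3 := Z_le1 x; lra.
Qed.

Lemma root_iter_comm n G : linop G -> (forall x, G (Z x) = Z (G x)) ->
  forall x, G (root_iter n x) = root_iter n (G x).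
Proof.
move=> Gl GZ; elim: n => [|n IH] x /=; first exact: linop0.
by rewrite (linopZ Gl) (linopD Gl) GZ !IH.
Qed.

Lemma root_iter_comm2 m n x :
  root_iter m (root_iter n x) = root_iter n (root_iter m x).
Proof.
apply: root_iter_comm; first exact: root_iter_lin.
by move=> y; rewrite -(root_iter_comm m Z_lin).
Qed.

Lemma root_iter_step n x :
  rnorm (root_iter n.+1 x - root_iter n x)
    <= (scalar_iter n.+1 - scalar_iter n) * rnorm x.
Proof.
elim: n x => [|n IH] x.
  rewrite /= subr0 addr0 rn_half expr0n /= addr0 subr0; have := Z_le1 x; lra.
set A := root_iter n.+1 in IH *; set B := root_iter n in IH *.
have Al : linop A by exact: root_iter_lin.
have Bl : linop B by exact: root_iter_lin.
have AB y : A (B y) = B (A y) by exact: root_iter_comm2.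
have -> : root_iter n.+2 x - A x = half *: (A (A x - B x) + B (A x - B x)).
  rewrite -[root_iter n.+2 x]/(half *: (Z x + A (A x))).
  rewrite -[X in _ - X]/(half *: (Z x + B (B x))) -scalerBr; congr (_ *: _).
  rewrite (linopB Al) (linopB Bl) AB opprD addrACA subrr add0r.
  by rewrite addrA subrK.
rewrite rn_half.
have /andP[a0 _] := scalar_iter_bounds n.+1; have /andP[b0 _] := scalar_iter_bounds n.
have h1 := rnormD (A (A x - B x)) (B (A x - B x)).
have h2 := le_trans (root_iter_le n.+1 (A x - B x)) (ler_wpM2l a0 (IH x)).
have h3 := le_trans (root_iter_le n (A x - B x)) (ler_wpM2l b0 (IH x)).
set a := scalar_iter n.+1 in a0 h2 h3 *; set b := scalar_iter n in b0 h2 h3 *.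
have -> : scalar_iter n.+2 = (1 + a ^+ 2) / 2 by [].
have ea : a = (1 + b ^+ 2) / 2 by [].
rewrite -/A in h2; rewrite -/B in h3.
have -> : ((1 + a ^+ 2) / 2 - a) * rnorm x
    = (a * ((a - b) * rnorm x) + b * ((a - b) * rnorm x)) / 2.
  by rewrite {2}ea; field.
by lra.
Qed.

Lemma square_root_exists : exists2 B : H -> H, positive_operator B &
  forall x, B (B x) = x - Z x.
Proof.
have sb n : scalar_iter n <= 1 by case/andP: (scalar_iter_bounds n).
have lim x : exists l, forall n,
    rnorm (l - root_iter n x) <= (sup (range scalar_iter) - scalar_iter n) * rnorm x.
  apply: (dominated_limit (b := 1)) => //; [exact: rnorm_ge0|exact: scalar_iter_mono|].
  by move=> n; exact: root_iter_step.
have [Y hY] := choice lim.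
pose d n := sup (range scalar_iter) - scalar_iter n.
have d0 n : 0 <= d n.
  rewrite subr_ge0; apply: sup_upper_bound; last by exists n.
  by split; [exists (scalar_iter 0), 0%N|exists 1 => _ [k _ <-]].
have vanish (v : H) K : (forall n, rnorm v <= d n * K) -> v = 0.
  exact: gap_vanish sb.
have Yl : linop Y.
  move=> a x y; apply/eqP; rewrite -subr_eq0; apply/eqP.
  apply: (vanish _ (rnorm (a *: x + y) + (rnorm a * rnorm x + rnorm y))) => n.
  have -> : Y (a *: x + y) - (a *: Y x + Y y) =
     (Y (a *: x + y) - root_iter n (a *: x + y))
       - (a *: (Y x - root_iter n x) + (Y y - root_iter n y)).
    rewrite (root_iter_lin n) scalerBr addrACA -opprD opprB.
    by rewrite addrA subrK.
  have h1 := hY (a *: x + y) n; have h2 := hY x n; have h3 := hY y n.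
  have h4 := rnormD (Y (a *: x + y) - root_iter n (a *: x + y))
    (- (a *: (Y x - root_iter n x) + (Y y - root_iter n y))).
  have h5 := rnormD (a *: (Y x - root_iter n x)) (Y y - root_iter n y).
  rewrite rnormZ in h5; rewrite rnormN in h4.
  have h6 := ler_wpM2l (rnorm_ge0 a) h2.
  rewrite -!/(d n) in h1 h2 h3 h6 *; lra.
have Yle x : rnorm (Y x) <= rnorm x.
  apply/ler_addgt0Pr => e e0.
  have [n hn] := sup_range_small sb (e := e / (rnorm x + 1))
    ltac:(by rewrite divr_gt0 // ltr_wpDl // rnorm_ge0).
  have x0 := rnorm_ge0 x.
  have h1 : rnorm (Y x - root_iter n x) <= e.
    apply: le_trans (hY x n) _; apply: le_trans (ler_wpM2r x0 hn) _.
    rewrite mulrAC ler_pdivrMr; last by lra.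
    by have := mulr_ge0 x0 (ltW e0); lra.
  have h2 := rnormD (Y x - root_iter n x) (root_iter n x); rewrite subrK in h2.
  have h3 := root_iter_le n x; have h4 := ler_wpM2r x0 (sb n); lra.
have rsym n x y : hip (root_iter n x) y = hip x (root_iter n y).
  elim: n x y => [|n IH] x y /=; first by rewrite (ip0l hs) (ip0r hs).
  by rewrite (ipZl hs) (ipZr hs) (ipDl hs) (ipDr hs) Z_sym !IH.
have Ysym x y : hip (Y x) y = hip x (Y y).
  apply/eqP; rewrite -subr_eq0 -normr_le0; apply/ler_addgt0Pr => e e0; rewrite add0r.
  have x0 := rnorm_ge0 x; have y0 := rnorm_ge0 y.
  have K0 := mulr_ge0 x0 y0.
  have [n hn] := sup_range_small sb (e := e / (2 * (rnorm x * rnorm y) + 1))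
    ltac:(by rewrite divr_gt0 //; lra).
  have -> : hip (Y x) y - hip x (Y y)
      = hip (Y x - root_iter n x) y - hip x (Y y - root_iter n y).
    by rewrite (ipBl hs) (ipBr hs) rsym; ring.
  have h1 := ip_abs_le hs (Y x - root_iter n x) y.
  have h2 := ip_abs_le hs x (Y y - root_iter n y).
  rewrite !hip_norm in h1 h2.
  have h3 := ler_normB (hip (Y x - root_iter n x) y) (hip x (Y y - root_iter n y)).
  have h4 := ler_wpM2r y0 (hY x n); have h5 := ler_wpM2l x0 (hY y n).
  have h6 : d n * (2 * (rnorm x * rnorm y)) <= e.
    have h7 : 0 <= 2 * (rnorm x * rnorm y) by lra.
    apply: le_trans (ler_wpM2r h7 hn) _; rewrite mulrAC ler_pdivrMr; last by lra.
    by have := mulr_ge0 (ltW e0) h7; lra.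
  by rewrite -!/(d n) in h4 h5 h6; lra.
have YY x : Y x + Y x = Z x + Y (Y x).
  apply/eqP; rewrite -subr_eq0; apply/eqP.
  apply: (vanish _ (4 * rnorm x)) => n.
  have e1 : root_iter n.+1 x + root_iter n.+1 x = Z x + root_iter n (root_iter n x).
    by rewrite /= -scalerDl -rmorphD /= -[2^-1]mul1r -splitr scale1r.
  have -> : Y x + Y x - (Z x + Y (Y x)) =
     (Y x - root_iter n.+1 x) + (Y x - root_iter n.+1 x)
       - ((Y (Y x) - root_iter n (Y x)) + root_iter n (Y x - root_iter n x)).
    have -> : Y (Y x) - root_iter n (Y x) + root_iter n (Y x - root_iter n x)
        = Y (Y x) - root_iter n (root_iter n x).
      by rewrite (linopB (root_iter_lin n)) addrA subrK.
    rewrite [_ - _ + (_ - _)]addrACA -opprD e1 -!addrA; congr (_ + (_ + _)).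
    rewrite -opprD; congr (- _).
    by rewrite -addrA [root_iter n (root_iter n x) + _]addrC subrK.
  set v1 := Y x - root_iter n.+1 x; set v2 := Y (Y x) - root_iter n (Y x).
  set v3 := root_iter n (Y x - root_iter n x).
  have h1 : rnorm v1 <= d n * rnorm x.
    apply: le_trans (hY x n.+1) _; rewrite ler_wpM2r ?rnorm_ge0 //.
    by rewrite lerD2l lerN2 scalar_iter_mono.
  have h2 : rnorm v2 <= d n * rnorm x.
    by apply: le_trans (hY (Y x) n) _; apply: ler_wpM2l (Yle x); exact: d0.
  have h3 : rnorm v3 <= d n * rnorm x.
    apply: le_trans (root_iter_le n _) _; apply: le_trans (hY x n).
    by rewrite ler_piMl ?rnorm_ge0 ?sb.
  have h4 := rnormD (v1 + v1) (- (v2 + v3)); have h5 := rnormD v1 v1; have h6 := rnormD v2 v3.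
  rewrite rnormN in h4; lra.
exists (fun x => x - Y x) => [|x]; last first.
  rewrite (linopB Yl); have -> : Z x = Y x + Y x - Y (Y x) by rewrite YY addrK.
  rewrite !opprB -addrA; congr (_ + _).
  by rewrite addrC -addrA -opprD.
split.
  apply/bounded_operatorP; split.
    by move=> a x y; rewrite Yl scalerBr opprD addrACA.
  exists 2; split => // x; have := rnormD x (- Y x); rewrite rnormN.
  by have := Yle x; lra.
move=> x; rewrite lecE /=.
have -> : complex.Im (inner (x - Y x) x) = 0.
  have := innerC (x - Y x) x; have -> : inner x (x - Y x) = inner (x - Y x) x.
    apply: inner_hip_eq => a; rewrite (ipBr hs) scalerBr (ipBl hs).
    by rewrite -(linopZ Yl) Ysym.
  by case: (inner (x - Y x) x) => a b /= [h]; lra.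
rewrite eqxx /= -/(hip _ _) (ipBl hs) subr_ge0.
apply: le_trans (ip_cauchy_schwarz hs _ _) _; rewrite !hip_norm hip_sqr expr2.
by rewrite ler_wpM2r ?rnorm_ge0.
Qed.

End square_root.

End hilbert_operators.

(** * Monomials *)

Section monomials.
Variable R : realType.
Local Notation C := R[i].
Variables (X : lmodType C) (S P : X -> X).

Lemma big_ord_vanish (h : nat -> X) k n : (k <= n)%N ->
  (forall i, (k <= i)%N -> h i = 0) -> \sum_(i < k) h i = \sum_(i < n) h i.
Proof.
move=> kn h0; rewrite -!(big_mkord xpredT h) [RHS](big_cat_nat (n := k)) //=.
rewrite [X in _ + X]big1_seq ?addr0 // => i.
by rewrite mem_index_iota => /andP[_ /andP[/h0]].
Qed.

Lemma poly_atE (f : {poly {poly C}}) n m x :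
  (size f <= n)%N -> (forall i, (size (f`_i)%R <= m)%N) ->
  poly_at f S P x = \sum_(i < n) \sum_(j < m) f`_i`_j *: iter i S (iter j P x).
Proof.
move=> fn fm; rewrite /poly_at.
have inner_sum i : \sum_(j < size f`_i) f`_i`_j *: iter i S (iter j P x)
    = \sum_(j < m) f`_i`_j *: iter i S (iter j P x).
  apply: (big_ord_vanish (h := fun j => f`_i`_j *: iter i S (iter j P x))) => // j fj.
  by rewrite nth_default // scale0r.
under eq_bigr => i _ do rewrite inner_sum.
apply: (big_ord_vanish
  (h := fun i => \sum_(j < m) f`_i`_j *: iter i S (iter j P x))) => // i fi.
by rewrite big1 // => j _; rewrite nth_default ?nth_default ?size_poly0 // scale0r.
Qed.

Lemma poly_at_degree (f : {poly {poly C}}) : exists m, forall i, (size (f`_i)%R <= m)%N.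
Proof.
exists (\max_(i < size f) size (f`_i)%R)%N => i.
have [fi|fi] := leqP (size f) i; first by rewrite nth_default // size_poly0.
exact: (leq_bigmax (Ordinal fi)).
Qed.

Lemma poly_atD (f g : {poly {poly C}}) x :
  poly_at (f + g) S P x = poly_at f S P x + poly_at g S P x.
Proof.
have [mf hf] := poly_at_degree f; have [mg hg] := poly_at_degree g.
pose n := maxn (size f) (size g); pose m := maxn mf mg.
rewrite !(@poly_atE _ n m) ?leq_maxl ?leq_maxr //.
- rewrite -big_split; apply: eq_bigr => i _ /=; rewrite -big_split; apply: eq_bigr => j _ /=.
  by rewrite !coefD scalerDl.
- by move=> i; apply: leq_trans (hg i) (leq_maxr _ _).
- by move=> i; apply: leq_trans (hf i) (leq_maxl _ _).
- exact: size_polyD.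
- move=> i; rewrite coefD; apply: leq_trans (size_polyD _ _) _.
  by rewrite geq_max (leq_trans (hf i) (leq_maxl _ _)) (leq_trans (hg i) (leq_maxr _ _)).
Qed.

Lemma poly_at0 x : poly_at 0 S P x = 0.
Proof. by rewrite /poly_at size_poly0 big_ord0. Qed.

Lemma poly_at_sum n (F : nat -> {poly {poly C}}) x :
  poly_at (\sum_(k < n) F k) S P x = \sum_(k < n) poly_at (F k) S P x.
Proof.
elim: n => [|n IH]; first by rewrite !big_ord0 poly_at0.
by rewrite !big_ord_recr poly_atD IH.
Qed.

(** [c s^i p^j]: the outer variable is [s]. *)
Definition monomial (c : C) i j : {poly {poly C}} := (c *: 'X^j) *: 'X^i.

Lemma poly_at_monomial c i j x : poly_at (monomial c i j) S P x = c *: iter i S (iter j P x).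
Proof.
have ce k l : (monomial c i j)`_k`_l = if (k == i) && (l == j) then c else 0.
  rewrite /monomial coefZ coefXn; case: (k == i); rewrite ?mulr0 ?coef0 // mulr1.
  by rewrite coefZ coefXn; case: (l == j); rewrite ?mulr0 ?mulr1.
rewrite (@poly_atE _ i.+1 j.+1).
- rewrite big_ord_recr /= big1 => [|k _]; last first.
    by rewrite big1 // => l _; rewrite ce /= ltn_eqF ?ltn_ord // scale0r.
  rewrite add0r big_ord_recr /= big1 => [|l _]; last first.
    by rewrite ce /= (ltn_eqF (ltn_ord l)) andbF scale0r.
  by rewrite add0r ce !eqxx.
- by rewrite (leq_trans (size_scale_leq _ _)) // size_polyXn.
- move=> k; apply/leq_sizeP => l jl; rewrite ce.
  by rewrite [l == j]gtn_eqF ?andbF.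
Qed.

Lemma monomial_eval c i j (s p : C) : (monomial c i j).[s, p] = c * p ^+ j * s ^+ i.
Proof. by rewrite /monomial hornerZ hornerXn hornerM hornerZ hornerXn -rmorphXn hornerC. Qed.

Lemma horner2_sum n (F : nat -> {poly {poly C}}) (s p : C) :
  (\sum_(k < n) F k).[s, p] = \sum_(k < n) (F k).[s, p].
Proof. by rewrite !horner_sum. Qed.

Lemma horner2D (f g : {poly {poly C}}) (s p : C) :
  (f + g).[s, p] = f.[s, p] + g.[s, p].
Proof. by rewrite !hornerD. Qed.

End monomials.

(** * From a form inequality to an operator of numerical radius at most 1 *)

Section form_factorization.
Variable R : realType.
Local Notation C := R[i].
Variable H : hilbertType R.
Implicit Types x y z : H.
Local Notation hip := (@hip R H).
Let hs : semi_inner hip := @hip_semi R H.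

Lemma le_of_scaling (p a b : R) : 0 <= a -> 0 <= b ->
  (forall t, 0 < t -> t * p <= t ^+ 2 * a ^+ 2 + b ^+ 2) -> p <= 2 * a * b.
Proof.
move=> a0 b0 h; have [p0|p0] := lerP p 0.
  by apply: le_trans p0 _; rewrite !mulr_ge0.
have [a00|a1] := eqVneq a 0.
  have := h ((b ^+ 2 + 1) / p) ltac:(by rewrite divr_gt0 // ltr_wpDl ?sqr_ge0).
  by rewrite a00 expr0n mulr0 add0r divfK ?gt_eqF //; lra.
have ap : 0 < a by rewrite lt_neqAle eq_sym a1.
have a2 : 0 < 2 * a ^+ 2 by rewrite mulr_gt0 ?exprn_gt0.
have := h (p / (2 * a ^+ 2)) ltac:(by rewrite divr_gt0).
have -> : p / (2 * a ^+ 2) * p = p ^+ 2 / (2 * a ^+ 2) by field; rewrite gt_eqF.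
have -> : (p / (2 * a ^+ 2)) ^+ 2 * a ^+ 2 = p ^+ 2 / (2 * a ^+ 2) / 2.
  by field; rewrite gt_eqF.
move=> h1; have h2 : p ^+ 2 / (2 * a ^+ 2) <= 2 * b ^+ 2 by lra.
rewrite ler_pdivrMr // in h2.
rewrite -(ler_pXn2r (n := 2)) ?nnegrE ?mulr_ge0 ?(ltW p0) // !exprMn.
by apply: le_trans h2 _; rewrite le_eqVlt; apply/orP; left; apply/eqP; ring.
Qed.

Variables (D F : H -> H).
Hypotheses (D_lin : linop D) (F_lin : linop F).
Hypothesis D_sym : forall x y, hip (D x) y = hip x (D y).
Hypothesis form_le : forall (u : C) x, rnorm u = 1 ->
  hip (u *: F x) x <= hip (D x) (D x).

(** Polarisation over [1, -1, 'i, -'i] bounds [<F x, y>] by [|D x|^2 + |D y|^2];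
    rescaling [x] turns the sum into twice the product. *)
Lemma form_polarized x y : hip (F x) y <= 2 * rnorm (D x) * rnorm (D y).
Proof.
have i1 : rnorm ('i%C : C) = 1.
  apply/eqP; rewrite -(eqrXn2 (n := 2)) ?rnorm_ge0 ?ler01 //.
  by rewrite sqr_rnorm /= expr0n add0r.
have n1 : rnorm (- 1 : C) = 1 by rewrite rnormN rnorm1.
have ni1 : rnorm (- 'i%C : C) = 1 by rewrite rnormN.
have ii : 'i%C * 'i%C = -1 :> C by rewrite -expr2 sqr_i.
have iJ : (('i%C : C)^*)%C = - 'i%C by rewrite -[- 'i%C]/(Complex (-0) (-1)) oppr0.
have sum x' y' : hip (F x') y' <= rnorm (D x') ^+ 2 + rnorm (D y') ^+ 2.
  have h1 := form_le (x' + y') (@rnorm1 R).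
  have h2 := form_le (x' - y') n1.
  have h3 := form_le (x' + 'i%C *: y') i1.
  have h4 := form_le (x' - 'i%C *: y') ni1.
  have p1 := parallelogram hs (D x') (D y').
  have p2 := parallelogram hs (D x') ('i%C *: D y').
  rewrite [X in _ = _ + 2 * X](ipZZ hs) i1 expr1n mul1r in p2.
  rewrite !(linopD D_lin, linopN D_lin, linopZ D_lin) in h1 h2 h3 h4.
  rewrite -!hip_sqr.
  rewrite !(linopD F_lin, linopN F_lin, linopZ F_lin, scalerDr, scalerN, scaleN1r,
    scaleNr, scale1r, scalerA, ii, opprK, opprD) in h1 h2 h3 h4.
  have e1 : hip ('i%C *: F x') ('i%C *: y') = hip (F x') y'.
    by rewrite (ipZZ hs) i1 expr1n mul1r.
  have e2 : hip (F y') ('i%C *: y') = - hip ('i%C *: F y') y'.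
    by rewrite (ipJ hs) iJ scaleNr (ipNr hs) opprK.
  rewrite !(ipDl hs, ipDr hs, ipNl hs, ipNr hs, e1, e2) in h1 h2 h3 h4 p1 p2 *.
  by lra.
apply: le_of_scaling; rewrite ?rnorm_ge0 // => t t0.
have := sum (t%:C%C *: x) y.
by rewrite (linopZ F_lin) (linopZ D_lin) (ipZl hs) rnormZ exprMn rnorm_realE gtr0_norm.
Qed.

(** Douglas' factorisation is used twice, for [W^* D = F] and then [A^* D = W], so that
    [D A D = F]. The range and kernel conditions say that [A] lives on the closed
    range of [D]; they give the numerical radius on the whole space by projecting
    onto that range, where it is the form inequality and density. *)
Lemma operator_of_form : exists A : H -> H, [/\ linop A,
    forall x, rnorm (A x) <= 2 * rnorm x,
    (forall x, near_range D (A x)) /\ (forall z, D z = 0 -> A z = 0),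
    forall x, D (A (D x)) = F x
  & forall (u : C) x, rnorm u = 1 -> hip (u *: A x) x <= hip x x].
Proof.
have [|W [Wl Wr hW]] := factor_through D_lin F_lin.
  move=> y; exists (2 * rnorm (D y)) => x.
  by rewrite mulrAC form_polarized.
have WD y : rnorm (W y) <= 2 * rnorm (D y).
  apply: (near_range_bound (D := D)) => // [|x]; first by rewrite mulr_ge0 ?rnorm_ge0.
  by rewrite hW mulrAC form_polarized.
have [|A [Al Ar hA]] := factor_through D_lin Wl.
  move=> y; exists (2 * rnorm y) => x.
  have := ip_cauchy_schwarz hs (W x) y; rewrite !hip_norm => h.
  apply: le_trans h _; have := ler_wpM2r (rnorm_ge0 y) (WD x).
  by rewrite mulrAC.
have AD x : D (A (D x)) = F x.
  by apply: hip_uniq => z; rewrite -D_sym hA (ipC hs) hW (ipC hs).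
have A2 x : rnorm (A x) <= 2 * rnorm x.
  apply: (near_range_bound (D := D)) => // [|z]; first by rewrite mulr_ge0 ?rnorm_ge0.
  rewrite hA; have := ip_cauchy_schwarz hs (W z) x; rewrite !hip_norm => h.
  by apply: le_trans h _; have := ler_wpM2r (rnorm_ge0 x) (WD z); rewrite mulrAC.
have perp w : (forall x, hip (D x) w = 0) -> A w = 0.
  move=> Dw; apply: (near_range_uniq (D := D)) => // x.
  by rewrite hA; apply: near_range_orth Dw.
have num_range (u : C) d : rnorm u = 1 -> near_range D d -> hip (u *: A d) d <= hip d d.
  move=> u1 hd; apply/ler_addgt0Pr => e e0.
  have d0 := rnorm_ge0 d.
  pose k := 6 * rnorm d + 3.
  have k0 : 0 < k by rewrite /k; lra.
  pose e' := Num.min 1 (e / k).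
  have e'0 : 0 < e' by rewrite lt_min ltr01 divr_gt0.
  have e'1 : e' <= 1 by rewrite ge_min lexx.
  have e'k : k * e' <= e.
    by rewrite mulrC -ler_pdivlMr // ge_min lexx orbT.
  have [x hx] := hd e' e'0.
  set w := D x in hx; set r := d - w in hx.
  have dE : d = w + r by rewrite /r addrCA subrr addr0.
  have h1 : hip (u *: A w) w <= rnorm w ^+ 2.
    have := form_le x u1; rewrite -AD -(linopZ D_lin) D_sym.
    by rewrite [X in _ <= X]hip_sqr.
  have hAA v : rnorm (u *: A v) <= 2 * rnorm v by rewrite rnormZ u1 mul1r.
  have h2 : hip (u *: A w) r <= 2 * rnorm w * rnorm r.
    have := ip_cauchy_schwarz hs (u *: A w) r; rewrite !hip_norm => h.
    by apply: le_trans h _; rewrite ler_wpM2r ?rnorm_ge0.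
  have h3 : hip (u *: A r) d <= 2 * rnorm r * rnorm d.
    have := ip_cauchy_schwarz hs (u *: A r) d; rewrite !hip_norm => h.
    by apply: le_trans h _; rewrite ler_wpM2r ?rnorm_ge0.
  have h4 : rnorm w <= rnorm d + rnorm r.
    by have := rnormB d r; rewrite {1}dE addrK.
  have r0 := rnorm_ge0 r; have w0 := rnorm_ge0 w.
  have -> : hip (u *: A d) d = hip (u *: A w) w + hip (u *: A w) r + hip (u *: A r) d.
    by rewrite {1}dE (linopD Al) scalerDr (ipDl hs) {1}dE (ipDr hs).
  rewrite hip_sqr.
  have h5 : rnorm w ^+ 2 <= (rnorm d + rnorm r) ^+ 2.
    by rewrite ler_pXn2r ?nnegrE ?addr_ge0.
  have h6 : rnorm w * rnorm r <= (rnorm d + rnorm r) * rnorm r by rewrite ler_wpM2r.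
  have h7 : rnorm r * rnorm d <= e' * rnorm d by rewrite ler_wpM2r.
  have h8 : rnorm r * rnorm r <= e' by have := ler_pM r0 r0 hx (le_trans hx e'1); lra.
  rewrite /k in e'k; rewrite sqrrD in h5.
  lra.
exists A; split => //.
  split=> // z Dz; apply: perp => x; by rewrite D_sym Dz (ip0r hs).
move=> u x u1.
have [|Q [Ql Qr hQ]] := @factor_through R H D D D_lin D_lin.
  move=> y; exists (rnorm y) => z.
  by have := ip_cauchy_schwarz hs (D z) y; rewrite !hip_norm mulrC.
have Qx v : near_range D v -> hip v x = hip v (Q x).
  move=> hv; apply/eqP; rewrite -subr_eq0 -(ipBr hs); apply/eqP.
  by apply: near_range_orth hv _ => y; rewrite (ipBr hs) hQ subrr.
have AQ : A x = A (Q x).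
  apply/eqP; rewrite -subr_eq0 -(linopB Al); apply/eqP; apply: perp => y.
  by rewrite (ipBr hs) hQ subrr.
have nA v : near_range D (u *: A v).
  rewrite -[u *: _]addr0; apply: near_range_lin => // e e0.
  by exists 0; rewrite (linop0 D_lin) subrr rnorm0 ltW.
rewrite Qx // AQ; apply: le_trans (num_range u (Q x) u1 (Qr x)) _.
rewrite !hip_sqr ler_pXn2r ?nnegrE ?rnorm_ge0 //.
apply: (near_range_bound (D := D)) => // [|y]; first exact: rnorm_ge0.
by rewrite hQ mulrC; have := ip_cauchy_schwarz hs (D y) x; rewrite !hip_norm.
Qed.

End form_factorization.

(** * Operator norm, spectral radius and defect operator *)

Section norms_and_spectrum.
Variable R : realType.
Local Notation C := R[i].
Variable H : hilbertType R.
Implicit Types x y z : H.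
Local Notation hip := (@hip R H).
Let hs : semi_inner hip := @hip_semi R H.

Lemma op_norm_leP (T : H -> H) (B : R) : linop T -> 0 <= B ->
  (op_norm T <= B%:E)%E <-> forall x, rnorm (T x) <= B * rnorm x.
Proof.
move=> Tl B0; split=> [TB x|TB]; last first.
  apply: ge_ereal_sup => _ [x /= x1 <-]; rewrite lee_fin.
  by apply: le_trans (TB x) _; rewrite ler_piMr.
have [->|x0] := eqVneq x 0; first by rewrite linop0 // !rnorm0 mulr0.
have rx : 0 < rnorm x.
  by rewrite lt_neqAle rnorm_ge0 andbT eq_sym; apply: contra x0 => /eqP /rnorm_eq0 ->.
pose a : C := (rnorm x)^-1%:C%C.
have na : rnorm a = (rnorm x)^-1 by rewrite rnorm_realE ger0_norm // invr_ge0 ltW.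
have h : ((rnorm (T (a *: x)))%:E <= op_norm T)%E.
  apply: ereal_sup_ubound; exists (a *: x) => //=.
  by rewrite rnormZ na mulVf // gt_eqF.
have := le_trans h TB.
by rewrite lee_fin (linopZ Tl) rnormZ na mulrC ler_pdivrMr.
Qed.

(** For [|l| > 2] the operator [S - l] is bounded below, and it is onto because
    [x |-> (S x - y) / l] is a contraction. *)
Lemma spectral_radius_le2 (S : H -> H) : linop S ->
  (forall x, rnorm (S x) <= 2 * rnorm x) -> (spectral_radius S <= 2%:E)%E.
Proof.
move=> Sl S2; apply: ge_ereal_sup => _ [l /= sl <-]; rewrite lee_fin leNgt.
apply/negP => l2; apply: sl.
have l0 : l != 0 by apply/eqP => e; move: l2; rewrite e rnorm0; lra.
have lb x : (rnorm l - 2) * rnorm x <= rnorm (S x - l *: x).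
  have := rnormB (S x) (S x - l *: x); rewrite opprB addrCA subrr addr0 rnormZ.
  by have := S2 x; lra.
pose q := 2 / rnorm l; have rl : 0 < rnorm l by lra.
have q0 : 0 <= q by rewrite divr_ge0 // ltW.
have q1 : q < 1 by rewrite ltr_pdivrMr // mul1r.
have onto y : exists x, S x - l *: x = y.
  pose u := fix u n : H := if n is m.+1 then l^-1 *: (S (u m) - y) else 0.
  have uS n : u n.+1 = l^-1 *: (S (u n) - y) by [].
  pose g n : R := \sum_(k < n) q ^+ k.
  have gS n : g n.+1 - g n = q ^+ n by rewrite /g big_ord_recr /= addrAC subrr add0r.
  have gmono n : g n <= g n.+1 by rewrite -subr_ge0 gS exprn_ge0.
  have gb n : g n <= (1 - q)^-1.
    have := subrX1 q n; rewrite -/(g n) => e.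
    rewrite -[leRHS]mul1r ler_pdivlMr; last by lra.
    have -> : g n * (1 - q) = 1 - q ^+ n by rewrite -[RHS]opprB e; ring.
    by rewrite gerBl exprn_ge0.
  have qS x : rnorm (l^-1 *: S x) <= q * rnorm x.
    rewrite rnormZ rnormV mulrC ler_pdivrMr // /q mulrAC divfK ?gt_eqF //.
  have ustep n : rnorm (u n.+1 - u n) <= (g n.+1 - g n) * rnorm (u 1%N).
    rewrite gS; elim: n => [|n IH]; first by rewrite /= expr0 mul1r subr0.
    have -> : u n.+2 - u n.+1 = l^-1 *: S (u n.+1 - u n).
      rewrite (uS n.+1) [X in _ - X](uS n) -scalerBr; congr (_ *: _).
      by rewrite opprB addrA subrK (linopB Sl).
    apply: le_trans (qS _) _; rewrite exprS -[leRHS]mulrA.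
    by apply: ler_wpM2l.
  have [x hx] := dominated_limit (rnorm_ge0 _) gmono gb ustep.
  exists x; suff xE : x = l^-1 *: (S x - y).
    rewrite {2}xE scalerA divff // scale1r opprB addrCA subrr addr0 //.
  apply/eqP; rewrite -subr_eq0; apply/eqP.
  apply: (gap_vanish (K := 2 * rnorm (u 1%N)) gb) => n.
  have -> : x - l^-1 *: (S x - y) = (x - u n.+1) + l^-1 *: S (u n - x).
    rewrite uS (linopB Sl) -addrA; congr (_ + _).
    by rewrite -!scalerN -scalerDr; congr (_ *: _); rewrite !opprB addrA subrK.
  have h1 := rnormD (x - u n.+1) (l^-1 *: S (u n - x)).
  have h2 := qS (u n - x); have h3 := hx n; have h4 := hx n.+1.
  rewrite -opprB rnormN in h3.
  have h5 : q * rnorm (u n - x) <= rnorm (u n - x) by rewrite ler_piMl ?rnorm_ge0 // ltW.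
  have h6 := ler_wpM2r (rnorm_ge0 (u 1%N)) (gmono n).
  move: (sup _) h3 h4 => sg h3 h4; lra.
have [U hU] := choice onto.
have inj x x' : S x - l *: x = S x' - l *: x' -> x = x'.
  move=> e; apply/eqP; rewrite -subr_eq0; apply/eqP/rnorm_eq0/eqP.
  have := lb (x - x').
  have -> : S (x - x') - l *: (x - x') = 0.
    by rewrite (linopB Sl) scalerBr opprD addrACA -opprD e subrr.
  rewrite rnorm0 => h; rewrite eq_le rnorm_ge0 andbT.
  by rewrite -(ler_pM2l (x := rnorm l - 2)) ?mulr0 //; lra.
exists U; last by split=> // x; apply: inj; rewrite hU.
apply/bounded_operatorP; split.
  move=> a x y; apply: inj; rewrite hU Sl.
  rewrite scalerDr opprD addrACA hU; congr (_ + _).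
  by rewrite scalerA mulrC -scalerA -scalerBr hU.
exists (rnorm l - 2)^-1; split; first by rewrite invr_ge0; lra.
move=> x; rewrite mulrC ler_pdivlMr; last by lra.
by have := lb (U x); rewrite hU mulrC.
Qed.

End norms_and_spectrum.

Section defect_operator.
Variable R : realType.
Local Notation C := R[i].
Variable H : hilbertType R.
Implicit Types x y z : H.
Local Notation hip := (@hip R H).
Let hs : semi_inner hip := @hip_semi R H.

(** A form with real diagonal values is hermitian. *)
Lemma positive_symmetric (B : H -> H) : positive_operator B ->
  forall x y, hip (B x) y = hip x (B y).
Proof.
move=> [/bounded_operatorP[Bl _] Bpos] x y.
have im z : hip (- 'i%C *: B z) z = 0 by rewrite -Im_inner; exact: ger0_Im (Bpos z).
have iJ : (('i%C : C)^*)%C = - 'i%C by rewrite -[- 'i%C]/(Complex (-0) (-1)) oppr0.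
have E v w : hip (- 'i%C *: B v) w + hip (- 'i%C *: B w) v = 0.
  have := im (v + w); rewrite (linopD Bl) scalerDr !(ipDl hs) !(ipDr hs) !im; lra.
have := E ('i%C *: x) y; rewrite (linopZ Bl) scalerA mulNr -expr2 sqr_i opprK scale1r.
have -> : hip (- 'i%C *: B y) ('i%C *: x) = - hip (B y) x.
  by rewrite (ipC hs) (ipJ hs) iJ scalerA mulrNN -expr2 sqr_i scaleN1r (ipNr hs) (ipC hs).
by rewrite (ipC hs x); lra.
Qed.

Lemma defect_opP (P : H -> H) : bounded_operator P ->
  (forall x, rnorm (P x) <= rnorm x) ->
  [/\ linop (defect_op P), forall x y, hip (defect_op P x) y = hip x (defect_op P y)
    & forall x y, hip (P x) (P y) + hip (defect_op P x) (defect_op P y) = hip x y].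
Proof.
move=> Pb P1; have [Pl _] := (bounded_operatorP P).1 Pb.
have [/bounded_operatorP[Pal [M [M0 PaM]]] Pa] := adjointP Pb.
pose Z x := adjoint P (P x).
have Zl : linop Z by exact: linop_comp.
have Zh x y : hip (Z x) y = hip (P x) (P y) by rewrite (ipC hs) -Pa (ipC hs).
have Zsym x y : hip (Z x) y = hip x (Z y) by rewrite Zh Pa.
have Z1 x : rnorm (Z x) <= rnorm x.
  have h : rnorm (Z x) ^+ 2 <= rnorm x * rnorm (Z x).
    rewrite -hip_sqr Zh; apply: le_trans (ip_cauchy_schwarz hs _ _) _.
    by rewrite !hip_norm ler_pM ?rnorm_ge0.
  have [->|z0] := eqVneq (rnorm (Z x)) 0; first exact: rnorm_ge0.
  by rewrite -(ler_pM2r (x := rnorm (Z x))) -?expr2 // lt_neqAle eq_sym z0 rnorm_ge0.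
have [B Bpos BB] := square_root_exists Zl Z1 Zsym.
have [Dpos DD] := @xgetPex _ (fun=> 0) [set B : H -> H | positive_operator B /\
  forall x, B (B x) = x - adjoint P (P x)] (ex_intro _ B (conj Bpos BB)).
rewrite -/(sqrt_op _) -/(defect_op P) in Dpos DD.
have Dsym := positive_symmetric Dpos.
split => // [|x y]; first by case: Dpos => /bounded_operatorP[].
by rewrite Dsym DD (ipBr hs) -(Zsym x y) Zh addrC subrK.
Qed.

Lemma defect_spaceP (P : H -> H) v : defect_space P v <-> near_range (defect_op P) v.
Proof.
split=> [/closure_rnormP h e e0|h]; first by have [_ [y _ <-] hy] := h e e0; exists y.
apply/closure_rnormP => e e0; have [y hy] := h e e0.
by exists (defect_op P y) => //; exists y.
Qed.

End defect_operator.

(** * The form inequality characterises Gamma-contractions *)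

Section gamma_contractions.
Variable R : realType.
Local Notation C := R[i].
Variable H : hilbertType R.
Implicit Types x y z : H.
Local Notation hip := (@hip R H).
Let hs : semi_inner hip := @hip_semi R H.

(** On the closed bidisc [|2 a b - (a + b)| <= |2 - (a + b)|]. With [u = 1 - a] and
    [v = 1 - b] the difference of the squares is
    [2 |v|^2 (1 - |a|^2) + 2 |u|^2 (1 - |b|^2)]. *)
Lemma mobius_le (a b : C) : rnorm a <= 1 -> rnorm b <= 1 ->
  rnorm (2 * (a * b) - (a + b)) <= rnorm (2 - (a + b)).
Proof.
move=> a1 b1.
have sq (z : C) : rnorm z <= 1 -> rnorm z ^+ 2 <= 1.
  by move=> z1; rewrite exprn_ile1 ?rnorm_ge0.
rewrite -(ler_pXn2r (n := 2)) ?nnegrE ?rnorm_ge0 //.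
have := sq _ a1; have := sq _ b1; rewrite !sqr_rnorm {a1 b1 sq}.
case: a b => a1 a2 [b1 b2].
have -> : 2 * (Complex a1 a2 * Complex b1 b2) - (Complex a1 a2 + Complex b1 b2)
  = Complex (2 * (a1 * b1 - a2 * b2) - (a1 + b1)) (2 * (a1 * b2 + a2 * b1) - (a2 + b2)).
  by rewrite mulr_natl mulr2n; congr Complex => /=; ring.
have -> : 2 - (Complex a1 a2 + Complex b1 b2) = Complex (2 - (a1 + b1)) (- (a2 + b2)).
  have -> : 2 = Complex 2 0 :> C by rewrite -[2 in LHS](rmorph_nat (real_complex R)).
  by congr Complex => /=; ring.
move=> /= hb ha.
have h1 : 0 <= ((1 - b1) ^+ 2 + b2 ^+ 2) * (1 - (a1 ^+ 2 + a2 ^+ 2)).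
  by apply: mulr_ge0; rewrite ?subr_ge0 // addr_ge0 ?sqr_ge0.
have h2 : 0 <= ((1 - a1) ^+ 2 + a2 ^+ 2) * (1 - (b1 ^+ 2 + b2 ^+ 2)).
  by apply: mulr_ge0; rewrite ?subr_ge0 // addr_ge0 ?sqr_ge0.
rewrite -subr_ge0.
have -> : (2 - (a1 + b1)) ^+ 2 + (- (a2 + b2)) ^+ 2
   - ((2 * (a1 * b1 - a2 * b2) - (a1 + b1)) ^+ 2 + (2 * (a1 * b2 + a2 * b1) - (a2 + b2)) ^+ 2)
   = 2 * (((1 - b1) ^+ 2 + b2 ^+ 2) * (1 - (a1 ^+ 2 + a2 ^+ 2)))
   + 2 * (((1 - a1) ^+ 2 + a2 ^+ 2) * (1 - (b1 ^+ 2 + b2 ^+ 2))) by ring.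
lra.
Qed.

Variables S P : H -> H.
Hypotheses (S_bd : bounded_operator S) (P_bd : bounded_operator P).
Hypothesis SP : forall x, S (P x) = P (S x).
Hypothesis P_le1 : forall x, rnorm (P x) <= rnorm x.

Let Sl : linop S. Proof. by case/bounded_operatorP: S_bd. Qed.
Let Pl : linop P. Proof. by case/bounded_operatorP: P_bd. Qed.

Let D := defect_op P.
Let Dl : linop D. Proof. by case: (defect_opP P_bd P_le1). Qed.
Let D_sym x y : hip (D x) y = hip x (D y).
Proof. by case: (defect_opP P_bd P_le1). Qed.
Let PD x y : hip (P x) (P y) + hip (D x) (D y) = hip x y.
Proof. by case: (defect_opP P_bd P_le1). Qed.

Definition fundamental_lhs x := S x - adjoint S (P x).
Local Notation F := fundamental_lhs.

Lemma fundamental_lhs_lin : linop F.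
Proof.
have [/bounded_operatorP[Sal _] _] := adjointP S_bd.
by move=> a x y; rewrite /F Sl Pl Sal scalerBr opprD addrACA.
Qed.

Lemma hip_fundamental_lhs (u : C) x y :
  hip (u *: F x) y = hip (u *: S x) y - hip (u *: P x) (S y).
Proof.
have [_ Sa] := adjointP S_bd.
rewrite /F scalerBr (ipBl hs); congr (_ - _).
rewrite !(ipJ hs) -(linopZ Sl).
by rewrite (ipC hs) -Sa (ipC hs).
Qed.

Lemma poly_at_lin f : linop (poly_at f S P).
Proof.
apply: linop_bigsum => i; apply: linop_bigsum => j; apply: linop_scale.
exact: linop_comp (linop_iter i Sl) (linop_iter j Pl).
Qed.

Section necessity.
Hypothesis gamma : Gamma_contraction S P.

Lemma gamma_poly_le (f : {poly {poly C}}) (B : R) : 0 <= B ->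
  (forall z1 z2 : C, rnorm z1 <= 1 -> rnorm z2 <= 1 ->
     rnorm f.[z1 + z2, z1 * z2] <= B) ->
  forall x, rnorm (poly_at f S P x) <= B * rnorm x.
Proof.
move=> B0 fB; case: gamma => _ _ _ g.
apply/(op_norm_leP (poly_at_lin f) B0); apply: le_trans (g f) _.
apply: ge_ereal_sup => _ [_ [z1 [z2 [h1 h2 ->]]] <-] /=.
by rewrite lee_fin fB.
Qed.

Lemma gamma_norm_le2 x : rnorm (S x) <= 2 * rnorm x.
Proof.
have h (z1 z2 : C) : rnorm z1 <= 1 -> rnorm z2 <= 1 ->
    rnorm (monomial 1 1 0).[z1 + z2, z1 * z2] <= 2.
  by move=> h1 h2; rewrite monomial_eval expr0 !mul1r expr1; have := rnormD z1 z2; lra.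
by have := @gamma_poly_le (monomial 1 1 0) 2 ltac:(lra) h x; rewrite poly_at_monomial scale1r.
Qed.

(** The truncations of the power series in [s] of [(a p - h s) / (1 - b s)]. *)
Definition mobius_trunc (a h b : C) N : {poly {poly C}} :=
  \sum_(k < N) (monomial (b ^+ k * a) k 1 + monomial (- (b ^+ k * h)) k.+1 0).

Lemma mobius_trunc_eval a h b N (s p : C) :
  (1 - b * s) * (mobius_trunc a h b N).[s, p]
    = (a * p - h * s) * (1 - (b * s) ^+ N).
Proof.
rewrite /mobius_trunc (@horner2_sum R N
  (fun k => monomial (b ^+ k * a) k 1 + monomial (- (b ^+ k * h)) k.+1 0)).
have -> : \sum_(k < N) (monomial (b ^+ k * a) k 1 + monomial (- (b ^+ k * h)) k.+1 0).[s, p]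
   = (a * p - h * s) * \sum_(k < N) (b * s) ^+ k.
  rewrite mulr_sumr; apply: eq_bigr => k _.
  by rewrite horner2D !monomial_eval expr0 expr1 exprS exprMn; ring.
have -> : 1 - (b * s) ^+ N = (1 - b * s) * \sum_(k < N) (b * s) ^+ k.
  by rewrite -[LHS]opprB subrX1 -mulNr opprB.
by rewrite mulrCA.
Qed.

Lemma pencil_lin (a h : C) : linop (fun y => a *: P y - h *: S y).
Proof.
move=> c y z; rewrite Pl Sl (scalerDr a) (scalerDr h) opprD addrACA scalerBr.
by rewrite !scalerA (mulrC a) (mulrC h).
Qed.

Lemma poly_at_mobius_trunc a h b N x :
  poly_at (mobius_trunc a h b N) S P (x - b *: S x)
    = (fun y => a *: P y - h *: S y) (x - b ^+ N *: iter N S x).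
Proof.
pose G y := a *: P y - h *: S y.
have Gl : linop G by exact: pencil_lin.
pose t k := b ^+ k *: iter k S x.
rewrite /mobius_trunc (@poly_at_sum R H S P N
  (fun k => monomial (b ^+ k * a) k 1 + monomial (- (b ^+ k * h)) k.+1 0)).
transitivity (\sum_(0 <= k < N) G (t k - t k.+1)).
  rewrite big_mkord; apply: eq_bigr => k _.
  have -> : t k - t k.+1 = b ^+ k *: iter k S (x - b *: S x).
    rewrite (linopB (linop_iter k Sl)) (linopZ (linop_iter k Sl)) -iterSr scalerBr.
    by rewrite scalerA -exprSr.
  move: (x - b *: S x) => y.
  rewrite poly_atD !poly_at_monomial /= (linopZ Gl) scalerBr !scalerA.
  by rewrite scaleNr (commute_iter k (fun z => esym (SP z))).
rewrite -(big_morph G (linopD Gl) (linop0 Gl)).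
rewrite -[in RHS]/(G _); congr (G _).
have -> : \sum_(0 <= k < N) (t k - t k.+1) = - \sum_(0 <= k < N) (t k.+1 - t k).
  by rewrite -sumrN; apply: eq_bigr => k _; rewrite opprB.
by rewrite telescope_sumr // opprB /t expr0 scale1r.
Qed.

Lemma iterS_le N x : rnorm (iter N S x) <= 2 ^+ N * rnorm x.
Proof.
elim: N => [|N IH]; first by rewrite expr0 mul1r.
by apply: le_trans (gamma_norm_le2 _) _; rewrite exprS -mulrA ler_wpM2l.
Qed.

(** For [|u| = 1] the function [(2 u p - s) / (2 - u s)] is bounded by [1] on
    [Gamma]. It is evaluated at [(r s, r^2 p)], where its expansion in powers of
    [s] converges uniformly, so that the polynomials [mobius_trunc] are bounded by
    [1 + r^N]; applied to [x - b S x] they telescope. *)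
Lemma mobius_contractive_inside (u : C) (r : R) x : rnorm u = 1 -> 0 < r -> r < 1 ->
  rnorm ((u * (r ^+ 2)%:C%C) *: P x - (r / 2)%:C%C *: S x)
    <= rnorm (x - (u * (r / 2)%:C%C) *: S x).
Proof.
move=> u1 r0 r1.
set a := u * _; set h := (r / 2)%:C%C; set b := u * _.
have na : rnorm a = r ^+ 2 by rewrite rnormM u1 mul1r rnorm_realE ger0_norm ?sqr_ge0.
have nh : rnorm h = r / 2 by rewrite rnorm_realE ger0_norm // divr_ge0 // ltW.
have nb : rnorm b = r / 2 by rewrite rnormM u1 mul1r -/h nh.
have two : 2 * h = r%:C%C.
  by rewrite -(rmorph_nat (real_complex R)) -rmorphM /=; congr _%:C%C; field.
have rC : rnorm (r%:C%C : C) = r by rewrite rnorm_realE gtr0_norm.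
have fB N (z1 z2 : C) : rnorm z1 <= 1 -> rnorm z2 <= 1 ->
    rnorm (mobius_trunc a h b N).[z1 + z2, z1 * z2] <= 1 + r ^+ N.
  move=> h1 h2; set s := z1 + z2; set p := z1 * z2.
  have ur (z : C) : rnorm z <= 1 -> rnorm (u * r%:C%C * z) <= r.
    by move=> z1'; rewrite !rnormM u1 rC mul1r ler_piMr // ltW.
  have bs : rnorm (b * s) <= r.
    have -> : b * s = (2^-1)%:C%C * (u * r%:C%C * z1 + u * r%:C%C * z2).
      have hh : (2^-1 : R)%:C%C * 2 = 1 :> C.
        by rewrite -(rmorph_nat (real_complex R)) -rmorphM /= mulVf.
      transitivity ((2^-1 : R)%:C%C * 2 * (b * s)); first by rewrite hh mul1r.
      by rewrite -two /b /s; ring.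
    rewrite rnormM rnorm_realE ger0_norm ?invr_ge0 //.
    have := rnormD (u * r%:C%C * z1) (u * r%:C%C * z2).
    have := ur _ h1; have := ur _ h2; lra.
  have den : 0 < rnorm (1 - b * s).
    have := rnormD (1 - b * s) (b * s); rewrite subrK rnorm1; lra.
  rewrite -(ler_pM2l den) -rnormM mobius_trunc_eval rnormM.
  apply: ler_pM; rewrite ?rnorm_ge0 //; last first.
    apply: le_trans (rnormD _ _) _; rewrite rnorm1 rnormN lerD2l rnormX.
    by rewrite lerXn2r ?nnegrE ?rnorm_ge0 ?(ltW r0).
  (* Up to factors of modulus 2, this is mobius_le at u r z1 and u r z2. *)
  have := @mobius_le (u * r%:C%C * z1) (u * r%:C%C * z2)
    (le_trans (ur _ h1) (ltW r1)) (le_trans (ur _ h2) (ltW r1)).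
  have -> : 2 * (u * r%:C%C * z1 * (u * r%:C%C * z2)) - (u * r%:C%C * z1 + u * r%:C%C * z2)
     = 2 * u * (a * p - h * s).
    by rewrite -two /a /p /s rmorphXn /= -two; ring.
  have -> : 2 - (u * r%:C%C * z1 + u * r%:C%C * z2) = 2 * (1 - b * s).
    by rewrite -two /b -/h /s; ring.
  rewrite -mulrA rnormM [leRHS]rnormM ler_pM2l; last first.
    by rewrite -(rmorph_nat (real_complex R)) rnorm_realE ger0_norm.
  by rewrite rnormM u1 mul1r.
pose G y := a *: P y - h *: S y.
have GE y : G y = a *: P y - h *: S y by [].
have G2 y : rnorm (G y) <= 2 * rnorm y.
  apply: le_trans (rnormB _ _) _; rewrite !rnormZ na nh.
  have y0 := rnorm_ge0 y.
  have h1 : r ^+ 2 * rnorm (P y) <= 1 * rnorm y.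
    by rewrite ler_pM ?sqr_ge0 ?rnorm_ge0 // exprn_ile1 ?ltW.
  have h2 : r / 2 * rnorm (S y) <= 2^-1 * (2 * rnorm y).
    by rewrite ler_pM ?rnorm_ge0 ?gamma_norm_le2 //; lra.
  lra.
have GB v w : G (v - w) = G v - G w by exact: (linopB (pencil_lin a h)).
rewrite -/(G x); apply/ler_addgt0Pr => e e0.
have x0 := rnorm_ge0 x; set y := x - b *: S x; have y0 := rnorm_ge0 y.
have [N hN] := @geometric_small R r (e / (rnorm y + 2 * rnorm x + 1)) (ltW r0) r1
  ltac:(by rewrite divr_gt0 //; lra).
have := gamma_poly_le (B := 1 + r ^+ N) ltac:(by rewrite addr_ge0 // exprn_ge0 // ltW)
  (fB N) y.
rewrite poly_at_mobius_trunc -/(G _) GB => h1.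
have h2 : rnorm (G (b ^+ N *: iter N S x)) <= 2 * (r ^+ N * rnorm x).
  apply: le_trans (G2 _) _; rewrite ler_wpM2l // rnormZ rnormX nb.
  apply: le_trans (ler_wpM2l _ (iterS_le N x)) _; first by rewrite exprn_ge0 // divr_ge0 // ltW.
  by rewrite mulrA -exprMn divfK.
have h3 := rnormD (G x - G (b ^+ N *: iter N S x)) (G (b ^+ N *: iter N S x)).
rewrite subrK in h3.
have h4 : r ^+ N * (rnorm y + 2 * rnorm x) <= e.
  have k0 : 0 <= rnorm y + 2 * rnorm x by lra.
  apply: le_trans (ler_wpM2r k0 hN) _; rewrite mulrAC ler_pdivrMr; last by lra.
  by have := ltW e0; lra.
lra.
Qed.

Lemma mobius_contractive (u : C) x : rnorm u = 1 ->
  rnorm (u *: P x - (2^-1)%:C%C *: S x) <= rnorm (x - (u * (2^-1)%:C%C) *: S x).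
Proof.
move=> u1; apply/ler_addgt0Pr => e e0; have x0 := rnorm_ge0 x.
pose d := Num.min 2^-1 (e / (4 * rnorm x + 1)).
have d0 : 0 < d by rewrite lt_min invr_gt0 ltr0n divr_gt0 //; lra.
have d2 : d <= 2^-1 by rewrite ge_min lexx.
have de : 4 * (d * rnorm x) <= e.
  have h : d * (4 * rnorm x + 1) <= e by rewrite -ler_pdivlMr ?ge_min ?lexx ?orbT //; lra.
  lra.
pose r := 1 - d.
have := @mobius_contractive_inside u r x u1 ltac:(rewrite /r; lra) ltac:(rewrite /r; lra).
set v := _ - _; set w := x - _ => vw.
have hP : rnorm ((u * (1 - r ^+ 2)%:C%C) *: P x) <= 2 * d * rnorm x.
  rewrite rnormZ rnormM u1 mul1r rnorm_realE.
  have h : 0 <= 1 - r ^+ 2 <= 2 * d.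
    have -> : 1 - r ^+ 2 = 2 * d - d * d by rewrite /r; ring.
    have := sqr_ge0 d; have := mulr_ge0 (ltW d0) (_ : 0 <= 1 - d); rewrite subr_ge0 expr2.
    by move=> /(_ ltac:(lra)); lra.
  case/andP: h => h1 h2; rewrite ger0_norm //.
  by rewrite ler_pM ?rnorm_ge0.
have hS (c : C) : rnorm c = d / 2 -> rnorm (c *: S x) <= d * rnorm x.
  move=> nc; rewrite rnormZ nc.
  have hd : 0 <= d / 2 by rewrite divr_ge0 // ltW.
  have := ler_wpM2l hd (gamma_norm_le2 x); lra.
have nd : rnorm ((d / 2)%:C%C : C) = d / 2.
  by rewrite rnorm_realE ger0_norm // divr_ge0 // ltW.
have -> : u *: P x - (2^-1)%:C%C *: S x
    = v + (u * (1 - r ^+ 2)%:C%C) *: P x - (d / 2)%:C%C *: S x.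
  have -> : v + (u * (1 - r ^+ 2)%:C%C) *: P x
      = (u * (r ^+ 2)%:C%C + u * (1 - r ^+ 2)%:C%C) *: P x - (r / 2)%:C%C *: S x.
    by rewrite /v addrAC -scalerDl.
  rewrite -addrA -opprD -scalerDl -mulrDr -!rmorphD /=.
  have -> : r ^+ 2 + (1 - r ^+ 2) = 1 by ring.
  have -> : r / 2 + d / 2 = 2^-1 by rewrite /r; field.
  by rewrite mulr1.
have wE : w = x - (u * (2^-1)%:C%C) *: S x + (u * (d / 2)%:C%C) *: S x.
  rewrite /w -addrA -scaleNr -[in RHS]scaleNr -scalerDl; congr (_ + _ *: _).
  rewrite -mulrN -[in RHS]mulrN -mulrDr -!rmorphN -rmorphD /=; congr (_ * _%:C%C).
  by rewrite /r; field.
have h1 := rnormB (v + (u * (1 - r ^+ 2)%:C%C) *: P x) ((d / 2)%:C%C *: S x).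
have h2 := rnormD v ((u * (1 - r ^+ 2)%:C%C) *: P x).
have h3 := rnormD (x - (u * (2^-1)%:C%C) *: S x) ((u * (d / 2)%:C%C) *: S x).
rewrite -wE in h3.
have h4 := hS (u * (d / 2)%:C%C) ltac:(by rewrite rnormM u1 mul1r nd).
have h5 := hS _ nd; lra.
Qed.

(** The square of [mobius_contractive]: the terms in [|S x|^2] cancel. *)
Lemma gamma_form_le (u : C) x : rnorm u = 1 -> hip (u *: F x) x <= hip (D x) (D x).
Proof.
move=> u1; rewrite hip_fundamental_lhs.
have := mobius_contractive x u1.
rewrite -(ler_pXn2r (n := 2)) ?nnegrE ?rnorm_ge0 // -!hip_sqr.
have qu v : hip (u *: v) (u *: v) = hip v v by rewrite (ipZZ hs) u1 expr1n mul1r.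
rewrite [u * _]mulrC -scalerA.
rewrite !(ipBl hs, ipBr hs) !(ipZl hs) !(ipZr hs) !qu.
rewrite (ipC hs (S x) (u *: P x)) (ipC hs x (u *: S x)).
by have := PD x x; lra.
Qed.

End necessity.

Lemma form_of_factorization (A : H -> H) : bounded_operator_on (defect_space P) A ->
  (numerical_radius_on (defect_space P) A <= 1)%E ->
  (forall x, F x = D (A (D x))) ->
  forall (u : C) x, rnorm u = 1 -> hip (u *: F x) x <= hip (D x) (D x).
Proof.
move=> [Ar Al _] A1 FA u x u1.
have inr v : defect_space P (D v).
  by apply/defect_spaceP => e e0; exists v; rewrite subrr rnorm0 ltW.
have in0 : defect_space P 0 by rewrite -(linop0 Dl).
have A0 : A 0 = 0.
  have := Al 1 0 0 in0 in0; rewrite !scale1r addr0 => /esym/eqP.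
  by rewrite -subr_eq0 addrK => /eqP.
rewrite FA -(linopZ Dl) D_sym.
have [d0|d0] := eqVneq (rnorm (D x)) 0.
  by rewrite (rnorm_eq0 d0) !(ip0r hs).
have dp : 0 < rnorm (D x) by rewrite lt_neqAle eq_sym d0 rnorm_ge0.
pose c := (rnorm (D x))^-1; have c0 : 0 < c by rewrite invr_gt0.
have nDc : rnorm (D (c%:C%C *: x)) = 1.
  by rewrite (linopZ Dl) rnormZ rnorm_realE gtr0_norm // mulVf.
have : ((rnorm (inner (A (D (c%:C%C *: x))) (D (c%:C%C *: x))))%:E <= 1)%E.
  apply: le_trans A1; apply: ereal_sup_ubound.
  by exists (D (c%:C%C *: x)) => //=; split; [exact: inr|rewrite nDc].
rewrite lee_fin => h.
have := le_trans (hip_le_rnorm_inner (A (D (c%:C%C *: x))) (D (c%:C%C *: x)) u1) h.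
rewrite (linopZ Dl).
have := Al c%:C%C (D x) 0 (inr x) in0; rewrite A0 !addr0 => ->.
rewrite scalerA mulrC -scalerA (ipZl hs) (ipZr hs) mulrA => h1.
rewrite hip_sqr.
have cd : c * rnorm (D x) = 1 by rewrite mulVf.
have dd : 0 < c * c by rewrite mulr_gt0.
rewrite -(ler_pM2l dd) (le_trans h1) // expr2 mulrACA cd mulr1 //.
Qed.

Lemma resolvent_of_spectral_radius : (spectral_radius S <= 2%:E)%E ->
  forall z : C, 2 < rnorm z -> has_resolvent hip S z.
Proof.
move=> rS z z2; apply: contrapT => nr.
have sz : spectrum S z.
  move=> [U /bounded_operatorP[_ [M [_ hM]]] [US SU]]; apply: nr.
  by exists U; split => //; exists M => x; rewrite !hip_norm.
have : ((rnorm z)%:E <= 2%:E)%E.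
  by apply: le_trans rS; apply: ereal_sup_ubound; exists z.
by rewrite lee_fin leNgt z2.
Qed.

(** The relation [D S = A D + A^* D P] required by the dilation holds because [D]
    annihilates the difference of both sides, by [D A D = S - S^* P] and its adjoint,
    and that difference lies in the closed range of [D], where [D] is injective. *)
Lemma gamma_of_form : (spectral_radius S <= 2%:E)%E ->
  (forall (u : C) x, rnorm u = 1 -> hip (u *: F x) x <= hip (D x) (D x)) ->
  Gamma_contraction S P.
Proof.
move=> rS form; split => // f.
have [A [Al A2 [Ar Ak] DAD Anum]] := operator_of_form Dl fundamental_lhs_lin D_sym form.
have [Ad [Adl Ad2 hAd]] := adjoint_exists Al (ler0n R 2) A2.
have FE x y : hip (F x) y = hip (S x) y - hip (P x) (S y).
  by have := hip_fundamental_lhs 1 x y; rewrite !scale1r.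
have S_adj x y : hip (S x) y = hip (P x) (S y) + hip (A (D x)) (D y).
  by rewrite -D_sym DAD FE addrC subrK.
have DS x : D (S x) = A (D x) + Ad (D (P x)).
  apply/eqP; rewrite -subr_eq0; apply/eqP; apply: hip_eq0.
  set z := D (S x) - _.
  have Dz : D z = 0.
    apply: hip_uniq => w; rewrite (ip0r hs) -D_sym /z (ipBr hs) (ipDr hs).
    have -> : hip (D w) (D (S x)) = hip w (S x) - hip (P w) (P (S x)).
      by rewrite -(PD w (S x)) addrC addKr.
    have -> : hip (D w) (A (D x)) = hip w (S x) - hip (S w) (P x).
      by rewrite D_sym DAD (ipC hs) FE (ipC hs) (ipC hs (P x)).
    have -> : hip (D w) (Ad (D (P x))) = hip (S w) (P x) - hip (P w) (P (S x)).
      by rewrite -hAd -D_sym DAD FE SP.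
    lra.
  rewrite {2}/z (ipBr hs) (ipDr hs) -D_sym Dz (ip0l hs) -hAd (Ak _ Dz) (ip0l hs).
  rewrite (ipC hs z) (near_range_orth (Ar (D x))) ?addr0 ?subr0 // => y.
  by rewrite D_sym Dz (ip0r hs).
have [_ [M [M0 SM]]] := (bounded_operatorP S).1 S_bd.
have grow x r : 2 < r -> exists K, forall n, inorm hip (iter n S x) <= K * r ^+ n.
  move=> r2.
  have SM1 : bounded_by hip (M + 1) S.
    by move=> y; rewrite !hip_norm mulrDl mul1r (le_trans (SM y)) // lerDl rnorm_ge0.
  have M1 : 0 < M + 1 by rewrite ltr_wpDl.
  have [K K0 hK] := growth_of_spectrum hs Sl M1 SM1
    (resolvent_of_spectral_radius rS) r2.
  by exists (K * inorm hip x) => n; rewrite mulrAC; exact: hK.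
have toB (T : H -> H) c : (forall x, rnorm (T x) <= c * rnorm x) -> bounded_by hip c T.
  by move=> h x; rewrite !hip_norm.
set s := ereal_sup _.
have sub (z1 z2 : C) : rnorm z1 <= 1 -> rnorm z2 <= 1 ->
    ((rnorm f.[z1 + z2, z1 * z2])%:E <= s)%E.
  move=> h1 h2; apply: ereal_sup_ubound; exists (z1 + z2, z1 * z2) => //.
  by exists z1, z2.
have s0 : (0 <= s)%E.
  have z1 : rnorm (0 : C) <= 1 by rewrite rnorm0.
  apply: le_trans (sub 0 0 z1 z1); rewrite lee_fin; exact: rnorm_ge0.
case: s s0 sub => [B|_ _|//]; last exact: leey.
rewrite lee_fin => B0 sub.
apply/(op_norm_leP (poly_at_lin f) B0) => x.
have := @dilation_bound R H hip hs S P D A Ad 2 Sl Pl Dl Al Adl SP PD hAd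
  (ler0n R 2) (toB _ _ A2) (toB _ _ Ad2) Anum S_adj DS grow f B B0 _ x.
rewrite !hip_norm; apply => a b a1 b1.
by have := sub a b; rewrite lee_fin a1 b1; apply.
Qed.

End gamma_contractions.

Theorem theorem4p4 (R : realType) (H : hilbertType R) (S P : H -> H) :
  separable H ->
  bounded_operator S -> bounded_operator P ->
  (forall x, S (P x) = P (S x)) ->
  (op_norm P <= 1)%E ->
  Gamma_contraction S P <->
  (spectral_radius S <= 2%:E)%E /\
  exists A : H -> H,
    [/\ bounded_operator_on (defect_space P) A,
        (numerical_radius_on (defect_space P) A <= 1)%E
      & forall x, S x - adjoint S (P x) =
                  defect_op P (A (defect_op P x))].
Proof.
move=> _ Sb Pb SP P1.
have [Pl _] := (bounded_operatorP P).1 Pb; have [Sl _] := (bounded_operatorP S).1 Sb.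
have P_le1 x : rnorm (P x) <= rnorm x.
  by have := (op_norm_leP Pl ler01).1 P1 x; rewrite mul1r.
have [Dl Dsym _] := defect_opP Pb P_le1.
split=> [gamma|[rS [A [Ab A1 AE]]]]; last first.
  apply: gamma_of_form => //.
  exact: (form_of_factorization Pb P_le1 Ab A1 AE).
split; first by apply: spectral_radius_le2 => // x; exact: gamma_norm_le2 gamma x.
have [A [Al A2 [Ar _] DAD Anum]] := operator_of_form Dl (fundamental_lhs_lin Sb Pb) Dsym
  (fun u x => gamma_form_le Sb Pb SP P_le1 gamma x).
exists A; split => [||x]; last by rewrite DAD.
  split=> [x _|a x y _ _|]; [exact/defect_spaceP|exact: Al|by exists 2 => x _].
apply: ge_ereal_sup => _ [x /= [_ x1] <-]; rewrite lee_fin.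
apply: rnorm_inner_le => u u1; apply: le_trans (Anum u x u1) _.
by rewrite hip_sqr exprn_ile1 ?rnorm_ge0.
Qed.
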